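(* Let $X$ be a complex manifold with $\dim_{\mathbb{C}}X=2$ and $\Omega\Subset X$ a relatively compact domain with $C^3$-smooth Levi-flat boundary $M=\partial\Omega$. Suppose that $\Omega$ has a $C^3$-smooth boundary distance function $\delta$ with positive Diederich--Fornaess exponent in the weak sense, $\eta_\delta>0$, and let $h_\delta$ be the hermitian metric of the normal bundle $N^{1,0}$ of $M$ induced from $\delta$. Then for every $p\in M$ the local Diederich--Fornaess exponent $\eta_\delta(p)$ is determined by the ratio of $i\Theta_{h_\delta}(p)$ and $iA_{h_\delta}(p)$, namely $$\eta_\delta(p)=\left(1+\frac{iA_{h_\delta}(p)}{i\Theta_{h_\delta}(p)}\right)^{-1}.$$
   Context: Let $J_X$ be the complex structure of $X$. Boundary distance function: a $C^2$-smooth function $\delta:\overline{\Omega}\to\mathbb{R}$ such that $\Omega=\{\delta>0\}$ and $d\delta\neq0$ on $\partial\Omega$ (so $\delta=0$ on $\partial\Omega$). Diederich--Fornaess exponent (in the weak sense): $\eta_\delta$ is the supremum of $\eta\in(0,1)$ such that $-\delta^\eta$ is strictly plurisubharmonic in $\Omega$ except on a compact subset of $\Omega$; $\eta_\delta=0$ if there is no such $\eta$. Local Diederich--Fornaess exponent: for $p\in\partial\Omega$, $\eta_\delta(p)$ is the supremum of $\eta\in(0,1)$ such that $-\delta^\eta$ is strictly plurisubharmonic on $U\cap\Omega$ for some neighborhood $U$ of $p$ in $X$; $\eta_\delta(p)=0$ if there is no such $\eta$. Levi-flatness: a smooth real hypersurface $M\subset X$ is Levi-flat if it locally separates $X$ into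 two Stein domains; equivalently, $M$ has a foliation $\mathcal{F}$ (the Levi foliation) by non-singular complex hypersurfaces of $X$ (here complex curves). Its tangent bundle is $T\mathcal{F}=TM\cap J_XTM$, identified with the CR structure $T^{1,0}M\subset T^{1,0}X|_M$. When $M$ is $C^3$-smooth, $\mathcal{F}$ is $C^3$-smooth (Barrett--Fornaess), so $M$ is covered by foliated charts with $C^3$-smooth parametrizations $\varphi:\mathbb{C}\times\mathbb{R}\supset V\to M$, $(z',t)\mapsto\varphi(z',t)$, holomorphic in $z'$, where the leaves are given locally by $t=\text{const}$. Normal bundle: $N^{1,0}=\mathbb{C}\otimes(TM/T\mathcal{F})$. In a foliated chart it is trivialized by the class of $\partial/\partial t$, and a hermitian metric $h$ of $N^{1,0}$ is represented by the positive function $h(z',t)$ giving the norm (not the squared norm) of the class of $\partial/\partial t$. Induced metric: for a $C^3$-smooth boundary distance function $\delta$, the hermitian metric $h_\delta$ of $N^{1,0}$ is given in each foliated chart by the $C^2$-smooth function $h_\delta(z',t)=\left|\left(J_X\varphi_*\frac{\partial}{\partial t}\right)\delta\right|$. Leafwise operators: in a foliated chart with coordinate $(z',t)$, $\partial_bf=\frac{\partial f}{\partial z'}dz'$ and $\overline{\partial}_bf=\frac{\partial f}{\partial\overline{z'}}d\overline{z'}$. The Chern curvature along the leaves is $i\Theta_h=-i\partial_b\overline{\partial}_b\log h$, and $iA_h=i\partial_b\log h\wedge\overline{\partial}_b\log h$; both are computed from the local functions representing $h$ and are independent of the foliated chart. Since the leaves have complex dimension one, $i\Theta_{h_\delta}(p)$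 and $iA_{h_\delta}(p)$ are real multiples of the same form $i\,dz'\wedge d\overline{z'}$, and their ratio is the ratio of the coefficients.
   Formalization: The formula is proved at those points p where the curvature forms iΘ and iA do not both vanish, with iΘ(p) ≠ 0 as part of the conclusion; where both vanish, which the hypotheses permit, the ratio is 0/0 and the formula has no meaning. *)

(* Defs.v *)
From mathcomp Require Import all_boot all_order all_algebra.
From mathcomp Require Import complex.
From mathcomp Require Import all_classical all_reals all_analysis.

Set Implicit Arguments.
Unset Strict Implicit.
Unset Printing Implicit Defensive.

Import Order.TTheory GRing.Theory Num.Theory.
Import numFieldNormedType.Exports.

Local Open Scope classical_set_scope.
Local Open Scope ring_scope.
Local Open Scope complex_scope.

(* C^n as the real normed space of pairs of blocks (x, y), z_j = x_j + i y_j *)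
Notation cspace R n := 'rV[R]_(n + n).

Section Calculus.
Variable R : realType.

(* For open U: all directional derivatives up to order k exist and are
   continuous on U. *)
Fixpoint Ck_on (V W : normedModType R) (k : nat) (U : set V) (f : V -> W)
    : Prop :=
  match k with
  | 0 => forall x, U x -> {for x, continuous f}
  | k'.+1 => (forall x, U x -> differentiable f x) /\
             (forall v : V, Ck_on k' U ('D_v f))
  end.

Definition cderive (V : normedModType R) (v : V) (g : V -> R[i]) (x : V)
    : R[i] :=
  ('D_v (fun y => complex.Re (g y) : R^o) x) +i* ('D_v (fun y => complex.Im (g y) : R^o) x).

(* d/dz and d/dzbar for the complex coordinate z = a + i b whose real
   coordinate directions are u = d/da and v = d/db *)
Definition wirt (V : normedModType R) (u v : V) (g : V -> R[i]) (x : V)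
    : R[i] :=
  (cderive u g x - (0 +i* 1) * cderive v g x) / 2%:R.

Definition wirtbar (V : normedModType R) (u v : V) (g : V -> R[i]) (x : V)
    : R[i] :=
  (cderive u g x + (0 +i* 1) * cderive v g x) / 2%:R.

Section Cn.
Variable n : nat.

Definition xdir (j : 'I_n) : cspace R n := delta_mx 0 (lshift n j).
Definition ydir (j : 'I_n) : cspace R n := delta_mx 0 (rshift n j).

Definition zcoord (j : 'I_n) (w : cspace R n) : R[i] :=
  (w 0 (lshift n j)) +i* (w 0 (rshift n j)).

Definition Jmul (w : cspace R n) : cspace R n :=
  row_mx (- rsubmx w) (lsubmx w).

Definition dz (j : 'I_n) : (cspace R n -> R[i]) -> cspace R n -> R[i] :=
  wirt (xdir j) (ydir j).
Definition dzbar (j : 'I_n) : (cspace R n -> R[i]) -> cspace R n -> R[i] :=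
  wirtbar (xdir j) (ydir j).

Definition holomorphic_on (U : set (cspace R n)) (f : cspace R n -> R[i]) :=
  forall x, U x ->
    [/\ differentiable (fun y => complex.Re (f y) : R^o) x,
        differentiable (fun y => complex.Im (f y) : R^o) x &
        forall j, dzbar j f x = 0].

Definition levi_mx (u : cspace R n -> R) (x : cspace R n) : 'M[R[i]]_n :=
  \matrix_(j, k) dz j (dzbar k (fun y => (u y)%:C)) x.

Definition levi_pos (u : cspace R n -> R) (x : cspace R n) : Prop :=
  forall v : 'rV[R[i]]_n, v != 0 ->
    0 < \sum_j \sum_k levi_mx u x j k * v 0 j * (v 0 k)^*.

End Cn.
End Calculus.

Record chart (R : realType) (n : nat) (X : topologicalType) := Chart {
  dom : set X;
  coord : X -> cspace R n;
  coordV : cspace R n -> X;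
  dom_open : open dom;
  ran_open : open (coord @` dom);
  coordK : forall x, dom x -> coordV (coord x) = x;
  coord_continuous : forall x, dom x -> {for x, continuous coord};
  coordV_continuous :
    forall y, (coord @` dom) y -> {for y, continuous coordV} }.

Record complex_manifold (R : realType) (n : nat) := ComplexManifold {
  space :> topologicalType;
  space_hausdorff : hausdorff_space space;
  space_second_countable : @second_countable space;
  atlas : set (chart R n space);
  atlas_cover : forall x : space, exists c, atlas c /\ dom c x;
  atlas_holomorphic : forall c d, atlas c -> atlas d -> forall k : 'I_n,
    holomorphic_on (coord c @` (dom c `&` dom d))
                   (fun y => zcoord k (coord d (coordV c y))) }.

Section Manifold.
Variables (R : realType) (n : nat) (X : complex_manifold R n).

Definition chart_at (x : X) : chart R n X := projT1 (cid (atlas_cover x)).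

Definition Ck_fun (k : nat) (W : set X) (f : X -> R) : Prop :=
  forall c : chart R n X, atlas c ->
    Ck_on k (coord c @` (dom c `&` W)) (fun y => f (coordV c y) : R^o).

Definition holomorphic_fun (W : set X) (f : X -> R[i]) : Prop :=
  forall c : chart R n X, atlas c ->
    holomorphic_on (coord c @` (dom c `&` W)) (fun y => f (coordV c y)).

(* w is a tangent vector at x, read in the chart chart_at x *)
Definition tderive (f : X -> R) (x : X) (w : cspace R n) : R :=
  'D_w (fun y => f (coordV (chart_at x) y) : R^o) (coord (chart_at x) x).

(* Strict plurisubharmonicity on an open set W, for C^2 functions *)
Definition spsh_on (W : set X) (u : X -> R) : Prop :=
  Ck_fun 2 W u /\
  forall (c : chart R n X) x, atlas c -> dom c x -> W x ->
    levi_pos (fun y => u (coordV c y)) (coord c x).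

Definition domain (D : set X) : Prop := [/\ D !=set0, open D & connected D].

Definition bdry (D : set X) : set X := closure D `\` D°.

Definition holomorphic_hull (D K : set X) : set X :=
  [set x | D x /\ forall (f : X -> R[i]) (r : R), holomorphic_fun D f ->
     (forall y, K y -> `|f y| <= r%:C) -> `|f x| <= r%:C].

Definition stein_domain (D : set X) : Prop :=
  [/\ domain D,
      forall K, compact K -> K `<=` D -> compact (holomorphic_hull D K) &
      forall x y, D x -> D y -> x <> y ->
        exists2 f, holomorphic_fun D f & f x <> f y].

Definition Ck_boundary (k : nat) (D : set X) : Prop :=
  forall p, bdry D p -> exists (U : set X) (rho : X -> R),
    [/\ open U, U p, Ck_fun k U rho,
        forall x, U x -> exists w, tderive rho x w <> 0 &
        D `&` U = [set x | 0 < rho x] `&` U].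

Definition levi_flat (M : set X) : Prop :=
  forall p, M p -> forall V : set X, open V -> V p ->
    exists U D1 D2 : set X,
      [/\ [/\ open U, U p & U `<=` V],
          U `\` M = D1 `|` D2, D1 `&` D2 = set0,
          stein_domain D1 & stein_domain D2].

(* Only the values of delta on the closure of Omega matter: C^k on the closure
   means that delta is C^k on an open neighbourhood of it. *)
Definition boundary_distance (k : nat) (Omega : set X) (delta : X -> R) :=
  [/\ exists W : set X, [/\ open W, closure Omega `<=` W & Ck_fun k W delta],
      Omega = [set x | closure Omega x /\ 0 < delta x] &
      forall p, bdry Omega p -> exists w, tderive delta p w <> 0].

(* In both definitions the supremum of the empty set is 0 (lemma sup0). *)
Definition DF_exponent (Omega : set X) (delta : X -> R) : R :=
  sup [set eta : R | [/\ 0 < eta, eta < 1 &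
    exists K : set X, [/\ compact K, K `<=` Omega &
      spsh_on (Omega `\` K) (fun x => - (delta x `^ eta))]]].

Definition local_DF_exponent (Omega : set X) (delta : X -> R) (p : X) : R :=
  sup [set eta : R | [/\ 0 < eta, eta < 1 &
    exists U : set X, [/\ open U, U p &
      spsh_on (U `&` Omega) (fun x => - (delta x `^ eta))]]].

(* Foliated charts live on C x R; coordinates (z', t), z' = a + i b. *)
Definition fdom : normedModType R := (cspace R 1 * R^o)%type.
Definition dir_a : fdom := (xdir R (0 : 'I_1), 0).
Definition dir_b : fdom := (ydir R (0 : 'I_1), 0).
Definition dir_t : fdom := (0, 1).

(* phi : V -> M is a C^3 parametrization (immersion and homeomorphism onto a
   relatively open subset of M), holomorphic in z'.  The curves t = const are
   then complex curves in M, hence pieces of leaves of the Levi foliation. *)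
Definition foliated_chart (M : set X) (V : set fdom) (phi : fdom -> X) :=
  [/\ open V,
      [/\ forall q, V q -> {for q, continuous phi},
          {in V &, injective phi} &
          forall A, open A -> A `<=` V ->
            exists2 O, open O & phi @` A = M `&` O],
      forall c : chart R n X, atlas c ->
        Ck_on 3 (V `&` phi @^-1` dom c) (fun q => coord c (phi q)) &
      forall (c : chart R n X) q, atlas c -> V q -> dom c (phi q) ->
        (forall v : fdom, 'D_v (fun q => coord c (phi q)) q = 0 -> v = 0) /\
        (forall k, wirtbar dir_a dir_b
                     (fun q => zcoord k (coord c (phi q))) q = 0)].

(* The norm of the class of d/dt: |(J_X phi_* d/dt) delta| *)
Definition induced_metric (delta : X -> R) (phi : fdom -> X) (q : fdom) : R :=
  `| tderive delta (phi q)
       (Jmul ('D_dir_t (fun q' => coord (chart_at (phi q)) (phi q')) q)) |.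

(* Coefficients of i Theta_h and i A_h with respect to i dz' /\ dz'bar *)
Definition Theta_coef (h : fdom -> R) (q : fdom) : R[i] :=
  - wirt dir_a dir_b (wirtbar dir_a dir_b (fun q' => (ln (h q'))%:C)) q.

Definition A_coef (h : fdom -> R) (q : fdom) : R[i] :=
  wirt dir_a dir_b (fun q' => (ln (h q'))%:C) q *
  wirtbar dir_a dir_b (fun q' => (ln (h q'))%:C) q.

End Manifold.

(* Main.v *)
Require Import Defs.
From HB Require Import structures.
From mathcomp Require Import all_boot all_order all_algebra.
From mathcomp Require Import complex ring lra.
From mathcomp Require Import all_classical all_reals all_analysis.

Set Implicit Arguments.
Unset Strict Implicit.
Unset Printing Implicit Defensive.

Import Order.TTheory GRing.Theory Num.Theory.
Import numFieldNormedType.Exports.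
Local Open Scope classical_set_scope.
Local Open Scope ring_scope.
Local Open Scope complex_scope.

(** Why the theorem is true. Read everything in a chart near p: u stands for delta,
    and lev u v w for the real form whose diagonal is four times the Levi form of u.
    Where u > 0, the Levi form of - u^eta is, up to a positive factor, the hermitian
    form (1 - eta) |du|^2 - u lev (lev_pow). In a frame e1, e2 its determinant is u
    times the function pshdet, which is u times the determinant of the Levi form
    minus (1 - eta) times a bordered Levi determinant. Close to the boundary a
    diagonal entry of the form is positive, so - u^eta is strictly plurisubharmonic
    exactly where pshdet is positive (pshdet_necessary, pshdet_sufficient).

    Since u is C^3, pshdet is C^1 up to the boundary. The bordered determinant is a
    multiple of the Levi form on the complex tangent lines of the boundary, and the
    boundary is foliated by complex curves, so pshdet vanishes on it
    (pshdet_boundary). Hence the sign of pshdet inside Omega near p is the sign of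
    its inward normal derivative at p, whenever that is not zero (barrier). Let F be
    the foliated parametrization, e1 = dF/da tangent to the leaf, e2 = J dF/dt and
    H = du (e2), so that |H| is the metric h_delta. Holomorphy of F along the leaves
    and u o F = 0 turn the normal derivative into an expression in the derivatives
    of H along the leaf (leaf_pshdet), and with the coefficients of the curvature
    forms of |H| (Theta_coefE, A_coefE) it becomes, in the direction H e2,
    4 H^4 ((1 - eta) (Theta + A) - A). So every eta in (0, 1) with
    A < (1 - eta) (Theta + A) is admissible near p, and every admissible eta
    satisfies A <= (1 - eta) (Theta + A) (local_sufficient, local_necessary). The
    positive global exponent provides one admissible eta; as A >= 0 and Theta, A are
    not both zero, this forces Theta > 0, and the supremum of the admissible eta is
    Theta / (Theta + A) (sup_threshold).

    Strict plurisubharmonicity refers to all charts, so positivity of the Levi form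
    has to be carried from one chart to another (lev_transfer). The transition maps
    are holomorphic in the sense that they have a complex linear derivative at each
    point, and nothing is known about their second derivatives. The invariance is
    therefore proved from Goursat's lemma: the circular means of a holomorphic
    function do not depend on the radius, and this replaces the statement that
    second derivatives of holomorphic maps do not contribute to the Levi form.

    The facts with suffix _aux are identities and inequalities between real numbers;
    they isolate the algebra from the derivatives to which it is applied. *)

(** * Functions of class C^k *)

Section CkTheory.
Variable R : realType.
Implicit Types V W : normedModType R.

Lemma diff_eps V W (f : V -> W) x : differentiable f x -> forall e : R, 0 < e ->
  \forall h \near (0 : V), `|f (x + h) - f x - 'd f x h| <= e * `|h|.
Proof.
move=> df e e0; have /eqaddoP/(_ e e0) := diff_locally df.
apply: filterS => h; rewrite -[(_ - _) h]/(f (h + x) - (f x + 'd f x h)).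
by rewrite opprD addrA [h + x]addrC.
Qed.

Lemma eps_diff V W (f : V -> W) x (L : {linear V -> W}) : continuous L ->
  (forall e : R, 0 < e ->
    \forall h \near (0 : V), `|f (x + h) - f x - L h| <= e * `|h|) ->
  differentiable f x /\ 'd f x = L :> (V -> W).
Proof.
move=> cL H.
have E : f \o shift x = cst (f x) + L +o_ (0 : V) id.
  apply/eqaddoP => e e0; have := H e e0.
  apply: filterS => h; rewrite -[(_ - _) h]/(f (h + x) - (f x + L h)).
  by rewrite opprD addrA [h + x]addrC.
have dL := diff_unique cL E.
by split=> //; apply/diff_locallyP; split; rewrite dL //.
Qed.

Lemma near_shift0 V (P : V -> Prop) x : (\forall y \near x, P y) <->
  \forall h \near (0 : V), P (x + h).
Proof.
split=> /nbhs_ballP[e /= e0 H]; apply/nbhs_ballP; exists e => //= h xh.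
  apply: H; move: xh; rewrite -!ball_normE /= opprD addNKr sub0r normrN.
  by [].
rewrite -(subrKC x h); apply: H; move: xh; rewrite -!ball_normE /= sub0r.
by rewrite opprB.
Qed.

Lemma open_near V (U : set V) x : open U -> U x -> \forall y \near x, U y.
Proof. by move=> oU Ux; exact: open_nbhs_nbhs. Qed.

Lemma near_eq_diff V W (f g : V -> W) x :
  (\forall y \near x, f y = g y) -> differentiable f x -> differentiable g x.
Proof.
move=> fg df; have fgx : f x = g x := nbhs_singleton fg.
suff [] : differentiable g x /\ 'd g x = 'd f x :> (V -> W) by [].
apply: eps_diff; first exact: diff_continuous.
move=> e e0; have nU := (near_shift0 _ _).1 fg.
near=> h; rewrite -(near nU h) // -fgx.
by near: h; exact: diff_eps.
Unshelve. all: by end_near. Qed.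

Lemma open_eq_diff V W (f g : V -> W) (U : set V) x : open U -> U x ->
  (forall y, U y -> f y = g y) -> differentiable f x -> differentiable g x.
Proof.
move=> oU Ux fg; apply: near_eq_diff.
by apply: filterS (open_near oU Ux) => y /fg.
Qed.

Lemma deriveP_lin V W (f : V -> W) x a v w : differentiable f x ->
  'D_(a *: v + w) f x = a *: 'D_v f x + 'D_w f x.
Proof. by move=> df; rewrite !deriveE// linearP. Qed.

Lemma deriveDv V W (f : V -> W) x v w : differentiable f x ->
  'D_(v + w) f x = 'D_v f x + 'D_w f x.
Proof. by move=> df; rewrite !deriveE// linearD. Qed.

Lemma deriveZv V W (f : V -> W) x a v : differentiable f x ->
  'D_(a *: v) f x = a *: 'D_v f x.
Proof. by move=> df; rewrite !deriveE// linearZ. Qed.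

Lemma deriveNv V W (f : V -> W) x v : differentiable f x ->
  'D_(- v) f x = - 'D_v f x.
Proof. by move=> df; rewrite !deriveE// linearN. Qed.

Lemma derive_sumv V W (f : V -> W) x (I : finType) (c : I -> R) (e : I -> V) :
  differentiable f x ->
  'D_(\sum_i c i *: e i) f x = \sum_i c i *: 'D_(e i) f x.
Proof.
move=> df; rewrite deriveE// linear_sum; apply: eq_bigr => i _.
by rewrite linearZ deriveE.
Qed.

Lemma open_eq_derive V W (f g : V -> W) (U : set V) x v : open U -> U x ->
  (forall y, U y -> f y = g y) -> 'D_v f x = 'D_v g x.
Proof.
move=> oU Ux fg; apply: near_eq_derive.
by apply: filterS (open_near oU Ux) => y /fg.
Qed.

Lemma Ck_ext V W k (U : set V) (f g : V -> W) : open U ->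
  (forall y, U y -> f y = g y) -> Ck_on k U f -> Ck_on k U g.
Proof.
move=> oU; elim: k f g => /= [|k IH] f g fg.
  move=> cf x Ux; rewrite /prop_for /continuous_at -fg //.
  apply: cvg_trans (cf x Ux); apply: near_eq_cvg.
  by apply: filterS (open_near oU Ux) => y /fg.
case=> df Hf; split=> [x Ux|v].
  exact: (open_eq_diff oU Ux fg (df x Ux)).
apply: IH (Hf v) => y Uy; exact: (open_eq_derive v oU Uy fg).
Qed.

Lemma Ck_sub V W k (U U' : set V) (f : V -> W) :
  U' `<=` U -> Ck_on k U f -> Ck_on k U' f.
Proof.
move=> sU; elim: k f => /= [|k IH] f; first by move=> cf x /sU; exact: cf.
by move=> [df Hf]; split=> [x /sU|v]; [exact: df|exact: IH].
Qed.

Lemma CkW V W k (U : set V) (f : V -> W) : Ck_on k.+1 U f -> Ck_on k U f.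
Proof.
elim: k f => /= [|k IH] f [df Hf].
  by move=> x Ux; exact/differentiable_continuous/df.
by split=> // v; exact: IH.
Qed.

Lemma Ck_cst V W k (U : set V) (c : W) : Ck_on k U (cst c).
Proof.
elim: k c => /= [|k IH] c; first by move=> x _; exact: cst_continuous.
split=> [x _|v]; first exact: differentiable_cst.
have -> : 'D_v (cst c) = cst 0 :> (V -> W).
  by apply/funext => x; rewrite derive_cst.
exact: IH.
Qed.

Lemma CkD V W k (U : set V) (f g : V -> W) : open U ->
  Ck_on k U f -> Ck_on k U g -> Ck_on k U (fun x => f x + g x).
Proof.
move=> oU; elim: k f g => /= [|k IH] f g.
  by move=> cf cg x Ux; apply: continuousD; [exact: cf|exact: cg].
move=> [df Hf] [dg Hg]; split=> [x Ux|v].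
  by apply: differentiableD; [exact: df|exact: dg].
apply: (Ck_ext oU _ (IH _ _ (Hf v) (Hg v))) => y Uy /=.
by rewrite deriveD //; apply: diff_derivable; [exact: df|exact: dg].
Qed.

Lemma CkZ V W k (U : set V) c (f : V -> W) : open U ->
  Ck_on k U f -> Ck_on k U (fun x => c *: f x).
Proof.
move=> oU; elim: k f => /= [|k IH] f.
  by move=> cf x Ux; apply: cvgZl_tmp; exact: cf.
move=> [df Hf]; split=> [x Ux|v].
  by apply: differentiableZ; exact: df.
apply: (Ck_ext oU _ (IH _ (Hf v))) => y Uy /=.
by rewrite deriveZ //; apply: diff_derivable; exact: df.
Qed.

Lemma CkN V W k (U : set V) (f : V -> W) : open U ->
  Ck_on k U f -> Ck_on k U (fun x => - f x).
Proof.
move=> oU /(CkZ (-1) oU); apply: Ck_ext => // y _; by rewrite scaleN1r.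
Qed.

Lemma CkM V k (U : set V) (f g : V -> R^o) : open U ->
  Ck_on k U f -> Ck_on k U g -> Ck_on k U (fun x => f x * g x : R^o).
Proof.
move=> oU; elim: k f g => /= [|k IH] f g.
  by move=> cf cg x Ux; apply: continuousM; [exact: cf|exact: cg].
move=> [df Hf] [dg Hg]; split=> [x Ux|v].
  by apply: differentiableM; [exact: df|exact: dg].
have Hf1 : Ck_on k U f by apply: CkW; split.
have Hg1 : Ck_on k U g by apply: CkW; split.
apply: (Ck_ext oU _ (CkD oU (IH _ _ Hf1 (Hg v)) (IH _ _ (Hf v) Hg1))) => y Uy.
rewrite deriveM; [|by apply: diff_derivable; exact: df|by apply: diff_derivable; exact: dg].
by rewrite /GRing.scale /= [g y * _]mulrC.
Qed.

Lemma derive_comp (V W Z : normedModType R) (f : V -> W) (g : W -> Z) x v :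
  differentiable f x -> differentiable g (f x) ->
  'D_v (fun y => g (f y)) x = 'D_('D_v f x) g (f x).
Proof.
move=> df dg; have dc := differentiable_comp df dg.
by rewrite deriveE // (diff_comp df dg) /= -!deriveE.
Qed.

Lemma derive_comp1 V (f : V -> R^o) (g : R -> R) x v dg :
  differentiable f x -> is_derive (f x) 1 g dg ->
  differentiable (fun y => g (f y) : R^o) x /\
  'D_v (fun y => g (f y) : R^o) x = dg * 'D_v f x.
Proof.
move=> df [gd <-].
have dg' : differentiable (g : R^o -> R^o) (f x) by exact/derivable1_diffP.
split; first exact: (differentiable_comp df dg').
rewrite (derive_comp v df dg').
have -> : 'D_v f x = 'D_v f x *: (1 : R^o) by rewrite /GRing.scale /= mulr1.
by rewrite deriveZv //= /GRing.scale /= mulr1 mulrC.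
Qed.

Lemma Ck_powR V k (U : set V) (f : V -> R^o) (a : R) : open U ->
  (forall x, U x -> 0 < f x) ->
  Ck_on k U f -> Ck_on k U (fun x => f x `^ a : R^o).
Proof.
move=> oU f0; elim: k a => /= [|k IH] a.
  move=> cf x Ux.
  apply: (@continuous_comp _ _ _ f (fun t : R^o => t `^ a : R^o)).
    exact: cf.
  apply/differentiable_continuous/derivable1_diffP.
  by case: (is_derive1_powR a (f0 _ Ux)).
move=> [df Hf]; split=> [x Ux|v].
  by have [] := derive_comp1 (0 : V) (df _ Ux) (is_derive1_powR a (f0 _ Ux)).
have H1 : Ck_on k U f by apply: CkW; split.
apply: (Ck_ext oU _ (CkM oU (CkZ a oU (IH (a - 1) H1)) (Hf v))) => y Uy.
by have [_ ->] := derive_comp1 v (df _ Uy) (is_derive1_powR a (f0 _ Uy)).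
Qed.

End CkTheory.

(** * Mean value theorem on lines and symmetry of second derivatives *)

Section SecondOrder.
Variable R : realType.
Implicit Types V W : normedModType R.

Lemma differentiable_line V (x v : V) (t : R) :
  differentiable (fun t : R^o => x + t *: v) t.
Proof.
apply: differentiableD; first exact: differentiable_cst.
exact: (@ex_diff _ _ _ _ _ _ _ (is_diff_scalel t v)).
Qed.

Lemma derive_line V (x v : V) (t : R) : 'D_1 (fun t : R^o => x + t *: v) t = v.
Proof.
have ds : is_diff t (fun t : R^o => t *: v) (fun h => h *: v).
  exact: is_diff_scalel.
rewrite deriveD; [|exact: derivable_cst|exact/diff_derivable/ex_diff].
rewrite derive_cst add0r deriveE; last exact: ex_diff.
by rewrite diff_val scale1r.
Qed.

Lemma is_derive_line V W (f : V -> W) x v (t : R) :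
  differentiable f (x + t *: v) ->
  is_derive t (1 : R) (fun t : R^o => f (x + t *: v)) ('D_v f (x + t *: v)).
Proof.
move=> df; have dl := differentiable_line x v t.
apply: DeriveDef; first exact/diff_derivable/(differentiable_comp dl df).
by rewrite (derive_comp (1 : R^o) dl df) derive_line.
Qed.

Lemma MVT_line V (f : V -> R^o) x v (s : R) : 0 < s ->
  (forall t, 0 <= t <= s -> differentiable f (x + t *: v)) ->
  exists2 c, 0 < c < s & f (x + s *: v) - f x = s * 'D_v f (x + c *: v).
Proof.
move=> s0 df.
have H t (tI : 0 <= t <= s) := is_derive_line (df t tI).
have := @MVT R (fun t : R => f (x + t *: v)) (fun t => 'D_v f (x + t *: v)) 0 s s0.
case.
- by move=> t; rewrite in_itv /= => /andP[t0 ts]; apply: H; rewrite !ltW.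
- apply: derivable_within_continuous => t; rewrite in_itv /= => tI.
  by case: (H t tI).
move=> c; rewrite in_itv /= => cI; rewrite scale0r addr0 subr0 => ->.
by exists c => //; rewrite mulrC.
Qed.

Lemma near_normball V (P : V -> Prop) x : (\forall y \near x, P y) ->
  exists2 r : R, 0 < r & forall y, `|y - x| < r -> P y.
Proof.
move=> /nbhs_ballP[r /= r0 H]; exists r => // y yr; apply: H.
by rewrite -ball_normE /= distrC.
Qed.

(** Both iterated derivatives are limits of the same second difference
    quotient, by the mean value theorem applied in either order. *)
Lemma schwarz V (f : V -> R^o) (U : set V) v w x : open U -> U x ->
  (forall y, U y -> differentiable f y) ->
  (forall y, U y -> differentiable ('D_v f) y) ->
  (forall y, U y -> differentiable ('D_w f) y) ->
  {for x, continuous ('D_w ('D_v f))} -> {for x, continuous ('D_v ('D_w f))} ->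
  'D_w ('D_v f) x = 'D_v ('D_w f) x.
Proof.
move=> oU Ux df dvf dwf c1 c2.
have key : forall v' w', (forall y, U y -> differentiable ('D_v' f) y) ->
    forall s r : R, 0 < s -> 0 < r -> s * (`|v'| + `|w'|) < r ->
    (forall y, `|y - x| < r -> U y) ->
    exists2 y, `|y - x| < r &
      f (x + s *: v' + s *: w') - f (x + s *: v') - (f (x + s *: w') - f x) =
      s ^+ 2 * 'D_w' ('D_v' f) y.
  move=> v' w' dvf' s r s0 r0 sr Ur.
  have bd a b : 0 <= a <= s -> 0 <= b <= s -> `|x + a *: v' + b *: w' - x| < r.
    move=> /andP[a0 as_] /andP[b0 bs].
    rewrite addrAC [x + _]addrC addrK.
    apply: le_lt_trans (ler_normD _ _) _; apply: le_lt_trans sr.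
    rewrite !normrZ !ger0_norm // mulrDr.
    by rewrite lerD // ler_wpM2r.
  have [||c /andP[c0 cs]] := @MVT_line V
     (fun y => f (y + s *: w') - f y) x v' s.
  - by [].
  - move=> t tI; apply: differentiableB.
      apply: (@differentiable_comp _ _ _ _ (fun y => y + s *: w') f).
        by apply: differentiableD => //; exact: differentiable_cst.
      by apply/df/Ur/bd => //; rewrite lexx ltW.
    by apply/df/Ur; rewrite -[x + _]addr0 -(scale0r w'); apply: bd => //; rewrite lexx ltW.
  have c0s : 0 <= c <= s by rewrite !ltW.
  have Uc t : 0 <= t <= s -> U (x + c *: v' + t *: w') by move=> ?; apply/Ur/bd.
  have Uc0 : U (x + c *: v').
    by rewrite -[_ + _]addr0 -(scale0r w'); apply: Uc; rewrite lexx ltW.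
  have Ucs : U (x + c *: v' + s *: w') by apply: Uc; rewrite lexx ltW.
  have dsh : differentiable (fun y => y + s *: w') (x + c *: v').
    by apply: differentiableD => //; exact: differentiable_cst.
  rewrite /= => E.
  have [||d /andP[d0 ds] E2] := @MVT_line V ('D_v' f) (x + c *: v') w' s.
  - by [].
  - by move=> t tI; apply/dvf'/Uc.
  exists (x + c *: v' + d *: w'); first by apply: bd => //; rewrite !ltW.
  rewrite E deriveB; first last.
  - exact/diff_derivable/df.
  - apply/diff_derivable.
    apply: (@differentiable_comp _ _ _ _ (fun y => y + s *: w') f) => //.
    exact: df.
  rewrite (@derive_comp _ _ _ _ (fun y => y + s *: w') f) //; last exact: df.
  have -> : 'D_v' (fun y => y + s *: w') (x + c *: v') = v'.
    rewrite deriveD; [|exact: derivable_id|exact: derivable_cst].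
    by rewrite derive_id derive_cst addr0.
  by rewrite E2 mulrA -expr2.
apply/eqP; rewrite -subr_eq0 -normr_le0; apply/ler_addgt0Pr => e e0.
rewrite add0r.
have e20 : 0 < e / 2 by rewrite divr_gt0.
move/cvgrPdist_lt: c1 => /(_ _ e20) n1.
move/cvgrPdist_lt: c2 => /(_ _ e20) n2.
have n3 : \forall y \near x, [/\ `|'D_w ('D_v f) x - 'D_w ('D_v f) y| < e / 2,
    `|'D_v ('D_w f) x - 'D_v ('D_w f) y| < e / 2 & U y].
  have n0 := open_near oU Ux.
  near=> y; split.
  - exact: (near n1 y).
  - exact: (near n2 y).
  - exact: (near n0 y).
have [r r0 Hr'] := near_normball n3.
pose s := r / (2 * (`|v| + `|w| + 1)).
have m0 : 0 < `|v| + `|w| + 1 by rewrite ltr_wpDl ?addr_ge0.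
have s0 : 0 < s by rewrite divr_gt0 // mulr_gt0.
have sr : s * (`|v| + `|w|) < r.
  rewrite /s mulrAC ltr_pdivrMr ?mulr_gt0 // ltr_pM2l //.
  by move: (`|v| + `|w|) m0 => S m0; lra.
have [y1 /Hr'[h1 _ _] E1] := key v w dvf s r s0 r0 sr (fun y yr => let: And3 _ _ u := Hr' y yr in u).
have sr' : s * (`|w| + `|v|) < r.
  by rewrite [`|w| + _]addrC.
have [y2 /Hr'[_ h2 _] E2] := key w v dwf s r s0 r0 sr' (fun y yr => let: And3 _ _ u := Hr' y yr in u).
have E : 'D_w ('D_v f) y1 = 'D_v ('D_w f) y2.
  apply: (@mulfI _ (s ^+ 2)); first by rewrite expf_neq0 // gt_eqF.
  have aux (a b c d : R^o) : a - b - (c - d) = a - c - (b - d).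
    by rewrite !opprB addrACA [RHS]addrACA [- b - c]addrC.
  apply: (etrans (esym E1)); apply: etrans E2.
  by rewrite aux [x + s *: w + _]addrAC.
have aux (a b c : R) : a - b = (a - c) - (b - c) by ring.
rewrite (aux _ _ ('D_w ('D_v f) y1)) [X in _ - (_ - X)]E.
apply: le_trans (ler_normB _ _) _; rewrite [leRHS]splitr.
exact: (lerD (ltW h1) (ltW h2)).
Unshelve. all: by end_near. Qed.

Lemma Ck_diff V W k (f : V -> W) (U : set V) x :
  Ck_on k.+1 U f -> U x -> differentiable f x.
Proof. by case=> df _ Ux; exact: df. Qed.

Lemma Ck_derive V W k (f : V -> W) (U : set V) v :
  Ck_on k.+1 U f -> Ck_on k U ('D_v f).
Proof. by case=> _ H; exact: H. Qed.

Lemma Ck_cont V W (f : V -> W) (U : set V) x :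
  Ck_on 0 U f -> U x -> {for x, continuous f}.
Proof. by move=> cf Ux; exact: cf. Qed.

Lemma Ck2_schwarz V (f : V -> R^o) (U : set V) v w x : open U -> U x ->
  Ck_on 2 U f -> 'D_w ('D_v f) x = 'D_v ('D_w f) x.
Proof.
move=> oU Ux Cf; have H u := Ck_derive u Cf.
apply: (schwarz oU Ux).
- by move=> y Uy; exact: (Ck_diff Cf Uy).
- by move=> y Uy; exact: (Ck_diff (H v) Uy).
- by move=> y Uy; exact: (Ck_diff (H w) Uy).
- exact: (Ck_cont (Ck_derive w (H v)) Ux).
- exact: (Ck_cont (Ck_derive v (H w)) Ux).
Qed.

Lemma derive2Dr V W (f : V -> W) (U : set V) v a w w' x : open U -> U x ->
  Ck_on 2 U f ->
  'D_v ('D_(a *: w + w') f) x = a *: 'D_v ('D_w f) x + 'D_v ('D_w' f) x.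
Proof.
move=> oU Ux Cf.
have dH u : differentiable ('D_u f) x := Ck_diff (Ck_derive u Cf) Ux.
rewrite (@open_eq_derive _ _ _ _ (fun y => a *: 'D_w f y + 'D_w' f y) U) //.
  rewrite deriveD ?deriveZ //; try exact: diff_derivable.
  by apply: derivableZ; exact: diff_derivable.
by move=> y Uy; rewrite deriveP_lin //; exact: (Ck_diff Cf Uy).
Qed.

End SecondOrder.

(** * Derivatives along maps and the second order expansion *)

Section RowVectors.
Variable R : realType.
Variable m : nat.
Implicit Types V W : normedModType R.
Local Notation E := 'rV[R]_m.
Local Notation d i := (delta_mx 0 i : E).

Lemma differentiable_bigsum V W (I : finType) (f : I -> V -> W) x :
  (forall i, differentiable (f i) x) -> differentiable (fun y => \sum_i f i y) x.
Proof.
move=> df; rewrite (_ : (fun y => _) = \sum_i f i); last first.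
  by apply/funext => y; rewrite fct_sumE.
apply: (big_ind (fun g : V -> W => differentiable g x)) => [|g h dg dh|i _].
- exact: differentiable_cst.
- exact: differentiableD.
- exact: df.
Qed.

Lemma derive_bigsum V W (I : finType) (f : I -> V -> W) x v :
  (forall i, differentiable (f i) x) ->
  'D_v (fun y => \sum_i f i y) x = \sum_i 'D_v (f i) x.
Proof.
move=> df.
have : differentiable (fun y => \sum_i f i y) x /\
    'D_v (fun y => \sum_i f i y) x = \sum_i 'D_v (f i) x; last by case.
rewrite (_ : (fun y => _) = \sum_i f i); last first.
  by apply/funext => y; rewrite fct_sumE.
elim/big_rec2: _ => [|i s g _ [dg IH]].
  by split; [exact: differentiable_cst|rewrite derive_cst].
split; first exact: differentiableD.
by rewrite deriveD ?IH //; exact: diff_derivable.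
Qed.

Lemma rV_sum (h : E) : h = \sum_i h 0 i *: d i.
Proof. by rewrite [LHS]row_sum_delta. Qed.

Lemma derive_rV W (f : E -> W) x (h : E) : differentiable f x ->
  'D_h f x = \sum_i h 0 i *: 'D_(d i) f x.
Proof. by move=> df; rewrite {1}(rV_sum h) derive_sumv. Qed.

Lemma differentiable_scal V W (k : V -> R^o) (c : W) x v : differentiable k x ->
  differentiable (fun y => k y *: c) x /\
  'D_v (fun y => k y *: c) x = 'D_v k x *: c.
Proof.
move=> dk; have dc : differentiable (fun y => k y *: c) x.
  exact: differentiableZl.
by split=> //; rewrite deriveE // diffZl //= deriveE.
Qed.

Lemma differentiable_coordE V (F : V -> E) x i : differentiable F x ->
  differentiable (fun y => F y 0 i : R^o) x.
Proof.
move=> dF; apply: (@differentiable_comp _ _ _ _ F (fun M : E => M 0 i : R^o)) => //.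
exact: differentiable_coord.
Qed.

Lemma derive_coord V (F : V -> E) x v i : differentiable F x ->
  'D_v (fun y => F y 0 i : R^o) x = ('D_v F x) 0 i.
Proof. by move=> dF; rewrite derive_mx ?mxE //; exact: diff_derivable. Qed.

Lemma differentiable_rV V (F : V -> E) x :
  (forall i, differentiable (fun y => F y 0 i : R^o) x) -> differentiable F x.
Proof.
move=> dF; have -> : F = (fun y => \sum_i F y 0 i *: d i).
  by apply/funext => y; exact: rV_sum.
by apply: differentiable_bigsum => i; exact: (differentiable_scal _ 0 (dF i)).1.
Qed.

Lemma derive_linear V W (L : {linear E -> W}) (F : V -> E) x v :
  differentiable F x ->
  differentiable (fun y => L (F y)) x /\ 'D_v (fun y => L (F y)) x = L ('D_v F x).
Proof.
move=> dF; have -> : (fun y => L (F y)) = (fun y => \sum_i F y 0 i *: L (d i)).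
  apply/funext => y; rewrite {1}(rV_sum (F y)) linear_sum.
  by apply: eq_bigr => i _; rewrite linearZ.
have dFi i := differentiable_scal (L (d i)) v (differentiable_coordE i dF).
split; first by apply: differentiable_bigsum => i; have [] := dFi i.
rewrite derive_bigsum; last by move=> i; have [] := dFi i.
rewrite [in RHS](rV_sum ('D_v F x)) linear_sum.
by apply: eq_bigr => i _; rewrite linearZ (dFi i).2 derive_coord.
Qed.

Lemma derive2_rV (f : E -> R^o) (U : set E) x (h k : E) : open U -> U x ->
  Ck_on 2 U f ->
  'D_h ('D_k f) x = \sum_j k 0 j * 'D_h ('D_(d j) f) x.
Proof.
move=> oU Ux Cf; have H u := Ck_derive u Cf; have df y (Uy : U y) := Ck_diff Cf Uy.
rewrite (@open_eq_derive _ _ _ _ (fun y => \sum_j k 0 j *: 'D_(d j) f y) U) //.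
  rewrite derive_bigsum => [|j].
    apply: eq_bigr => j _; rewrite deriveZ //.
    exact/diff_derivable/(Ck_diff (H _) Ux).
  apply: differentiableZ; exact: (Ck_diff (H _) Ux).
by move=> y Uy; rewrite derive_rV //; exact: df.
Qed.

Lemma near_comp V (F : V -> E) (U : set E) q : differentiable F q -> open U ->
  U (F q) -> \forall q' \near q, U (F q').
Proof.
move=> dF oU Uq; exact: (differentiable_continuous dF (open_near oU Uq)).
Qed.

(** The direction Y moves with the base point F. Expanding Y in the canonical
    basis reduces the statement to the product rule and the chain rule for the
    fixed partial derivatives of u. *)
Lemma derive_along V (u : E -> R^o) (U : set E) (F Y : V -> E) q w : open U ->
  Ck_on 2 U u -> U (F q) -> differentiable F q -> differentiable Y q ->
  differentiable (fun q' => 'D_(Y q') u (F q') : R^o) q /\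
  'D_w (fun q' => 'D_(Y q') u (F q') : R^o) q =
    'D_('D_w Y q) u (F q) + 'D_('D_w F q) ('D_(Y q) u) (F q).
Proof.
move=> oU Cu Uq dF dY; have H e := Ck_derive e Cu; have du y (Uy : U y) := Ck_diff Cu Uy.
have dH e : differentiable ('D_e u) (F q) := Ck_diff (H e) Uq.
have nE : \forall q' \near q, (\sum_i Y q' 0 i * 'D_(d i) u (F q')) = 'D_(Y q') u (F q').
  by apply: filterS (near_comp dF oU Uq) => q' Uq'; rewrite derive_rV //; exact: du.
have dc i : differentiable (fun q' => 'D_(d i) u (F q')) q.
  exact: (differentiable_comp dF (dH _)).
have dYi i := differentiable_coordE i dY.
have dt i : differentiable (fun q' => Y q' 0 i * 'D_(d i) u (F q') : R^o) q.
  exact: (differentiableM (dYi i) (dc i)).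
split.
  apply: near_eq_diff; first exact: nE.
  exact: differentiable_bigsum.
have <- := near_eq_derive w nE.
rewrite derive_bigsum //.
rewrite (derive_rV ('D_w Y q)) //; last exact: du.
rewrite (derive2_rV _ _ oU Uq Cu) -big_split; apply: eq_bigr => i _.
rewrite deriveM; [|exact/diff_derivable/dYi|exact/diff_derivable/dc].
rewrite derive_coord // (derive_comp _ dF (dH _)) /GRing.scale /=.
by rewrite addrC [X in X + _]mulrC [X in _ + X]mulrC [X in X + _]mulrC.
Qed.

Lemma derive3_rV (f : E -> R^o) (U : set E) x (l h k : E) : open U -> U x ->
  Ck_on 3 U f ->
  'D_l ('D_h ('D_k f)) x = \sum_j k 0 j * 'D_l ('D_h ('D_(d j) f)) x.
Proof.
move=> oU Ux Cf; have C2 := CkW Cf.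
apply: (etrans (open_eq_derive l oU Ux (fun y Uy => derive2_rV h k oU Uy C2))).
have dH j : differentiable ('D_h ('D_(d j) f)) x.
  exact: (Ck_diff (Ck_derive h (Ck_derive (d j) Cf)) Ux).
rewrite derive_bigsum => [|j]; last exact: (differentiableZ (k 0 j) (dH j)).
apply: eq_bigr => j _; exact: (@deriveZ _ _ _ _ (k 0 j) _ _ (diff_derivable (dH j))).
Qed.

Lemma derive_along2 V (u : E -> R^o) (U : set E) (F X Y : V -> E) q w : open U ->
  Ck_on 3 U u -> U (F q) -> differentiable F q -> differentiable X q ->
  differentiable Y q ->
  differentiable (fun q' => 'D_(X q') ('D_(Y q') u) (F q') : R^o) q /\
  'D_w (fun q' => 'D_(X q') ('D_(Y q') u) (F q') : R^o) q =
    'D_('D_w X q) ('D_(Y q) u) (F q) + 'D_(X q) ('D_('D_w Y q) u) (F q)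
    + 'D_('D_w F q) ('D_(X q) ('D_(Y q) u)) (F q).
Proof.
move=> oU Cu Uq dF dX dY; have H e := Ck_derive e Cu; have du y (Uy : U y) := Ck_diff Cu Uy; have C2 := CkW Cu.
have dA i := derive_along w oU (H (d i)) Uq dF dX.
have nE : \forall q' \near q, (\sum_i Y q' 0 i * 'D_(X q') ('D_(d i) u) (F q')) =
    'D_(X q') ('D_(Y q') u) (F q').
  by apply: filterS (near_comp dF oU Uq) => q' Uq'; rewrite -(derive2_rV _ _ oU).
have dYi i := differentiable_coordE i dY.
have dt i : differentiable (fun q' => Y q' 0 i * 'D_(X q') ('D_(d i) u) (F q') : R^o) q.
  exact: (differentiableM (dYi i) (dA i).1).
split.
  apply: near_eq_diff; first exact: nE.
  exact: differentiable_bigsum.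
have <- := near_eq_derive w nE.
rewrite derive_bigsum //.
rewrite (derive2_rV ('D_w X q) (Y q) oU Uq C2).
rewrite (derive2_rV (X q) ('D_w Y q) oU Uq C2).
rewrite (derive3_rV ('D_w F q) (X q) (Y q) oU Uq Cu).
rewrite -!big_split; apply: eq_bigr => i _.
rewrite deriveM; [|exact/diff_derivable/dYi|exact/diff_derivable/(dA i).1].
rewrite derive_coord // (dA i).2.
have aux (y a b c e : R) : y * (a + b) + c * e = y * a + e * c + y * b by ring.
exact: aux.
Qed.

Lemma sum_sum_le (a e : R) : 0 <= a -> 0 <= e ->
  \sum_(j < m) \sum_(i < m) a * (e / (m%:R * m%:R + 1)) <= e * a.
Proof.
move=> a0 e0.
have E1 (b : R) : \sum_(i < m) b = b * m%:R by rewrite sumr_const card_ord mulr_natr.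
under eq_bigr do rewrite E1; rewrite E1.
have : 0 <= m%:R * m%:R :> R by rewrite mulr_ge0.
move: (m%:R : R) => k k0.
rewrite [X in X <= _](_ : _ = e * a * (k * k / (k * k + 1))); last by ring.
rewrite ler_piMr ?mulr_ge0 // ler_pdivrMr ?ltr_wpDl //.
by rewrite mul1r lerDl.
Qed.

(** In the use below a and b are the first and second derivatives of phi at 0:
    subtracting the quadratic part before applying the mean value theorem leaves
    a remainder that involves only the first derivative of phi. *)
Lemma taylor_line (phi dphi : R -> R) (a b : R) :
  (forall t : R, 0 <= t <= 1 -> is_derive t (1 : R) phi (dphi t)) ->
  exists c : R, [/\ 0 < c, c < 1 &
    phi 1 - phi 0 - a - b / 2 = dphi c - a - c * b].
Proof.
move=> dp; pose g (t : R) : R := phi t - t * a - t ^+ 2 * (b / 2).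
have dg (t : R) : 0 <= t <= 1 -> is_derive t (1 : R) g (dphi t - a - t * b).
  move=> tI; have i1 := dp _ tI.
  have i2 : is_derive t (1 : R) (fun t : R => t * a : R) a.
    by apply: is_derive_eq; rewrite /GRing.scale /= mulr0 add0r mulr1.
  have i3 : is_derive t (1 : R) (fun t : R => t ^+ 2 * (b / 2) : R) (t * b).
    apply: is_derive_eq; rewrite /GRing.scale /= mulr0 add0r mulr1.
    by lra.
  exact: is_deriveB.
have [||c] := @MVT R g (fun t => dphi t - a - t * b) 0 1 ltr01.
- by move=> t; rewrite in_itv /= => /andP[t0 t1]; apply: dg; rewrite !ltW.
- apply: derivable_within_continuous => t; rewrite in_itv /= => tI.
  by case: (dg t tI).
rewrite in_itv /= => /andP[c0 c1]; rewrite subr0 mulr1 => E1.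
exists c; split => //; rewrite -E1 /g; ring.
Qed.

(** The remainder of the second order expansion is controlled by the
    oscillation of the finitely many second partial derivatives. *)
Lemma taylor2 (f : E -> R^o) (U : set E) x : open U -> U x -> Ck_on 2 U f ->
  forall e : R, 0 < e -> \forall h \near (0 : E),
    `|f (x + h) - f x - 'D_h f x - 'D_h ('D_h f) x / 2| <= e * `|h| ^+ 2.
Proof.
move=> oU Ux Cf e e0; have H e' := Ck_derive e' Cf; have df y (Uy : U y) := Ck_diff Cf Uy.
pose e' := e / (m%:R * m%:R + 1).
have mm0 : 0 <= m%:R * m%:R :> R by rewrite mulr_ge0.
have e'0 : 0 < e' by rewrite divr_gt0 // ltr_wpDl.
have n0 := open_near oU Ux.
pose P i j y := `|'D_(d i) ('D_(d j) f) x - 'D_(d i) ('D_(d j) f) y| <= e'.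
have n2 i j : \forall y \near x, P i j y.
  have c := Ck_cont (Ck_derive (d i) (H (d j))) Ux.
  by move/cvgrPdist_le: c => /(_ _ e'0).
have n3 : \forall y \near x, forall i j, P i j y.
  exact: (@filter_forall _ _ (fun i y => forall j, P i j y) _ (nbhs_filter x)
    (fun i => @filter_forall _ _ (P i) _ (nbhs_filter x) (n2 i))).
have n1 : \forall y \near x, U y /\ forall i j, P i j y.
  by near=> y; split; [exact: (near n0 y)|exact: (near n3 y)].
have [r r0 Hr] := near_normball n1.
have osc (h : E) y : `|y - x| < r ->
    `|'D_h ('D_h f) x - 'D_h ('D_h f) y| <= e * `|h| ^+ 2.
  move=> yr; have [Uy Hy] := Hr y yr.
  rewrite (derive2_rV h h oU Ux Cf) (derive2_rV h h oU Uy Cf) -sumrB.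
  have hi i : `|h 0 i| <= `|h|.
    by rewrite [leRHS]/Num.Def.normr /= mx_normrE; exact: (le_bigmax _ (fun i => `|h i.1 i.2|) (0, i)).
  apply: (@le_trans _ _ (\sum_(j < m) \sum_(i < m) `|h| ^+ 2 * e')).
    apply: le_trans (ler_norm_sum _ _ _) _; apply: ler_sum => j _.
    rewrite -mulrBr (derive_rV _ (Ck_diff (H (d j)) Ux)) (derive_rV _ (Ck_diff (H (d j)) Uy)).
    rewrite -sumrB normrM.
    have -> : \sum_(i < m) `|h| ^+ 2 * e' = `|h| * \sum_(i < m) (`|h| * e').
      by rewrite mulr_sumr; apply: eq_bigr => i _; rewrite expr2 mulrA.
    apply: (ler_pM (normr_ge0 _) (normr_ge0 _) (hi j)).
    apply: le_trans (ler_norm_sum _ _ _) _.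
    apply: ler_sum => i _; rewrite -scalerBr normrZ.
    exact: (ler_pM (normr_ge0 _) (normr_ge0 _) (hi i) (Hy i j)).
  by apply: sum_sum_le; [exact: exprn_ge0|exact: ltW].
have nh : \forall h \near (0 : E), `|h| < r by exact: nbhs0_lt.
near=> h.
have hr : `|h| < r by exact: (near nh h).
have hx t : 0 <= t <= 1 -> `|x + t *: h - x| < r.
  move=> /andP[t0 t1]; rewrite [x + _]addrC addrK normrZ ger0_norm //.
  by apply: le_lt_trans hr; rewrite ler_piMl.
pose a := 'D_h f x; pose b := 'D_h ('D_h f) x.
have dl (t : R) : 0 <= t <= 1 -> is_derive t (1 : R)
    (fun t : R => f (x + t *: h)) ('D_h f (x + t *: h)).
  by move=> tI; apply: is_derive_line; apply: df; exact: (Hr _ (hx _ tI)).1.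
have [c [c0 c1 E1]] := taylor_line a b dl.
rewrite scale1r scale0r addr0 in E1.
have [|c' /andP[c'0 c'1] E2] := @MVT_line _ _ ('D_h f) x h c c0.
  move=> t /andP[t0 tc]; apply: (Ck_diff (H h)).
  apply: (Hr _ (hx _ _)).1; by rewrite t0 (le_trans tc) // ltW.
have aux (p q s k a' b' : R) : p - a' = k * s -> q = p - a' - k * b' ->
  q = - (k * (b' - s)) by move=> Hp ->; rewrite Hp; ring.
have -> := aux _ _ _ _ _ _ E2 E1.
rewrite normrN normrM ger0_norm ?(ltW c0) //.
have c'x : `|x + c' *: h - x| < r by apply: hx; rewrite ltW //= (le_trans (ltW c'1)) // ltW.
apply: le_trans (osc _ _ c'x); rewrite ler_piMl //; exact: ltW.
Unshelve. all: by end_near. Qed.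

End RowVectors.

(** * The Levi form in real terms *)

Section ComplexStructure.
Variable R : realType.
Variable n : nat.
Local Notation E := (cspace R n).

Fact Jmul_linear : linear (@Jmul R n).
Proof.
move=> a v w; rewrite /Jmul -[v]hsubmxK -[w]hsubmxK.
rewrite scale_row_mx add_row_mx !row_mxKl !row_mxKr.
by rewrite scale_row_mx add_row_mx opprD scalerN.
Qed.

HB.instance Definition _ := GRing.isLinear.Build R E E *:%R (@Jmul R n) Jmul_linear.

Lemma JmulK (w : E) : Jmul (Jmul w) = - w.
Proof.
rewrite /Jmul row_mxKl row_mxKr -[in RHS](hsubmxK w).
by rewrite opp_row_mx.
Qed.

Lemma xdirE j : xdir R j = row_mx (delta_mx 0 j) 0 :> E.
Proof.
apply/rowP => i; case: (split_ordP i) => k ->; rewrite ?row_mxEl ?row_mxEr !mxE.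
  by rewrite (inj_eq (@lshift_inj _ _)).
by rewrite eq_rlshift.
Qed.

Lemma ydirE j : ydir R j = row_mx 0 (delta_mx 0 j) :> E.
Proof.
apply/rowP => i; case: (split_ordP i) => k ->; rewrite ?row_mxEl ?row_mxEr !mxE.
  by rewrite eq_lrshift.
by rewrite (inj_eq (@rshift_inj _ _)).
Qed.

Lemma Jmul_row (a b : 'rV[R]_n) : Jmul (row_mx a b) = row_mx (- b) a.
Proof. by rewrite /Jmul row_mxKl row_mxKr. Qed.

Lemma Jmul_xdir j : Jmul (xdir R j : E) = ydir R j.
Proof. by rewrite xdirE ydirE Jmul_row oppr0. Qed.

Lemma Jmul_ydir j : Jmul (ydir R j : E) = - xdir R j.
Proof. by rewrite -Jmul_xdir JmulK. Qed.

Lemma halfc (a b : R) : (a +i* b) / 2%:R = (a / 2) +i* (b / 2) :> R[i].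
Proof.
have -> : (2%:R : R[i]) = (2%:R : R)%:C by rewrite rmorph_nat.
by rewrite -fmorphV; simpc.
Qed.

Lemma Re_sum (I : finType) (F : I -> R[i]) :
  complex.Re (\sum_i F i) = \sum_i complex.Re (F i).
Proof. by apply: (big_morph _ _ erefl) => -[a b] [c e]. Qed.

Lemma Im_sum (I : finType) (F : I -> R[i]) :
  complex.Im (\sum_i F i) = \sum_i complex.Im (F i).
Proof. by apply: (big_morph _ _ erefl) => -[a b] [c e]. Qed.

(** Four times the real part of the Levi form, in real terms. *)
Definition lev (u : E -> R^o) (x v w : E) : R :=
  'D_v ('D_w u) x + 'D_(Jmul v) ('D_(Jmul w) u) x.

Lemma wirt_re (V : normedModType R) (P Q : V -> R^o) (v w : V) x :
  wirt v w (fun y => P y +i* Q y) x =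
  (('D_v P x + 'D_w Q x) / 2) +i* (('D_v Q x - 'D_w P x) / 2).
Proof. by rewrite /wirt /cderive /= -halfc; congr (_ / _); simpc. Qed.

Lemma wirtbar_re (V : normedModType R) (P Q : V -> R^o) (v w : V) x :
  wirtbar v w (fun y => P y +i* Q y) x =
  (('D_v P x - 'D_w Q x) / 2) +i* (('D_v Q x + 'D_w P x) / 2).
Proof. by rewrite /wirtbar /cderive /= -halfc; congr (_ / _); simpc. Qed.

Fact levi_entry_aux (a b c d : R) :
  ((2^-1 *: (a : R^o) + 2^-1 *: (b : R^o)) / 2)
    +i* ((2^-1 *: (c : R^o) - 2^-1 *: (d : R^o)) / 2)
  = ((a + b) / 4) +i* ((c - d) / 4) :> R[i].
Proof.
rewrite /GRing.scale /=; apply/eqP; rewrite eq_complex /=.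
by apply/andP; split; apply/eqP; field.
Qed.

Lemma levi_mxE (u : E -> R^o) (U : set E) x j k : open U -> U x -> Ck_on 2 U u ->
  levi_mx u x j k =
  (('D_(xdir R j) ('D_(xdir R k) u) x + 'D_(ydir R j) ('D_(ydir R k) u) x) / 4) +i*
  (('D_(xdir R j) ('D_(ydir R k) u) x - 'D_(ydir R j) ('D_(xdir R k) u) x) / 4).
Proof.
move=> oU Ux Cu; rewrite mxE.
have -> : dzbar k (fun y => (u y)%:C) =
    (fun y => (2^-1 *: 'D_(xdir R k) u y : R^o) +i* (2^-1 *: 'D_(ydir R k) u y : R^o)).
  apply/funext => y; rewrite /dzbar (@wirtbar_re _ u (cst 0)) !derive_cst.
  by rewrite subr0 add0r /GRing.scale /= ![2^-1 * _]mulrC.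
rewrite /dz wirt_re.
have dH v : differentiable ('D_v u) x := Ck_diff (Ck_derive v Cu) Ux.
have dZ v w : 'D_w (fun y => 2^-1 *: 'D_v u y : R^o) x = 2^-1 *: 'D_w ('D_v u) x.
  by rewrite -deriveZ //; exact/diff_derivable/dH.
rewrite (dZ (xdir R k) (xdir R j)) (dZ (ydir R k) (ydir R j)).
rewrite (dZ (ydir R k) (xdir R j)) (dZ (xdir R k) (ydir R j)).
exact: levi_entry_aux.
Qed.

Lemma sum_block (G : 'I_(n + n) -> 'I_(n + n) -> R) (v w : E) :
  \sum_k w 0 k * (\sum_i v 0 i * G i k) = \sum_j \sum_k
    (v 0 (lshift n j) * w 0 (lshift n k) * G (lshift n j) (lshift n k)
   + v 0 (lshift n j) * w 0 (rshift n k) * G (lshift n j) (rshift n k)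
   + v 0 (rshift n j) * w 0 (lshift n k) * G (rshift n j) (lshift n k)
   + v 0 (rshift n j) * w 0 (rshift n k) * G (rshift n j) (rshift n k)).
Proof.
rewrite big_split_ord /= [RHS]exchange_big -big_split /=.
apply: eq_bigr => k _; rewrite !big_split_ord /= !mulrDr !mulr_sumr -!big_split /=.
by apply: eq_bigr => j _; ring.
Qed.

Lemma hess_expand (u : E -> R^o) (U : set E) x (v w : E) :
  open U -> U x -> Ck_on 2 U u ->
  'D_v ('D_w u) x = \sum_j \sum_k
    (v 0 (lshift n j) * w 0 (lshift n k) * 'D_(xdir R j) ('D_(xdir R k) u) x
   + v 0 (lshift n j) * w 0 (rshift n k) * 'D_(xdir R j) ('D_(ydir R k) u) x
   + v 0 (rshift n j) * w 0 (lshift n k) * 'D_(ydir R j) ('D_(xdir R k) u) x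
   + v 0 (rshift n j) * w 0 (rshift n k) * 'D_(ydir R j) ('D_(ydir R k) u) x).
Proof.
move=> oU Ux Cu.
have dH e : differentiable ('D_e u) x := Ck_diff (Ck_derive e Cu) Ux.
rewrite (derive2_rV v w oU Ux Cu).
rewrite (eq_bigr (fun k => w 0 k *
    \sum_i v 0 i * 'D_(delta_mx 0 i) ('D_(delta_mx 0 k) u) x)); last first.
  by move=> k _; congr (_ * _); exact: derive_rV (dH _).
exact: (@sum_block (fun i k => 'D_(delta_mx 0 i) ('D_(delta_mx 0 k) u) x)).
Qed.

Lemma Jmul_l (w : E) j : Jmul w 0 (lshift n j) = - w 0 (rshift n j).
Proof. by rewrite /Jmul row_mxEl !mxE. Qed.

Lemma Jmul_r (w : E) j : Jmul w 0 (rshift n j) = w 0 (lshift n j).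
Proof. by rewrite /Jmul row_mxEr !mxE. Qed.

Fact levi_Re_aux (p q r s a b a' b' : R) :
  complex.Re ((((p + q) / 4) +i* ((r - s) / 4)) * (a +i* b) * (a' +i* b')^*) =
  (a * a' * p + a * b' * r + b * a' * s + b * b' * q +
   (- b * - b' * p + - b * a' * r + a * - b' * s + a * a' * q)) / 4.
Proof. by rewrite /=; field. Qed.

Fact levi_Im_aux (p q r s a b a' b' : R) :
  complex.Im ((((p + q) / 4) +i* ((r - s) / 4)) * (a +i* b) * (a' +i* b')^*) =
  ((p + q) * (b * a' - a * b') + (r - s) * (a * a' + b * b')) / 4.
Proof. by rewrite /=; field. Qed.

(** The imaginary part of a hermitian form changes sign when the two summation
    indices are exchanged. *)
Lemma herm_im (p q r s : 'I_n -> 'I_n -> R) (a b : 'I_n -> R) :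
  (forall j k, p j k = p k j) -> (forall j k, q j k = q k j) ->
  (forall j k, s j k = r k j) ->
  \sum_j \sum_k ((p j k + q j k) * (b j * a k - a j * b k) +
    (r j k - s j k) * (a j * a k + b j * b k)) / 4 = 0.
Proof.
move=> Hp Hq Hs; set S := (X in X = 0).
suff : S = - S by move=> SS; lra.
rewrite {1}/S exchange_big -sumrN; apply: eq_bigr => j _.
rewrite -sumrN; apply: eq_bigr => k _; rewrite (Hp k) (Hq k) !Hs; ring.
Qed.

(** The hermitian sum at the complex vector whose real and imaginary parts are
    the two blocks of w is lev u x w w / 4, and every complex vector has this
    form. *)
Lemma levi_posP (u : E -> R^o) (U : set E) x : open U -> U x -> Ck_on 2 U u ->
  levi_pos u x <-> forall w : E, w != 0 -> 0 < lev u x w w.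
Proof.
move=> oU Ux Cu.
have key (w : E) (v : 'rV[R[i]]_n) :
    (forall j, v 0 j = (w 0 (lshift n j)) +i* (w 0 (rshift n j))) ->
    \sum_j \sum_k levi_mx u x j k * v 0 j * (v 0 k)^* = (lev u x w w / 4)%:C.
  move=> vw; apply/eqP; rewrite eq_complex /=; apply/andP; split; apply/eqP.
    rewrite Re_sum /lev !(hess_expand _ _ oU Ux Cu) -big_split mulr_suml /=.
    apply: eq_bigr => j _; rewrite Re_sum -big_split mulr_suml /=.
    apply: eq_bigr => k _; rewrite (levi_mxE _ _ oU Ux Cu) !vw !Jmul_l !Jmul_r.
    exact: levi_Re_aux.
  rewrite Im_sum; rewrite -[RHS](@herm_im
    (fun j k => 'D_(xdir R j) ('D_(xdir R k) u) x)
    (fun j k => 'D_(ydir R j) ('D_(ydir R k) u) x)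
    (fun j k => 'D_(xdir R j) ('D_(ydir R k) u) x)
    (fun j k => 'D_(ydir R j) ('D_(xdir R k) u) x)
    (fun j => w 0 (lshift n j)) (fun j => w 0 (rshift n j))).
  - apply: eq_bigr => j _; rewrite Im_sum; apply: eq_bigr => k _.
    by rewrite (levi_mxE _ _ oU Ux Cu) !vw; exact: levi_Im_aux.
  - by move=> j k; exact: (Ck2_schwarz _ _ oU Ux Cu).
  - by move=> j k; exact: (Ck2_schwarz _ _ oU Ux Cu).
  - by move=> j k; exact: (Ck2_schwarz _ _ oU Ux Cu).
split=> H w w0.
  pose v : 'rV[R[i]]_n := \row_j ((w 0 (lshift n j)) +i* (w 0 (rshift n j))).
  have v0 : v != 0.
    apply: contraNneq w0 => v0; apply/eqP/rowP => i; rewrite mxE.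
    have Hv j : v 0 j = 0 by rewrite v0 mxE.
    by case: (split_ordP i) => k ->; have := Hv k; rewrite mxE => -[].
  have := H v v0; rewrite (@key w) => [|j]; last by rewrite mxE.
  by rewrite ltcE /= => /andP[_]; rewrite pmulr_lgt0.
pose w' : E := row_mx (\row_j complex.Re (w 0 j)) (\row_j complex.Im (w 0 j)).
rewrite (@key w'); last first.
  by move=> j; rewrite /w' row_mxEl row_mxEr !mxE; case: (w 0 j).
have w'0 : w' != 0.
  apply: contraNneq w0 => w'0; apply/eqP/rowP => i; rewrite mxE.
  have hl : w' 0 (lshift n i) = 0 by rewrite w'0 mxE.
  have hr : w' 0 (rshift n i) = 0 by rewrite w'0 mxE.
  move: hl hr; rewrite /w' row_mxEl row_mxEr !mxE; case: (w 0 i) => a b /= -> ->.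
  by [].
by have := H _ w'0; rewrite ltcE /= eqxx => h; rewrite pmulr_lgt0.
Qed.

End ComplexStructure.

(** * Goursat's lemma on rectangles *)

Section Goursat.
Variable R : realType.
Implicit Types (P Q : R -> R -> R).

(** Differentiability of P at (x, y) with explicit partial derivatives. The
    hypothesis lin below gives P and Q the common coefficient py, which expresses
    that the form P dx + Q dy is closed. *)
Definition lin_at P (x y px py : R) := forall e : R, 0 < e ->
  exists2 d : R, 0 < d & forall x' y', `|x' - x| <= d -> `|y' - y| <= d ->
    `|P x' y' - P x y - px * (x' - x) - py * (y' - y)| <=
      e * (`|x' - x| + `|y' - y|).

Variables (P Q Pp Qp : R -> R -> R) (a c L M : R).
Hypotheses (L0 : 0 < L) (M0 : 0 < M).
Definition in_rect x y := (a <= x <= a + L) /\ (c <= y <= c + M).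
Hypothesis dPp : forall x y, in_rect x y -> is_derive x (1 : R) (Pp^~ y) (P x y).
Hypothesis dQp : forall x y, in_rect x y -> is_derive y (1 : R) (Qp x) (Q x y).
Hypothesis lin : forall x y, in_rect x y -> exists px py qy : R,
  lin_at P x y px py /\ lin_at Q x y py qy.

(** Circulation of P dx + Q dy along the boundary of the rectangle with corner
    (x, y) and sides l, m. The integrals over the sides are increments of
    primitives: Pp in the first variable, Qp in the second. *)
Definition circ x y l m : R :=
  (Pp (x + l) y - Pp x y) - (Pp (x + l) (y + m) - Pp x (y + m)) +
  ((Qp (x + l) (y + m) - Qp (x + l) y) - (Qp x (y + m) - Qp x y)).

Lemma circ_split x y l m : circ x y (l + l) (m + m) =
  circ x y l m + circ (x + l) y l m + circ x (y + m) l m +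
  circ (x + l) (y + m) l m.
Proof. by rewrite /circ !addrA; ring. Qed.

Lemma MVT_diff (F G f g : R -> R) (x l : R) : 0 < l ->
  (forall t, x <= t <= x + l -> is_derive t (1 : R) F (f t)) ->
  (forall t, x <= t <= x + l -> is_derive t (1 : R) G (g t)) ->
  exists t : R, x <= t <= x + l /\
    (F (x + l) - F x) - (G (x + l) - G x) = l * (f t - g t).
Proof.
move=> l0 dF dG; have xl : x < x + l by rewrite ltrDl.
have dFG t : x <= t <= x + l -> is_derive t (1 : R) (F - G) (f t - g t).
  by move=> tI; have i1 := dF _ tI; have i2 := dG _ tI; exact: is_deriveB.
have [||t] := @MVT R (F - G) (fun t => f t - g t) x (x + l) xl.
- by move=> t; rewrite in_itv /= => /andP[t0 t1]; apply: dFG; rewrite !ltW.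
- apply: derivable_within_continuous => t; rewrite in_itv /= => tI.
  by case: (dFG t tI).
rewrite in_itv /= => /andP[t0 t1] E; exists t; split; first by rewrite !ltW.
have -> : l * (f t - g t) = (f t - g t) * (x + l - x) by ring.
rewrite -E -[(F - G) _]/(F _ - G _) -[(F - G) x]/(F x - G x); ring.
Qed.

(** By the mean value theorem each pair of opposite sides contributes a side
    length times a difference of values of P or Q. The linear parts of these
    differences cancel because the form is closed at (s, t). *)
Lemma circ_small s t e : in_rect s t -> 0 < e -> exists2 d : R, 0 < d &
  forall x y l m, 0 < l <= d -> 0 < m <= d ->
    x <= s <= x + l -> y <= t <= y + m ->
    a <= x -> x + l <= a + L -> c <= y -> y + m <= c + M ->
    `|circ x y l m| <= 2 * e * (l + m) ^+ 2.
Proof.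
move=> st e0; have [px [py [qy [lP lQ]]]] := lin st.
have [d1 d10 H1] := lP e e0; have [d2 d20 H2] := lQ e e0.
exists (Num.min d1 d2); first by rewrite lt_min d10.
move=> x y l m /andP[l0 ld] /andP[m0 md] /andP[xs sx] /andP[yt ty] ax xa cy yc.
move: ld md; rewrite !le_min => /andP[l1 l2] /andP[m1 m2].
have near u v : x <= u <= x + l -> y <= v <= y + m ->
    `|u - s| <= l /\ `|v - t| <= m.
  by move=> /andP[? ?] /andP[? ?]; rewrite !ler_norml; split; apply/andP; split; lra.
have rect u v : x <= u <= x + l -> y <= v <= y + m -> in_rect u v.
  by move=> /andP[? ?] /andP[? ?]; split; apply/andP; split; lra.
have yy : y <= y <= y + m by rewrite lexx lerDl ltW.
have ym : y <= y + m <= y + m by rewrite lexx lerDl ltW.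
have xx : x <= x <= x + l by rewrite lexx lerDl ltW.
have xl : x <= x + l <= x + l by rewrite lexx lerDl ltW.
have [u [uI E1]] := @MVT_diff (Pp^~ y) (Pp^~ (y + m)) (P^~ y) (P^~ (y + m)) x l l0
  (fun u uI => dPp (rect _ _ uI yy)) (fun u uI => dPp (rect _ _ uI ym)).
have [v [vI E2]] := @MVT_diff (Qp (x + l)) (Qp x) (Q (x + l)) (Q x) y m m0
  (fun v vI => dQp (rect _ _ xl vI)) (fun v vI => dQp (rect _ _ xx vI)).
rewrite /circ E1 E2.
have bP v' : y <= v' <= y + m ->
    `|P u v' - P s t - px * (u - s) - py * (v' - t)| <= e * (l + m).
  move=> v'I; have [h1 h2] := near u v' uI v'I.
  apply: le_trans (H1 _ _ (le_trans h1 l1) (le_trans h2 m1)) _.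
  by rewrite ler_pM2l // lerD.
have bQ u' : x <= u' <= x + l ->
    `|Q u' v - Q s t - py * (u' - s) - qy * (v - t)| <= e * (l + m).
  move=> u'I; have [h1 h2] := near u' v u'I vI.
  apply: le_trans (H2 _ _ (le_trans h1 l2) (le_trans h2 m2)) _.
  by rewrite ler_pM2l // lerD.
have := bP _ yy; have := bP _ ym; have := bQ _ xx; have := bQ _ xl.
set q1 := Q (x + l) v; set q0 := Q x v; set p0 := P u y; set p1 := P u (y + m).
rewrite !ler_norml => /andP[? ?] /andP[? ?] /andP[? ?] /andP[? ?].
have e1 : - (2 * e * (l + m)) <= p0 - p1 + py * m <= 2 * e * (l + m).
  by apply/andP; split; lra.
have e2 : - (2 * e * (l + m)) <= q1 - q0 - py * l <= 2 * e * (l + m).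
  by apply/andP; split; lra.
have -> : l * (p0 - p1) + m * (q1 - q0) =
  l * (p0 - p1 + py * m) + m * (q1 - q0 - py * l) by ring.
move: e1 e2 => /andP[? ?] /andP[? ?].
apply/andP; split; nra.
Qed.

(** If the circulation were nonzero, repeated quartering would produce nested
    rectangles shrinking to a point, on which the circulation is at least the
    initial one divided by the ratio of areas; the first order expansion at
    the limit point makes it smaller. *)
Lemma goursat : circ a c L M = 0.
Proof.
apply/eqP; rewrite -normr_le0 leNgt; apply/negP => k0.
set k := `|circ a c L M| in k0.
pose l n := L / 2 ^+ n; pose m n := M / 2 ^+ n.
have p0 n : 0 < 2 ^+ n :> R by rewrite exprn_gt0.
have l0 n : 0 < l n by rewrite divr_gt0.
have m0 n : 0 < m n by rewrite divr_gt0.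
have lS n : l n = l n.+1 + l n.+1 by rewrite /l exprS; field; rewrite gt_eqF.
have mS n : m n = m n.+1 + m n.+1 by rewrite /m exprS; field; rewrite gt_eqF.
pose big n (z : R * R) := k / 4 ^+ n <= `|circ z.1 z.2 (l n) (m n)|.
pose step n (z : R * R) : R * R :=
  if big n.+1 z then z else
  if big n.+1 (z.1 + l n.+1, z.2) then (z.1 + l n.+1, z.2) else
  if big n.+1 (z.1, z.2 + m n.+1) then (z.1, z.2 + m n.+1) else
  (z.1 + l n.+1, z.2 + m n.+1).
pose z := fix z n := if n is n'.+1 then step n' (z n') else (a, c).
have bigz n : big n (z n).
  elim: n => [|n IH]; first by rewrite /big /= /l /m !expr0 !divr1.
  rewrite /= /step; case: ifPn => // b1; case: ifPn => // b2; case: ifPn => // b3.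
  apply: contraT => b4.
  move: IH b1 b2 b3 b4; rewrite /big -!ltNge /= lS mS circ_split => IH b1 b2 b3 b4.
  have : k / 4 ^+ n = 4 * (k / 4 ^+ n.+1).
    by rewrite exprS; field; rewrite expf_neq0.
  move: IH b1 b2 b3 b4.
  set q := k / 4 ^+ n.+1; set q' := k / 4 ^+ n.
  set x0 := (z n).1; set y0 := (z n).2.
  set c1 := circ x0 y0 (l n.+1) (m n.+1).
  set c2 := circ (x0 + l n.+1) y0 (l n.+1) (m n.+1).
  set c3 := circ x0 (y0 + m n.+1) (l n.+1) (m n.+1).
  set c4 := circ (x0 + l n.+1) (y0 + m n.+1) (l n.+1) (m n.+1).
  move=> IH b1 b2 b3 b4 qq.
  have := ler_normD (c1 + c2 + c3) c4; have := ler_normD (c1 + c2) c3.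
  by have := ler_normD c1 c2; lra.
have zS n : [/\ (z n).1 <= (z n.+1).1, (z n.+1).1 + l n.+1 <= (z n).1 + l n,
    (z n).2 <= (z n.+1).2 & (z n.+1).2 + m n.+1 <= (z n).2 + m n].
  have := l0 n.+1; have := m0 n.+1; have := lS n; have := mS n.
  rewrite /= /step; case: (big _ _); [|case: (big _ _); [|case: (big _ _)]];
    move=> /= E1 E2 ? ?; split; lra.
have mono n j : [/\ (z n).1 <= (z (n + j)%N).1,
    (z (n + j)%N).1 + l (n + j)%N <= (z n).1 + l n,
    (z n).2 <= (z (n + j)%N).2 & (z (n + j)%N).2 + m (n + j)%N <= (z n).2 + m n].
  elim: j => [|j [h1 h2 h3 h4]]; first by rewrite addn0.
  have [g1 g2 g3 g4] := zS (n + j)%N; rewrite addnS.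
  by split; [exact: le_trans g1|exact: le_trans h2|exact: le_trans g3|exact: le_trans h4].
have cross i n : (z i).1 <= (z n).1 + l n /\ (z i).2 <= (z n).2 + m n.
  have [h1 h2 h3 h4] := mono i n; have [g1 g2 g3 g4] := mono n i.
  rewrite addnC in g1 g2 g3 g4; have := l0 (i + n)%N; have := m0 (i + n)%N.
  by move=> ? ?; split; lra.
pose s := sup (range (fun n => (z n).1)); pose t := sup (range (fun n => (z n).2)).
have sI n : (z n).1 <= s <= (z n).1 + l n.
  apply/andP; split.
    apply: ub_le_sup; last by exists n.
    by exists ((z 0%N).1 + l 0%N) => _ [i _ <-]; have [] := cross i 0%N.
  by apply: ge_sup; [exists (z 0%N).1, 0%N|move=> _ [i _ <-]; have [] := cross i n].
have tI n : (z n).2 <= t <= (z n).2 + m n.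
  apply/andP; split.
    apply: ub_le_sup; last by exists n.
    by exists ((z 0%N).2 + m 0%N) => _ [i _ <-]; have [] := cross i 0%N.
  by apply: ge_sup; [exists (z 0%N).2, 0%N|move=> _ [i _ <-]; have [] := cross i n].
have l00 : l 0%N = L by rewrite /l expr0 divr1.
have m00 : m 0%N = M by rewrite /m expr0 divr1.
have rst : in_rect s t by split; [have := sI 0%N|have := tI 0%N]; rewrite ?l00 ?m00.
(* for this e the bound of circ_small on the n-th rectangle is half of k / 4^n *)
pose e := k / (4 * (L + M) ^+ 2).
have LM0 : 0 < (L + M) ^+ 2 by rewrite exprn_gt0 // addr_gt0.
have e0 : 0 < e by rewrite divr_gt0 // mulr_gt0.
have [d d0 Hd] := circ_small rst e0.
have [n Hn] : exists n : nat, (L + M) / d <= 2 ^+ n.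
  have Hn := archi_boundP (ltW (divr_gt0 (addr_gt0 L0 M0) d0)).
  exists (Num.bound ((L + M) / d)); apply: le_trans (ltW Hn) _.
  by rewrite -natrX ler_nat ltnW // ltn_expl.
have ld : l n <= d.
  rewrite /l ler_pdivrMr // mulrC -ler_pdivrMr //; apply: le_trans Hn.
  by rewrite ler_pM2r ?invr_gt0 // lerDl ltW.
have md : m n <= d.
  rewrite /m ler_pdivrMr // mulrC -ler_pdivrMr //; apply: le_trans Hn.
  by rewrite ler_pM2r ?invr_gt0 // lerDr ltW.
have [g1 g2 g3 g4] := mono 0%N n; rewrite add0n l00 m00 /= in g1 g2 g3 g4.
have := Hd (z n).1 (z n).2 (l n) (m n); rewrite !l0 !m0 ld md.
move=> /(_ isT isT (sI n) (tI n) g1 g2 g3 g4) H.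
have := le_trans (bigz n) H.
have -> : 2 * e * (l n + m n) ^+ 2 = k / 4 ^+ n / 2.
  rewrite /e /l /m (_ : 4 ^+ n = (2 ^+ n) ^+ 2); last by rewrite exprAC; congr (_ ^+ _); ring.
  by field; rewrite !gt_eqF //= addr_gt0.
have kn : 0 < k / 4 ^+ n by rewrite divr_gt0 // exprn_gt0.
by lra.
Qed.
End Goursat.

(** * Circular means of holomorphic maps *)

Section MeanValue.
Variable R : realType.
Local Notation RR := (R^o * R^o)%type.

Lemma differentiable_fst (z : RR) : differentiable (fst : RR -> R^o) z.
Proof.
have [] // := @eps_diff _ _ _ (fst : RR -> R^o) z (fst : {linear RR -> R^o}).
  by move=> y; exact: cvg_fst.
move=> e e0; near=> h; rewrite -[(z + h).1]/(z.1 + h.1) [z.1 + _]addrC addrK subrr.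
by rewrite normr0 mulr_ge0 // ltW.
Unshelve. all: by end_near. Qed.

Lemma differentiable_snd (z : RR) : differentiable (snd : RR -> R^o) z.
Proof.
have [] // := @eps_diff _ _ _ (snd : RR -> R^o) z (snd : {linear RR -> R^o}).
  by move=> y; exact: cvg_snd.
move=> e e0; near=> h; rewrite -[(z + h).2]/(z.2 + h.2) [z.2 + _]addrC addrK subrr.
by rewrite normr0 mulr_ge0 // ltW.
Unshelve. all: by end_near. Qed.

Lemma primitive (f : R -> R) a b : a < b ->
  (forall x, a <= x <= b -> {for x, continuous f}) ->
  exists F : R -> R, forall x, a < x < b -> is_derive x (1 : R) F (f x).
Proof.
move=> ab cf; exists (fun x0 : R => (\int[lebesgue_measure]_(t in `[a, x0]) f t)%R).
move=> x /andP[ax xb].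
have fi : lebesgue_measure.-integrable `[a, b] (EFin \o f).
  apply: continuous_compact_integrable; first exact: segment_compact.
  apply: continuous_in_subspaceT => y; rewrite inE /= in_itv /= => yI.
  exact: cf.
have cx : {for x, continuous f} by apply: cf; rewrite !ltW.
have [d1 d2] := continuous_FTC1_closed xb fi ax cx.
exact: (DeriveDef d1 (etrans (esym (derive1E _ _)) d2)).
Qed.

Lemma diff_lin_at (G : RR -> R^o) x y : differentiable G (x, y) ->
  lin_at (fun a b => G (a, b)) x y ('D_(1, 0) G (x, y)) ('D_(0, 1) G (x, y)).
Proof.
move=> dG e e0; have := diff_eps dG e0 => /nbhs_ballP[d /= d0 H].
exists (d / 2); first by rewrite divr_gt0.
move=> x' y' xd yd; have [hx hy] : `|x' - x| < d /\ `|y' - y| < d.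
  by split; [apply: le_lt_trans xd _|apply: le_lt_trans yd _];
    rewrite ltr_pdivrMr // ltr_pMr // ltr1n.
have nh : `|(x' - x, y' - y) : RR| = Num.max `|x' - x| `|y' - y| by rewrite prod_normE.
have := H (x' - x, y' - y); rewrite -ball_normE /= sub0r normrN nh.
rewrite gt_max hx hy => /(_ isT).
have -> : (x, y) + (x' - x, y' - y) = (x', y') :> RR.
  by rewrite -[LHS]/(x + (x' - x), y + (y' - y)) !subrKC.
have -> : (x' - x, y' - y) = (x' - x) *: ((1, 0) : RR) + (y' - y) *: ((0, 1) : RR).
  rewrite -[RHS]/((x' - x) * 1 + (y' - y) * 0, (x' - x) * 0 + (y' - y) * 1).
  by rewrite !mulr1 !mulr0 addr0 add0r.
rewrite linearP linearZ -!deriveE // /GRing.scale /= => H'.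
rewrite [_ * (x' - x)]mulrC [_ * (y' - y)]mulrC -addrA -opprD.
apply: le_trans H' _; rewrite ler_pM2l // ge_max lerDl lerDr.
by rewrite !normr_ge0.
Qed.

Lemma lin_at_cont (P : R -> R -> R) x y px py : lin_at P x y px py ->
  {for x, continuous (P^~ y)} /\ {for y, continuous (P x)}.
Proof.
move=> H; have key (f : R -> R) z p : (forall e : R, 0 < e -> exists2 d : R, 0 < d &
    forall z', `|z' - z| <= d -> `|f z' - f z - p * (z' - z)| <= e * `|z' - z|) ->
    {for z, continuous f}.
  move=> Hf; apply/cvgrPdist_le => e e0.
  have [d d0 Hd] := Hf 1 ltr01.
  have p0 : 0 < 1 + `|p| by rewrite ltr_pwDl.
  near=> t.
  have td : `|t - z| <= Num.min d (e / (1 + `|p|)).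
    rewrite distrC; near: t; apply: (cvgrPdist_le _ _).1; first exact: cvg_id.
    by rewrite lt_min d0 divr_gt0.
  move: td; rewrite le_min => /andP[td te].
  rewrite distrC -(subrK (p * (t - z)) (f t - f z)).
  apply: le_trans (ler_normD _ _) _.
  apply: le_trans (_ : (1 + `|p|) * `|t - z| <= _); last by rewrite mulrC -ler_pdivlMr.
  by rewrite mulrDl normrM lerD // Hd.
split; [apply: (key _ _ px)|apply: (key _ _ py)] => e e0; have [d d0 Hd] := H e e0;
  exists d => // z' zd.
  have := Hd z' y zd; rewrite subrr normr0 mulr0 subr0 addr0; apply; exact: ltW.
have := Hd x z'; rewrite !subrr normr0 mulr0 subr0 add0r; apply => //; exact: ltW.
Unshelve. all: by end_near. Qed.

Variable n : nat.
Local Notation E := (cspace R n).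

(** The orbit e^(s + i t) w of w under complex multiplication. *)
Definition polar (w : E) (z : RR) : E :=
  (expR z.1 * cos z.2) *: w + (expR z.1 * sin z.2) *: Jmul w.

Lemma polarE w s t : polar w (s, t) =
  (expR s * cos t) *: w + (expR s * sin t) *: Jmul w.
Proof. by []. Qed.

Lemma derive_polar w z : [/\ differentiable (polar w) z,
  'D_(1, 0) (polar w) z = polar w z & 'D_(0, 1) (polar w) z = Jmul (polar w z)].
Proof.
have dc1 f df : is_derive z.1 (1 : R) f df ->
    differentiable (fun z : RR => f z.1 : R^o) z /\
    forall v : RR, 'D_v (fun z : RR => f z.1 : R^o) z = df * v.1.
  move=> Hf; split; first exact: (derive_comp1 (0 : RR) (differentiable_fst z) Hf).1.
  move=> v; rewrite (derive_comp1 v (differentiable_fst z) Hf).2.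
  rewrite deriveE; last exact: differentiable_fst.
  by rewrite (@diff_lin _ _ _ (fst : {linear RR -> R^o})) // => y; exact: cvg_fst.
have dc2 f df : is_derive z.2 (1 : R) f df ->
    differentiable (fun z : RR => f z.2 : R^o) z /\
    forall v : RR, 'D_v (fun z : RR => f z.2 : R^o) z = df * v.2.
  move=> Hf; split; first exact: (derive_comp1 (0 : RR) (differentiable_snd z) Hf).1.
  move=> v; rewrite (derive_comp1 v (differentiable_snd z) Hf).2.
  rewrite deriveE; last exact: differentiable_snd.
  by rewrite (@diff_lin _ _ _ (snd : {linear RR -> R^o})) // => y; exact: cvg_snd.
have [de De] := dc1 _ _ (is_derive_expR z.1).
have [dc Dc] := dc2 _ _ (is_derive_cos z.2).
have [ds Ds] := dc2 _ _ (is_derive_sin z.2).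
have dec : differentiable (fun z : RR => expR z.1 * cos z.2 : R^o) z.
  exact: (differentiableM de dc).
have des : differentiable (fun z : RR => expR z.1 * sin z.2 : R^o) z.
  exact: (differentiableM de ds).
have Dec v : 'D_v (fun z : RR => expR z.1 * cos z.2 : R^o) z =
    expR z.1 * (- sin z.2 * v.2) + cos z.2 * (expR z.1 * v.1).
  rewrite (@deriveM _ _ (fun z : RR => expR z.1) (fun z : RR => cos z.2)) //.
  - by rewrite De Dc.
  - exact: diff_derivable.
  - exact: diff_derivable.
have Des v : 'D_v (fun z : RR => expR z.1 * sin z.2 : R^o) z =
    expR z.1 * (cos z.2 * v.2) + sin z.2 * (expR z.1 * v.1).
  rewrite (@deriveM _ _ (fun z : RR => expR z.1) (fun z : RR => sin z.2)) //.
  - by rewrite De Ds.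
  - exact: diff_derivable.
  - exact: diff_derivable.
have d1 v := differentiable_scal w v dec.
have d2 v := differentiable_scal (Jmul w) v des.
have Dp v : 'D_v (polar w) z =
    (expR z.1 * (- sin z.2 * v.2) + cos z.2 * (expR z.1 * v.1)) *: w +
    (expR z.1 * (cos z.2 * v.2) + sin z.2 * (expR z.1 * v.1)) *: Jmul w.
  rewrite -Dec -Des -(d1 v).2 -(d2 v).2 -deriveD //.
  - exact: (diff_derivable (d1 v).1).
  - exact: (diff_derivable (d2 v).1).
split.
- exact: (differentiableD (d1 0).1 (d2 0).1).
- rewrite Dp /= !mulr0 !mulr1 !add0r /polar.
  by rewrite [cos _ * _]mulrC [sin _ * _]mulrC.
- rewrite Dp /= !mulr0 !mulr1 !addr0 /polar.
  have -> (a b : R) : Jmul (a *: w + b *: Jmul w) = a *: Jmul w - b *: w.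
    by rewrite linearP linearZ /= JmulK scalerN.
  by rewrite addrC mulrN scaleNr.
Qed.

Lemma polar_norm w s t : `|polar w (s, t)| <= expR s * (`|w| + `|Jmul w|).
Proof.
rewrite polarE; apply: le_trans (ler_normD _ _) _.
have aux (a c : R) (v : E) : 0 <= a -> `|c| <= 1 -> `|(a * c) *: v| <= a * `|v|.
  move=> a0 c1; rewrite normrZ ler_wpM2r //.
  by rewrite (normrM a c) (ger0_norm a0) ler_piMr.
rewrite mulrDr lerD // aux ?expR_ge0 //.
  by rewrite ler_norml cos_geN1 cos_le1.
by rewrite ler_norml sin_geN1 sin_le1.
Qed.

Lemma polar2pi w s : polar w (s, 2 * pi) = polar w (s, 0).
Proof.
by rewrite !polarE mulr_natl cos2pi sin2pi cos0 sin0.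
Qed.

(** In polar coordinates the Cauchy-Riemann equations say that A dt + B ds, with
    A = lam (g w) and B = - lam (J (g w)) at the points e^(s + i t) w, is a closed
    form; by 2 pi-periodicity in t and Goursat's lemma, the circular means of A do
    not depend on the radius. Hence values of A on the two circles meet, and an
    upper bound on one circle is at least a lower bound on the other. *)
Lemma circle_mean_le (g : E -> E) (lam : {linear E -> R^o}) (w : E) (r s0 s1 c0 c1 : R) :
  (forall z, `|z| < r -> differentiable g z /\
    forall k, 'D_(Jmul k) g z = Jmul ('D_k g z)) ->
  expR s0 * (`|w| + `|Jmul w|) < r -> expR s1 * (`|w| + `|Jmul w|) < r ->
  (forall t, lam (g (polar w (s0, t))) <= c0) ->
  (forall t, c1 <= lam (g (polar w (s1, t)))) -> c1 <= c0.
Proof.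
move=> dg r0 r1 H0 H1.
pose N := `|w| + `|Jmul w|.
have N0 : 0 <= N by rewrite addr_ge0.
pose A s t : R := lam (g (polar w (s, t))).
pose B s t : R := - lam (Jmul (g (polar w (s, t)))).
have lAB s t : expR s * N < r -> exists px py qy : R,
    lin_at B s t px py /\ lin_at A s t py qy.
  move=> sr; have [dp D1 D2] := derive_polar w (s, t).
  have [dgz Dg] := dg _ (le_lt_trans (polar_norm w s t) sr).
  pose G z := g (polar w z); have dG : differentiable G (s, t).
    exact: (differentiable_comp dp dgz).
  have DG v : 'D_v G (s, t) = 'D_('D_v (polar w) (s, t)) g (polar w (s, t)).
    exact: (derive_comp v dp dgz).
  have dA v := derive_linear lam v dG.
  pose lamJ : {linear E -> R^o} := (lam \o @Jmul R n)%FUN.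
  have dB' v := derive_linear lamJ v dG.
  have dB : differentiable (fun z => - lamJ (G z)) (s, t).
    exact: (differentiableN (dB' 0).1).
  have DB v : 'D_v (fun z => - lamJ (G z)) (s, t) = - lamJ ('D_v G (s, t)).
    rewrite -(dB' v).2; apply: deriveN; exact: (diff_derivable (dB' v).1).
  have lA := diff_lin_at (dA 0).1; have lB := diff_lin_at dB.
  exists ('D_(1, 0) (fun z => - lamJ (G z)) (s, t)),
    ('D_(1, 0) (fun z => lam (G z)) (s, t)),
    ('D_(0, 1) (fun z => lam (G z)) (s, t)); split; last exact: lA.
  have <- : 'D_(0, 1) (fun z => - lamJ (G z)) (s, t) =
      'D_(1, 0) (fun z => lam (G z)) (s, t).
    by rewrite DB (dA _).2 !DG D1 D2 Dg /lamJ /= JmulK linearN opprK.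
  exact: lB.
have dA s : expR s * N < r -> exists F : R -> R, forall t, 0 <= t <= 2 * pi ->
    is_derive t (1 : R) F (A s t).
  move=> sr; have pi0 : 0 < 2 * pi :> R by rewrite mulr_gt0 // pi_gt0.
  have [] := @primitive (A s) (-1) (2 * pi + 1); first by lra.
    by move=> t _; have [? [? [? [_ /lin_at_cont[]]]]] := lAB s t sr.
  by move=> F HF; exists F => t /andP[t0 t1]; apply: HF; apply/andP; split; lra.
have mean sa sb : sa < sb -> expR sb * N < r ->
    exists ta tb, A sa ta = A sb tb.
  move=> ab br.
  have [sb' [bb' br']] : exists sb', sb < sb' /\ expR sb' * N < r.
    have cE : {for sb, continuous (fun x : R => expR x * N)}.
      by apply: continuousM; [exact: continuous_expR|exact: cst_continuous].
    have nE : \forall x \near sb, expR x * N < r by exact: (cvgr_lt _ cE _ br).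
    move/nbhs_ballP: nE => [d /= d0 Hd].
    have d2 : 0 < d / 2 by rewrite divr_gt0.
    exists (sb + d / 2); split; first by rewrite ltrDl.
    apply: Hd; rewrite -ball_normE /= opprD addNKr normrN ger0_norm ?ltW //.
    by lra.
  have sr s : s <= sb' -> expR s * N < r.
    by move=> ss; apply: le_lt_trans br'; rewrite ler_wpM2r // ler_expR.
  have dB t : exists F : R -> R, forall s, sa <= s <= sb ->
      is_derive s (1 : R) F (B s t).
    have [] := @primitive (B^~ t) (sa - 1) sb'; first by lra.
      move=> s /andP[_ ss].
      by have [? [? [? [/lin_at_cont[]]]]] := lAB s t (sr _ ss).
    by move=> F HF; exists F => s /andP[? ?]; apply: HF; apply/andP; split; lra.
  have [Bp HB] := choice dB.
  have dA' s : exists F : R -> R, s <= sb -> forall t, 0 <= t <= 2 * pi ->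
      is_derive t (1 : R) F (A s t).
    have [ss|ss] := leP s sb; last by exists (A s).
    by have [F HF] := dA s (sr _ (le_trans ss (ltW bb'))); exists F.
  have [Ap HA] := choice dA'.
  have pi0 : 0 < 2 * pi :> R by rewrite mulr_gt0 // pi_gt0.
  have l0 : 0 < sb - sa by rewrite subr_gt0.
  have := @goursat R B A (fun s t => Bp t s) Ap sa 0 (sb - sa) (2 * pi) l0 pi0.
  rewrite /in_rect /circ subrKC add0r => gc.
  have {gc} E0 := gc (fun s t st => HB t s st.1)
    (fun s t st => HA s (proj2 (andP st.1)) t st.2)
    (fun s t st => lAB s t (sr s (le_trans (proj2 (andP st.1)) (ltW bb')))).
  have [u [uI Eu]] := @MVT_diff R (Bp 0) (Bp (2 * pi)) (B^~ 0) (B^~ (2 * pi)) sa (sb - sa) l0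
    (fun s sI => HB 0 s ltac:(by move: sI; rewrite subrKC))
    (fun s sI => HB (2 * pi) s ltac:(by move: sI; rewrite subrKC)).
  move: Eu; rewrite subrKC /B polar2pi subrr mulr0 => Eu.
  have [||ta _ Ea] := @MVT R (Ap sa) (A sa) 0 (2 * pi) pi0.
  - by move=> t; rewrite in_itv /= => /andP[? ?]; apply: (HA sa (ltW ab)); rewrite !ltW.
  - apply: derivable_within_continuous => t; rewrite in_itv /= => tI.
    by case: (HA sa (ltW ab) t tI).
  have [||tb _ Eb] := @MVT R (Ap sb) (A sb) 0 (2 * pi) pi0.
  - by move=> t; rewrite in_itv /= => /andP[? ?]; apply: (HA sb (lexx _)); rewrite !ltW.
  - apply: derivable_within_continuous => t; rewrite in_itv /= => tI.
    by case: (HA sb (lexx _) t tI).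
  exists ta, tb; apply: (@mulIf _ (2 * pi - 0)); first by rewrite subr0 gt_eqF.
  rewrite -Ea -Eb; move: E0; rewrite Eu add0r => /subr0_eq ->.
  by [].
have [s01|s10|s01] := ltgtP s0 s1.
- by have [ta [tb E]] := mean _ _ s01 r1; apply: le_trans (H1 tb) _; rewrite -[leLHS]E; exact: H0.
- by have [ta [tb E]] := mean _ _ s10 r0; apply: le_trans (H1 ta) _; rewrite [leLHS]E; exact: H0.
- by rewrite s01 in H0; exact: le_trans (H1 0) (H0 0).
Qed.

End MeanValue.

(** * Invariance of the Levi form under holomorphic maps *)

Section Transfer.
Variable R : realType.
Variable n : nat.
Local Notation E := (cspace R n).

Lemma entry_le m (h : 'rV[R]_m) i : `|h 0 i| <= `|h|.
Proof.
by rewrite [leRHS]/Num.Def.normr /= mx_normrE;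
  exact: (le_bigmax _ (fun i => `|h i.1 i.2|) (0, i)).
Qed.

Lemma Jmul_norm (w : E) : `|Jmul w| <= `|w|.
Proof.
rewrite [leLHS]/Num.Def.normr /= mx_normrE; apply: bigmax_le => // -[a i] _ /=.
rewrite (ord1 a); case: (split_ordP i) => k ->.
  by rewrite Jmul_l normrN entry_le.
by rewrite Jmul_r entry_le.
Qed.

Lemma derive_bounded m (W : normedModType R) (f : 'rV[R]_m -> W) x :
  differentiable f x -> exists2 C : R, 0 <= C & forall h, `|'D_h f x| <= C * `|h|.
Proof.
move=> df; exists (\sum_i `|'D_(delta_mx 0 i) f x|); first exact: sumr_ge0.
move=> h; rewrite derive_rV // mulr_suml.
apply: le_trans (ler_norm_sum _ _ _) _; apply: ler_sum => i _.
by rewrite normrZ mulrC ler_wpM2l // entry_le.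
Qed.

Lemma hess_bounded m (f : 'rV[R]_m -> R^o) (U : set 'rV[R]_m) x : open U -> U x ->
  Ck_on 2 U f -> exists2 C : R, 0 <= C &
    forall h k, `|'D_h ('D_k f) x| <= C * (`|h| * `|k|).
Proof.
move=> oU Ux Cf.
have dH j : exists2 C : R, 0 <= C & forall h, `|'D_h ('D_(delta_mx 0 j) f) x| <= C * `|h|.
  exact: derive_bounded (Ck_diff (Ck_derive _ Cf) Ux).
have [C HC] := choice (fun j => let: ex_intro2 c p q := dH j in
  ex_intro (fun c => 0 <= c /\ forall h, `|'D_h ('D_(delta_mx 0 j) f) x| <= c * `|h|) c (conj p q)).
exists (\sum_j C j); first by apply: sumr_ge0 => j _; case: (HC j).
move=> h k; rewrite (derive2_rV h k oU Ux Cf) mulr_suml.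
apply: le_trans (ler_norm_sum _ _ _) _; apply: ler_sum => j _.
have [C0 /(_ h) Hj] := HC j.
rewrite (normrM (k 0 j)); apply: le_trans (ler_pM _ _ (entry_le k j) Hj) _ => //.
by rewrite mulrC mulrA.
Qed.

Fact remainder_aux (K C e1 e H k d g : R) : 0 <= K -> 0 <= C -> 0 <= e1 ->
  0 <= d -> 0 <= H -> 0 <= k -> 0 <= g -> d <= e1 * H -> k <= (C + 1) * H ->
  g <= C * H ->
  K * (2 * C + 1) * e1 <= e -> K * (d * k) + K * (g * d) <= e * H ^+ 2.
Proof.
move=> K0 C0 e10 d0 H0 k0 g0 dH kH gH eK.
have h1 : d * k <= (e1 * H) * ((C + 1) * H) by exact: ler_pM.
have h2 : g * d <= (C * H) * (e1 * H) by exact: ler_pM.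
apply: le_trans (_ : K * ((e1 * H) * ((C + 1) * H)) + K * ((C * H) * (e1 * H)) <= _).
  by rewrite lerD // ler_wpM2l.
rewrite (_ : _ + _ = (K * (2 * C + 1) * e1) * H ^+ 2); last by ring.
by rewrite ler_wpM2r // sqr_ge0.
Qed.

Fact remainder_aux2 (a b c q q' e H : R) :
  `|a - b - c - q / 2| <= e / 2 * H -> `|q - q'| <= e * H ->
  `|a - b - c - q' / 2| <= e * H.
Proof.
rewrite !ler_norml => /andP[h1 h2] /andP[h3 h4].
by move: h1 h2; rewrite (_ : e / 2 * H = e * H / 2);
  [move=> h1 h2; apply/andP; split; lra|ring].
Qed.

(** Second order expansion of v o f when f is differentiable only once: the first
    order term of v is evaluated at the exact increment of f, and only the
    quadratic term, where the error is of higher order, uses the derivative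
    of f. *)
Lemma taylor2_comp (f : E -> E) (v : E -> R^o) (V : set E) y : open V -> V (f y) ->
  differentiable f y -> Ck_on 2 V v -> forall e : R, 0 < e ->
  \forall h \near (0 : E), `|v (f (y + h)) - v (f y) - 'D_(f (y + h) - f y) v (f y)
    - 'D_('D_h f y) ('D_('D_h f y) v) (f y) / 2| <= e * `|h| ^+ 2.
Proof.
move=> oV Vy df Cv e e0.
have [C C0 HC] := derive_bounded df.
have [K K0 HK] := hess_bounded oV Vy Cv.
pose e1 : R := Num.min 1 (e / (K * (2 * C + 1) + 1)).
have KC0 : 0 <= K * (2 * C + 1) by rewrite mulr_ge0 // addr_ge0 // mulr_ge0.
have e10 : 0 < e1 by rewrite lt_min ltr01 divr_gt0 // ltr_wpDl.
have C10 : 0 < (C + 1) ^+ 2 by rewrite exprn_gt0 // ltr_wpDl.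
pose e2 : R := e / 2 / (C + 1) ^+ 2.
have e20 : 0 < e2 by rewrite !divr_gt0.
have n1 := diff_eps df e10.
have [r r0 Hr] := near_normball (taylor2 oV Vy Cv e20).
have C1r : 0 < r / (C + 1) by rewrite divr_gt0 // ltr_wpDl.
have n2 : \forall h \near (0 : E), `|h| < r / (C + 1) by exact: nbhs0_lt.
near=> h.
have h1 := near n1 h; have h2 : `|h| < r / (C + 1) by exact: (near n2 h).
set k := f (y + h) - f y.
have kh : `|k - 'D_h f y| <= e1 * `|h|.
  by rewrite deriveE //; apply: h1.
have Dh := HC h.
have e11 : e1 <= 1 by rewrite ge_min lexx.
have k1 : `|k| <= (C + 1) * `|h|.
  rewrite -(subrK ('D_h f y) k); apply: le_trans (ler_normD _ _) _.
  rewrite addrC mulrDl lerD //; apply: le_trans kh _; exact: ler_wpM2r.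
have kr : `|k - 0| < r.
  rewrite subr0; apply: le_lt_trans k1 _; rewrite mulrC -ltr_pdivlMr //.
  exact: ltr_wpDl.
have T := Hr k kr; rewrite /k subrKC -/k in T.
set a := v (f (y + h)) in T *; set b := v (f y) in T *; set c := 'D_k v (f y) in T *.
set q := 'D_k ('D_k v) (f y) in T *; set q' := 'D_('D_h f y) _ _.
have Hq : `|q - q'| <= e * `|h| ^+ 2.
  have dv u : differentiable ('D_u v) (f y) := Ck_diff (Ck_derive u Cv) Vy.
  have qq : q - q' = 'D_(k - 'D_h f y) ('D_k v) (f y)
      + 'D_('D_h f y) ('D_(k - 'D_h f y) v) (f y).
    have E1 := deriveDv (k - 'D_h f y) ('D_h f y) (dv k).
    rewrite subrK in E1.
    have E2 := derive2Dr ('D_h f y) (-1) ('D_h f y) k oV Vy Cv.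
    rewrite scaleN1r [- _ + k]addrC in E2.
    have aux (p1 p2 p3 p4 p5 : R) : p1 = p2 + p3 -> p4 = -1 * p5 + p3 ->
      p1 - p5 = p2 + p4 by move=> -> ->; ring.
    exact: aux E1 E2.
  have H1 := HK (k - 'D_h f y) k.
  have H2 := HK ('D_h f y) (k - 'D_h f y).
  rewrite qq; apply: le_trans (ler_normD _ _) _.
  apply: le_trans (lerD H1 H2) _.
  have e1K : K * (2 * C + 1) * e1 <= e.
    apply: le_trans (_ : (K * (2 * C + 1) + 1) * e1 <= _).
      by rewrite ler_wpM2r ?(ltW e10) // lerDl.
    by rewrite mulrC -ler_pdivlMr ?ltr_wpDl // ge_min lexx orbT.
  apply: remainder_aux e1K; rewrite ?normr_ge0 //; exact: ltW.
have T' : `|a - b - c - q / 2| <= e / 2 * `|h| ^+ 2.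
  apply: le_trans T _; rewrite /e2 -mulrA ler_wpM2l ?divr_ge0 ?(ltW e0) //.
  rewrite mulrC ler_pdivrMr // mulrC -exprMn.
  by rewrite lerXn2r // nnegrE ?mulr_ge0 ?addr_ge0.
exact: remainder_aux2 T' Hq.
Unshelve. all: by end_near. Qed.

Lemma derive2Zr m (u : 'rV[R]_m -> R^o) (U : set 'rV[R]_m) x v a w : open U ->
  U x -> Ck_on 2 U u -> 'D_v ('D_(a *: w) u) x = a * 'D_v ('D_w u) x.
Proof.
move=> oU Ux Cu; have := derive2Dr v a w 0 oU Ux Cu.
have -> : 'D_0 u = cst 0 by apply/funext => y; exact: derive0.
by rewrite derive_cst !addr0.
Qed.

Lemma hess_bil m (u : 'rV[R]_m -> R^o) (U : set 'rV[R]_m) x (a1 b1 a2 b2 : R) p q :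
  open U -> U x -> Ck_on 2 U u ->
  'D_(a1 *: p + b1 *: q) ('D_(a2 *: p + b2 *: q) u) x =
    a1 * a2 * 'D_p ('D_p u) x + (a1 * b2 + b1 * a2) * 'D_p ('D_q u) x
    + b1 * b2 * 'D_q ('D_q u) x.
Proof.
move=> oU Ux Cu; have dH e : differentiable ('D_e u) x := Ck_diff (Ck_derive e Cu) Ux.
have E1 := derive2Dr (a1 *: p + b1 *: q) a2 p (b2 *: q) oU Ux Cu.
have E2 := derive2Zr (a1 *: p + b1 *: q) b2 q oU Ux Cu.
have F1 := deriveP_lin a1 p (b1 *: q) (dH p).
have F2 := deriveP_lin a1 p (b1 *: q) (dH q).
have G1 := deriveZv b1 q (dH p).
have G2 := deriveZv b1 q (dH q).
have S := Ck2_schwarz p q oU Ux Cu.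
have aux (t1 t2 t3 f1 f2 g1 g2 pp pq qp qq : R) :
  t1 = a2 * f1 + t2 -> t2 = b2 * f2 -> f1 = a1 * pp + g1 -> f2 = a1 * pq + g2 ->
  g1 = b1 * qp -> g2 = b1 * qq -> qp = pq ->
  t1 = a1 * a2 * pp + (a1 * b2 + b1 * a2) * pq + b1 * b2 * qq.
  by move=> -> -> -> -> -> -> ->; ring.
exact: aux E1 E2 F1 F2 G1 G2 S.
Qed.

Lemma hessNN m (u : 'rV[R]_m -> R^o) (U : set 'rV[R]_m) x h : open U ->
  U x -> Ck_on 2 U u -> 'D_(- h) ('D_(- h) u) x = 'D_h ('D_h u) x.
Proof.
move=> oU Ux Cu; have dH e : differentiable ('D_e u) x := Ck_diff (Ck_derive e Cu) Ux.
have := derive2Zr (- h) (-1) h oU Ux Cu; rewrite scaleN1r => ->.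
by rewrite (deriveNv h (dH h)) mulN1r opprK.
Qed.

Lemma lev_rot (u : E -> R^o) (U : set E) x (w : E) (a b : R) : open U -> U x ->
  Ck_on 2 U u ->
  lev u x (a *: w + b *: Jmul w) (a *: w + b *: Jmul w) =
  (a ^+ 2 + b ^+ 2) * lev u x w w.
Proof.
move=> oU Ux Cu; have bil a1 b1 a2 b2 p q := hess_bil a1 b1 a2 b2 p q oU Ux Cu.
rewrite /lev linearP linearZ /= JmulK.
have -> : a *: Jmul w + b *: - w = (- b) *: w + a *: Jmul w.
  by rewrite addrC scalerN scaleNr.
have aux (t1 t2 p q r : R) :
  t1 = a * a * p + (a * b + b * a) * q + b * b * r ->
  t2 = - b * - b * p + (- b * a + a * - b) * q + a * a * r ->
  t1 + t2 = (a ^+ 2 + b ^+ 2) * (p + r) by move=> -> ->; ring.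
exact: aux (bil a b a b w (Jmul w)) (bil (- b) a (- b) a w (Jmul w)).
Qed.

Lemma lev_rotE (u : E -> R^o) (U : set E) x (w : E) (s t : R) : open U -> U x ->
  Ck_on 2 U u ->
  lev u x (polar w (s, t)) (polar w (s, t)) = expR s ^+ 2 * lev u x w w.
Proof.
move=> oU Ux Cu; rewrite polarE (lev_rot _ _ _ oU Ux Cu); congr (_ * _).
rewrite !exprMn -mulrDr cos2Dsin2 mulr1; ring.
Qed.

Fact mean_aux2 (p q r1 r2 a b g : R) :
  `|p - q - r1 - a / 2| <= g -> `|p - q - r2 - b / 2| <= g ->
  `|r2 - r1 - (a - b) / 2| <= 2 * g.
Proof. rewrite !ler_norml => /andP[? ?] /andP[? ?]; apply/andP; split; lra. Qed.

Fact mean_aux4 (l1 l2 l3 l4 l d1 d2 a1 a2 b1 b2 g1 g2 : R) :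
  `|l1 - l - d1 - (a1 - b1) / 2| <= 2 * g1 ->
  `|l2 - l - d2 - (a2 - b2) / 2| <= 2 * g2 ->
  `|l3 - l - - d1 - (a1 - b1) / 2| <= 2 * g1 ->
  `|l4 - l - - d2 - (a2 - b2) / 2| <= 2 * g2 -> g2 <= g1 ->
  `|l1 + l2 + (l3 + l4) - 4 * l - (a1 + a2 - (b1 + b2))| <= 8 * g1.
Proof.
rewrite !ler_norml => /andP[? ?] /andP[? ?] /andP[? ?] /andP[? ?] ?.
apply/andP; split; lra.
Qed.

Fact mean_aux_e (d w E H : R) : 0 <= E -> 0 <= w -> 0 <= H -> 0 <= d ->
  H <= 2 * E * w ->
  8 * (d / (64 * w ^+ 2 + 64) * H ^+ 2) <= E ^+ 2 * (d / 2).
Proof.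
move=> E0 w0 H0 d0 HE.
have HH : H ^+ 2 <= 4 * E ^+ 2 * w ^+ 2.
  rewrite (_ : 4 * E ^+ 2 * w ^+ 2 = (2 * E * w) ^+ 2); last by ring.
  by rewrite lerXn2r // nnegrE !mulr_ge0.
have w20 : 0 <= w ^+ 2 by rewrite exprn_ge0.
have p0 : 0 < 64 * w ^+ 2 + 64 by rewrite ltr_wpDl // mulr_ge0.
rewrite (_ : 8 * _ = (8 * d * H ^+ 2) / (64 * w ^+ 2 + 64)); last by ring.
rewrite ler_pdivrMr //.
apply: le_trans (_ : 8 * d * (4 * E ^+ 2 * w ^+ 2) <= _).
  by rewrite ler_wpM2l // mulr_ge0.
have : 0 <= d * E ^+ 2 by rewrite mulr_ge0 // exprn_ge0.
by move=> h; lra.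
Qed.

Fact mean_aux_up (a c E d : R) : `|a - c - E * d| <= E * (d / 2) ->
  a <= c + E * (3 / 2 * d).
Proof. rewrite ler_norml => /andP[_ h]; lra. Qed.

Fact mean_aux_dn (a c E d : R) : `|a - c - E * d| <= E * (d / 2) ->
  c + E * (1 / 2 * d) <= a.
Proof. rewrite ler_norml => /andP[h _]; lra. Qed.

Fact mean_aux_up' (a c E d : R) : `|a - c - E * d| <= E * (- d / 2) ->
  a <= c + E * (1 / 2 * d).
Proof. rewrite ler_norml => /andP[_ h]; lra. Qed.

Fact mean_aux_dn' (a c E d : R) : `|a - c - E * d| <= E * (- d / 2) ->
  c + E * (3 / 2 * d) <= a.
Proof. rewrite ler_norml => /andP[h _]; lra. Qed.

Fact mean_aux_end (E0 E1 d : R) : 0 < E0 -> 0 < d -> 4 * E0 <= E1 ->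
  E0 * (3 / 2 * d) < E1 * (1 / 2 * d).
Proof.
move=> E00 d0 h; apply: lt_le_trans (_ : 4 * E0 * (1 / 2 * d) <= _).
  by rewrite (_ : 4 * E0 * (1 / 2 * d) = 2 * (E0 * d));
    [have := mulr_gt0 E00 d0; lra|field].
by rewrite ler_wpM2r // mulr_ge0 // ltW.
Qed.

Definition holo_at (F : E -> E) z :=
  differentiable F z /\ forall k, 'D_(Jmul k) F z = Jmul ('D_k F z).

Lemma holo_atD F G z : holo_at F z -> holo_at G z -> holo_at (fun z => F z + G z) z.
Proof.
move=> [dF JF] [dG JG]; split; first exact: differentiableD.
move=> k; rewrite !deriveD; try exact: diff_derivable.
by rewrite JF JG linearD.
Qed.

(** Let d be the difference of the two sides. The map f has a complex linear
    derivative but no second derivative is at hand, so the chain rule for second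
    derivatives is replaced by circular means. Subtracting the two second order
    expansions of vc = v o f at y leaves lam (f (y + h)), with lam = dv at f y, a
    linear function of h, and quadratic terms. Averaging over h, J h, - h, - J h
    turns these into lam (g h) - lam (g 0) = d |z|^2 + o (|z|^2) for h = z w, with g
    holomorphic; since the circular means of lam o g are constant, d = 0. *)
Lemma lev_transfer (f : E -> E) (U V : set E) (v vc : E -> R^o) y w :
  open U -> U y -> open V -> Ck_on 2 U vc -> Ck_on 2 V v ->
  (forall z, U z -> [/\ differentiable f z,
     forall k, 'D_(Jmul k) f z = Jmul ('D_k f z), V (f z) & vc z = v (f z)]) ->
  lev vc y w w = lev v (f y) ('D_w f y) ('D_w f y).
Proof.
move=> oU Uy oV Cvc Cv Hf.
have [df Jf Vy vcy] := Hf y Uy.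
set d1 := lev vc y w w; set d2 := lev v _ _ _.
apply/eqP; rewrite -subr_eq0 -normr_le0 leNgt; apply/negP => d0.
pose d : R := d1 - d2; rewrite -/d in d0.
pose lam : {linear E -> R^o} := 'd v (f y).
have dv : differentiable v (f y) := Ck_diff Cv Vy.
(* with this e the remainders contribute at most half of the main term d |z|^2 *)
pose e : R := `|d| / (64 * `|w| ^+ 2 + 64).
have w20 : 0 <= `|w| ^+ 2 by rewrite exprn_ge0.
have e0 : 0 < e by rewrite divr_gt0 // ltr_wpDl // mulr_ge0.
have n1 := taylor2 oU Uy Cvc e0.
have n2 := taylor2_comp oV Vy df Cv e0.
have n3 := (near_shift0 _ _).1 (open_near oU Uy).
have nn : \forall h \near (0 : E), [/\ U (y + h),
    `|vc (y + h) - vc y - 'D_h vc y - 'D_h ('D_h vc) y / 2| <= e * `|h| ^+ 2 &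
    `|v (f (y + h)) - v (f y) - 'D_(f (y + h) - f y) v (f y)
    - 'D_('D_h f y) ('D_('D_h f y) v) (f y) / 2| <= e * `|h| ^+ 2].
  by near=> h; split; [exact: (near n3 h)|exact: (near n1 h)|exact: (near n2 h)].
have [r r0 Hr] := near_normball nn.
have {n1 n2 n3 nn} phi h : `|h| < r -> `|lam (f (y + h) - f y) - 'D_h vc y -
    ('D_h ('D_h vc) y - 'D_('D_h f y) ('D_('D_h f y) v) (f y)) / 2| <= 2 * (e * `|h| ^+ 2).
  move=> hr; have [Uh T1 T2] := Hr h (eq_ind_r (fun x => `|x| < r) hr (subr0 h)).
  have [_ _ _ vch] := Hf _ Uh.
  rewrite vch vcy in T1; rewrite deriveE // in T2.
  exact: mean_aux2 T1 T2.
(* the pairs of opposite points remove the first derivatives of vc, and the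
   directions h and J h together produce the Levi form *)
pose g (z : E) : E := f (y + z) + f (y + Jmul z) + (f (y + - z) + f (y + - Jmul z)).
have est h : `|h| < r -> `|lam (g h) - 4 * lam (f y) -
    (lev vc y h h - lev v (f y) ('D_h f y) ('D_h f y))| <= 8 * (e * `|h| ^+ 2).
  move=> hr; have Jh := Jmul_norm h.
  have Jr : `|Jmul h| < r by apply: le_lt_trans hr.
  have P1 := phi h hr; have P2 := phi _ Jr.
  have P3 := phi (- h) (eq_ind_r (fun x => x < r) hr (normrN h)).
  have P4 := phi (- Jmul h) (eq_ind_r (fun x => x < r) Jr (normrN _)).
  rewrite !linearB /= in P1 P2 P3 P4.
  rewrite (deriveNv h (Ck_diff Cvc Uy)) (deriveNv h df) (hessNN h oU Uy Cvc)
    (hessNN _ oV Vy Cv) normrN in P3.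
  rewrite (deriveNv (Jmul h) (Ck_diff Cvc Uy)) (deriveNv (Jmul h) df)
    (hessNN (Jmul h) oU Uy Cvc) (hessNN _ oV Vy Cv) normrN in P4.
  have gE : lam (g h) = lam (f (y + h)) + lam (f (y + Jmul h))
      + (lam (f (y + - h)) + lam (f (y + - Jmul h))) by rewrite !linearD.
  have e2 : e * `|Jmul h| ^+ 2 <= e * `|h| ^+ 2.
    by rewrite ler_pM2l // lerXn2r // nnegrE.
  rewrite /lev -Jf gE.
  exact: mean_aux4 P1 P2 P3 P4 e2.
have dg z : `|z| < r -> differentiable g z /\ forall k, 'D_(Jmul k) g z = Jmul ('D_k g z).
  move=> zr; have Jr : `|Jmul z| < r by apply: le_lt_trans zr; exact: Jmul_norm.
  have part (L : E -> E) : differentiable L z -> (forall k, 'D_k L z = L k) ->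
      (forall k, L (Jmul k) = Jmul (L k)) -> `|L z| < r -> holo_at (fun z => f (y + L z)) z.
    move=> dL DL LJ Lr.
    have [ULz _ _] := Hr (L z) (eq_ind_r (fun x => `|x| < r) Lr (subr0 _)).
    have [dfL JfL _ _] := Hf _ ULz.
    have dy : differentiable (fun z => y + L z) z.
      by apply: differentiableD => //; exact: differentiable_cst.
    have Dy k : 'D_k (fun z => y + L z) z = L k.
      rewrite deriveD; [|exact: derivable_cst|exact: diff_derivable].
      by rewrite derive_cst add0r DL.
    split; first exact: (differentiable_comp dy dfL).
    by move=> k; rewrite !(derive_comp _ dy dfL) !Dy LJ JfL.
  have did : differentiable (id : E -> E) z by [].
  have dJ k := derive_linear (@Jmul R n) k did.
  have DJ k : 'D_k (@Jmul R n) z = Jmul k by rewrite (dJ k).2 derive_id.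
  apply: holo_atD; apply: holo_atD.
  - apply: (part id) => // k; exact: derive_id.
  - by apply: (part (@Jmul R n)) => //; exact: (dJ 0).1.
  - apply: (part (fun z => - z)).
    + by apply: differentiableN.
    + by move=> k; rewrite deriveN ?derive_id //; exact: derivable_id.
    + by move=> k; rewrite linearN.
    + by rewrite normrN.
  - apply: (part (fun z => - Jmul z)).
    + by apply: differentiableN; exact: (dJ 0).1.
    + by move=> k; rewrite deriveN ?DJ //; exact: (diff_derivable (dJ 0).1).
    + by move=> k; rewrite linearN.
    + by rewrite normrN.
pose N := `|w| + `|Jmul w|.
pose s1 := ln (r / (N + 1)).
have N0 : 0 <= N by rewrite addr_ge0.
have s1r s : s <= s1 -> expR s * N < r.
  move=> ss; apply: le_lt_trans (_ : expR s1 * N < r).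
    by rewrite ler_wpM2r // ler_expR.
  rewrite /s1 lnK ?posrE ?divr_gt0 ?ltr_wpDl // mulrAC ltr_pdivrMr ?ltr_wpDl //.
  by rewrite ltr_pM2l // ltrDl.
have val s t : s <= s1 -> `|lam (g (polar w (s, t))) - 4 * lam (f y) - expR s ^+ 2 * d|
    <= expR s ^+ 2 * (`|d| / 2).
  move=> ss; have pr := polar_norm w s t; rewrite -/N in pr.
  have /est := le_lt_trans pr (s1r s ss).
  have -> : 'D_(polar w (s, t)) f y = polar ('D_w f y) (s, t).
    by rewrite !polarE (deriveP_lin _ _ _ df) (deriveZv _ _ df) Jf.
  rewrite (lev_rotE w s t oU Uy Cvc) (lev_rotE ('D_w f y) s t oV Vy Cv) -mulrBr.
  move=> H; apply: le_trans H _.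
  have NN : N <= 2 * `|w| by rewrite mulr_natl mulr2n lerD2l Jmul_norm.
  apply: (@mean_aux_e `|d| `|w| (expR s) `|polar w (s, t)|); rewrite ?normr_ge0 ?expR_ge0 //.
  apply: le_trans pr _; apply: le_trans (ler_wpM2l (expR_ge0 s) NN) _.
  by rewrite mulrA [expR s * 2]mulrC.
have s01 : s1 - 1 <= s1 by lra.
have e4 : 4 * expR (s1 - 1) ^+ 2 <= expR s1 ^+ 2.
  have -> : expR s1 = expR 1 * expR (s1 - 1) by rewrite -expRD subrKC.
  rewrite exprMn ler_wpM2r ?exprn_ge0 ?expR_ge0 //.
  have : 2 <= expR 1 :> R by rewrite -[2]/(1 + 1); exact: expR_ge1Dx.
  by move=> h; rewrite (_ : 4 = 2 ^+ 2); [rewrite lerXn2r // nnegrE ?expR_ge0|ring].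
have E0 : 0 < expR (s1 - 1) ^+ 2 by rewrite exprn_gt0 // expR_gt0.
have [dpos|dneg] := leP 0 d.
  rewrite (ger0_norm dpos) in d0 val.
  have := @circle_mean_le R n g lam w r (s1 - 1) s1
    (4 * lam (f y) + expR (s1 - 1) ^+ 2 * (3 / 2 * d))
    (4 * lam (f y) + expR s1 ^+ 2 * (1 / 2 * d)) dg (s1r _ s01) (s1r _ (lexx _)).
  move=> H; have {H} := H (fun t => mean_aux_up (val _ t s01)) (fun t => mean_aux_dn (val _ t (lexx _))).
  by rewrite lerD2l => H; have := mean_aux_end E0 d0 e4; rewrite ltNge H.
rewrite (ltr0_norm dneg) in d0 val.
have := @circle_mean_le R n g lam w r s1 (s1 - 1)
    (4 * lam (f y) + expR s1 ^+ 2 * (1 / 2 * d))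
    (4 * lam (f y) + expR (s1 - 1) ^+ 2 * (3 / 2 * d)) dg (s1r _ (lexx _)) (s1r _ s01).
move=> H; have {H} := H (fun t => mean_aux_up' (val _ t (lexx _))) (fun t => mean_aux_dn' (val _ t s01)).
rewrite lerD2l => H; have := mean_aux_end E0 d0 e4.
by rewrite !mulrN ltrN2 ltNge H.
Unshelve. all: by end_near. Qed.

End Transfer.

(** * Sign of a function vanishing on the boundary *)

Section Barrier.
Variable R : realType.
Variable V : normedModType R.

(** Both u and psi increase in the direction nu near y0, and u is negative at
    y0 - s0 nu. From a point y of Om close to y0, moving in the direction - nu must
    therefore leave Om before the time s0. At the exit time psi vanishes, so psi y
    is positive by the mean value theorem. *)
Lemma barrier (Om O : set V) (u psi : V -> R^o) (y0 nu : V) :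
  open O -> O y0 -> open (Om `&` O) ->
  (forall y, O y -> Om y -> 0 < u y) ->
  (forall y, O y -> closure Om y -> ~ Om y -> psi y = 0) ->
  Ck_on 1 O u -> Ck_on 1 O psi -> u y0 = 0 ->
  0 < 'D_nu u y0 -> 0 < 'D_nu psi y0 ->
  \forall y \near y0, Om y -> 0 < psi y.
Proof.
move=> oO Oy0 oOm upos psi0 Cu Cp u0 du dp.
have cu : {for y0, continuous ('D_nu u)} := Ck_cont (Ck_derive nu Cu) Oy0.
have cp : {for y0, continuous ('D_nu psi)} := Ck_cont (Ck_derive nu Cp) Oy0.
have n1 : \forall y \near y0, 0 < 'D_nu u y by exact: (cvgr_gt _ cu _ du).
have n2 : \forall y \near y0, 0 < 'D_nu psi y by exact: (cvgr_gt _ cp _ dp).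
have n0 := open_near oO Oy0.
have nn : \forall y \near y0, [/\ O y, 0 < 'D_nu u y & 0 < 'D_nu psi y].
  by near=> y; split; [exact: (near n0 y)|exact: (near n1 y)|exact: (near n2 y)].
have [r r0 Hr] := near_normball nn.
have N0 : 0 < `|nu| + 1 by rewrite ltr_wpDl.
pose s0 := r / 2 / (`|nu| + 1).
have s00 : 0 < s0 by rewrite !divr_gt0.
have s0n : s0 * `|nu| < r / 2.
  rewrite /s0 mulrAC ltr_pdivrMr // ltr_pM2l ?divr_gt0 // ltrDl //.
have seg y (s : R) : `|y - y0| < r / 2 -> 0 <= s <= s0 -> `|y - s *: nu - y0| < r.
  move=> yr /andP[s1 s2]; rewrite addrAC; apply: le_lt_trans (ler_normB _ _) _.
  rewrite [ltRHS]splitr ltr_leD // ?ltW // normrZ ger0_norm //.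
  by apply: le_lt_trans s0n; rewrite ler_wpM2r.
have lineE (y : V) (a c : R) : y - a *: nu + c *: nu = y - (a - c) *: nu.
  by rewrite scalerBl opprB addrA addrAC.
have uneg : u (y0 - s0 *: nu) < 0.
  have [|c /andP[c0 cs] E] := @MVT_line R V u (y0 - s0 *: nu) nu s0 s00.
    move=> t /andP[t0 ts]; apply: (Ck_diff Cu).
    have [] // := Hr (y0 - s0 *: nu + t *: nu); rewrite lineE.
    by apply: seg; [rewrite subrr normr0 divr_gt0|apply/andP; split; lra].
  have [_ dc _] : [/\ O (y0 - s0 *: nu + c *: nu), 0 < 'D_nu u (y0 - s0 *: nu + c *: nu) & 0 < 'D_nu psi (y0 - s0 *: nu + c *: nu)].
    apply: Hr; rewrite lineE.
    by apply: seg; [rewrite subrr normr0 divr_gt0|apply/andP; split; lra].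
  move: E; rewrite subrK u0 sub0r => E; rewrite -oppr_gt0 [X in 0 < X]E.
  exact: mulr_gt0.
have Oneg : O (y0 - s0 *: nu).
  have [] // := Hr (y0 - s0 *: nu); apply: seg; first by rewrite subrr normr0 divr_gt0.
  by rewrite lexx ltW.
have n3 : \forall y \near y0, u (y - s0 *: nu) < 0.
  have cc : {for y0, continuous (fun y => u (y - s0 *: nu))}.
    apply: (@continuous_comp V V R^o (fun y => y - s0 *: nu) u).
      apply: cvgB; [exact: cvg_id|exact: cvg_cst].
    exact: differentiable_continuous (Ck_diff Cu Oneg).
  exact: (cvgr_lt _ cc _ uneg).
have n4 : \forall y \near y0, `|y - y0| < r / 2.
  apply/near_shift0; near=> h; rewrite addrC addKr.
  by near: h; apply: nbhs0_lt; rewrite divr_gt0.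
near=> y; move=> Omy.
have yr : `|y - y0| < r / 2 by exact: (near n4 y).
have us0 : u (y - s0 *: nu) < 0 by exact: (near n3 y).
pose T := [set s | 0 <= s <= s0 /\ ~ Om (y - s *: nu)].
have Ts0 : T s0.
  split; first by rewrite lexx ltW.
  move=> Oms; have [Os _ _] := Hr _ (seg y s0 yr (introT andP (conj (ltW s00) (lexx _)))).
  by have := upos _ Os Oms; rewrite ltNge (ltW us0).
have lbT : has_lbound T by exists 0 => s [] /andP[].
have iT : has_inf T by split => //; exists s0.
pose t := inf T.
have t0 : 0 <= t by apply: lb_le_inf; [exists s0|move=> s [] /andP[]].
have ts0 : t <= s0 by apply: ge_inf.
have nearOm (s : R) : 0 <= s <= s0 -> Om (y - s *: nu) -> exists2 d : R, 0 < d &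
    forall s', `|s' - s| < d -> Om (y - s' *: nu).
  move=> sI Oms; have [Os _ _] := Hr _ (seg y s yr sI).
  have [d d0 Hd] := near_normball (open_near oOm (conj Oms Os)).
  exists (d / (`|nu| + 1)); first by rewrite divr_gt0.
  move=> s' s's; apply: (Hd (y - s' *: nu) _).1.
  rewrite opprB addrC addrA subrK -scalerBl normrZ distrC.
  apply: le_lt_trans (_ : `|s' - s| * (`|nu| + 1) < _).
    by rewrite ler_wpM2l // lerDl.
  by rewrite -ltr_pdivlMr.
have below (s : R) : 0 <= s -> s < t -> Om (y - s *: nu).
  move=> s1 st; apply: contrapT => Oms.
  have : t <= s.
    apply: (ge_inf lbT); split; last exact: Oms.
    by rewrite s1 (le_trans (ltW st) ts0).
  by rewrite leNgt st.
have tI : 0 <= t <= s0 by rewrite t0.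
have nOmt : ~ Om (y - t *: nu).
  move=> Omt; have [d d0 Hd] := nearOm t tI Omt.
  have [s [sI nOms] std] := inf_adherent d0 iT.
  have ts : t <= s by exact: (ge_inf lbT (conj sI nOms)).
  apply: nOms; apply: Hd.
  by rewrite ger0_norm ?subr_ge0 // ltrBlDl.
have tpos : 0 < t.
  rewrite lt_neqAle t0 andbT; apply/eqP => t0'.
  by apply: nOmt; rewrite -t0' scale0r subr0.
have clt : closure Om (y - t *: nu).
  move=> B /nbhs_ballP[d /= d0 Bd].
  pose e := Num.min t (d / (`|nu| + 1)) / 2.
  have m0 : 0 < Num.min t (d / (`|nu| + 1)) by rewrite lt_min tpos divr_gt0.
  have e0 : 0 < e by rewrite divr_gt0.
  have em : e < Num.min t (d / (`|nu| + 1)) by rewrite /e ltr_pdivrMr // ltr_pMr // ltr1n.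
  move: em; rewrite lt_min => /andP[et ed].
  exists (y - (t - e) *: nu); split; first by apply: below; lra.
  apply: Bd; rewrite -ball_normE /= opprB addrC addrA subrK -scalerBl.
  rewrite [t - e]addrC addrK scaleNr normrN normrZ (gtr0_norm e0).
  apply: le_lt_trans (_ : e * (`|nu| + 1) < _).
    by rewrite ler_wpM2l ?(ltW e0) // lerDl.
  by rewrite -ltr_pdivlMr.
have psit : psi (y - t *: nu) = 0.
  have [Ot _ _] := Hr _ (seg y t yr tI); exact: psi0.
have [|c /andP[c0 ct] E] := @MVT_line R V psi (y - t *: nu) nu t tpos.
  move=> s /andP[s1 s2]; apply: (Ck_diff Cp).
  have [] // := Hr (y - t *: nu + s *: nu); rewrite lineE.
  by apply: seg => //; apply/andP; split; lra.
move: E; rewrite subrK psit subr0 => ->; apply: mulr_gt0 => //.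
have [] // := Hr (y - t *: nu + c *: nu); rewrite lineE.
by apply: seg => //; apply/andP; split; lra.
Unshelve. all: by end_near. Qed.

End Barrier.

(** * Hermitian forms in real coordinates *)

Section HermitianForm.
Variable R : realType.

(** Completing the square: d times the form with matrix (a, b + i c; b - i c, d) is
    a sum of two squares plus the determinant times |x1 + i x2|^2. *)
Fact herm22_pos (a d b c x1 x2 x3 x4 : R) : 0 < d -> 0 < a * d - b ^+ 2 - c ^+ 2 ->
  [|| x1 != 0, x2 != 0, x3 != 0 | x4 != 0] ->
  0 < a * (x1 ^+ 2 + x2 ^+ 2) + d * (x3 ^+ 2 + x4 ^+ 2)
      + 2 * (b * (x1 * x3 + x2 * x4) + c * (x1 * x4 - x2 * x3)).
Proof.
move=> d0 D0 x0; rewrite -(pmulr_rgt0 _ d0).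
have -> : d * (a * (x1 ^+ 2 + x2 ^+ 2) + d * (x3 ^+ 2 + x4 ^+ 2)
      + 2 * (b * (x1 * x3 + x2 * x4) + c * (x1 * x4 - x2 * x3))) =
  (d * x3 + b * x1 - c * x2) ^+ 2 + (d * x4 + b * x2 + c * x1) ^+ 2 +
  (a * d - b ^+ 2 - c ^+ 2) * (x1 ^+ 2 + x2 ^+ 2) by ring.
set S := x1 ^+ 2 + x2 ^+ 2.
have S0 : 0 <= S by rewrite addr_ge0 ?sqr_ge0.
have [Spos|] := ltP 0 S.
  by rewrite ltr_wpDl ?addr_ge0 ?sqr_ge0 // mulr_gt0.
move=> Sn; have S00 : S = 0 by apply/eqP; rewrite eq_le Sn.
have /andP[/eqP x10 /eqP x20] : (x1 == 0) && (x2 == 0).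
  by move/eqP: S00; rewrite /S paddr_eq0 ?sqr_ge0 // !sqrf_eq0.
rewrite [X in 0 < X](_ : _ = d ^+ 2 * (x3 ^+ 2 + x4 ^+ 2)); last first.
  by rewrite S00 x10 x20; ring.
move: x0; rewrite x10 x20 eqxx /= => x0.
rewrite mulr_gt0 ?exprn_gt0 // lt_neqAle addr_ge0 ?sqr_ge0 // andbT eq_sym.
by rewrite paddr_eq0 ?sqr_ge0 // !sqrf_eq0 negb_and.
Qed.

(** Among the vectors with first component d, the form is smallest at the one with
    second component - b - i c, where its value is d times the determinant. *)
Fact herm22_det_gt0 (a d b c : R) :
  (forall x1 x2 x3 x4 : R, [|| x1 != 0, x2 != 0, x3 != 0 | x4 != 0] ->
  0 < a * (x1 ^+ 2 + x2 ^+ 2) + d * (x3 ^+ 2 + x4 ^+ 2)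
      + 2 * (b * (x1 * x3 + x2 * x4) + c * (x1 * x4 - x2 * x3))) ->
  0 < a * d - b ^+ 2 - c ^+ 2.
Proof.
move=> H; have d0 : 0 < d.
  have := H 0 0 1 0; rewrite oner_eq0 !orbT => /(_ isT).
  by rewrite (_ : _ + _ = d) //; ring.
have := H d 0 (- b) (- c); rewrite gt_eqF //= => /(_ isT).
rewrite (_ : _ + _ = d * (a * d - b ^+ 2 - c ^+ 2)); last by ring.
by rewrite pmulr_rgt0.
Qed.

End HermitianForm.

Section JForm.
Variable R : realType.
Variable n : nat.
Local Notation E := (cspace R n).

(** The complex combination (x1 + i x2) v + (x3 + i x4) w. *)
Definition comb (v w : E) (x1 x2 x3 x4 : R) : E :=
  x1 *: v + (x2 *: Jmul v + (x3 *: w + x4 *: Jmul w)).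

Lemma Jmul_comb v w x1 x2 x3 x4 :
  Jmul (comb v w x1 x2 x3 x4) = comb v w (- x2) x1 (- x4) x3.
Proof.
rewrite /comb !linearP linearZ /= !JmulK !scalerN !scaleNr.
by rewrite addrCA [x3 *: Jmul w + _]addrC.
Qed.

(* B is the real part of a hermitian form, with imaginary part B v (J w) *)
Variable B : E -> E -> R.
Hypotheses (Bsym : forall v w, B v w = B w v)
  (BJ : forall v w, B (Jmul v) (Jmul w) = B v w)
  (BP : forall a v w w', B v (a *: w + w') = a * B v w + B v w').

Let B0 v : B v 0 = 0.
Proof. have := BP 1 v 0 0; rewrite scale1r addr0 mul1r => h; lra. Qed.

Let BZ a v w : B v (a *: w) = a * B v w.
Proof. by have := BP a v w 0; rewrite !addr0 B0 addr0. Qed.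

Let BPl a v v' w : B (a *: v + v') w = a * B v w + B v' w.
Proof. by rewrite Bsym BP !(Bsym w). Qed.

Let BZl a v w : B (a *: v) w = a * B v w.
Proof. by rewrite Bsym BZ (Bsym w). Qed.

Let BvJ v w : B (Jmul v) w = - B v (Jmul w).
Proof. by have := BJ v (Jmul w); rewrite JmulK -scaleN1r BZ => <-; ring. Qed.

Let BJ0 v : B v (Jmul v) = 0.
Proof. by have := BvJ v v; rewrite (Bsym (Jmul v)) => h; lra. Qed.

Lemma Jform_combr v w x1 x2 x3 x4 :
  B v (comb v w x1 x2 x3 x4) = B v v * x1 + B v w * x3 + B v (Jmul w) * x4.
Proof. by rewrite /comb !BP BZ BJ0; ring. Qed.

Lemma Jform_comb v w x1 x2 x3 x4 :
  B (comb v w x1 x2 x3 x4) (comb v w x1 x2 x3 x4) =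
  B v v * (x1 ^+ 2 + x2 ^+ 2) + B w w * (x3 ^+ 2 + x4 ^+ 2)
  + 2 * (B v w * (x1 * x3 + x2 * x4) + B v (Jmul w) * (x1 * x4 - x2 * x3)).
Proof.
rewrite /comb !BPl !BZl !BP !BZ !BJ !BvJ !BJ0.
rewrite ?(Bsym w v) ?(Bsym w (Jmul v)) ?BvJ.
ring.
Qed.

End JForm.

Section LeviForm.
Variable R : realType.
Variable n : nat.
Local Notation E := (cspace R n).
Variables (u : E -> R^o) (U : set E).
Hypotheses (oU : open U) (Cu : Ck_on 2 U u).

Lemma lev_sym x v w : U x -> lev u x v w = lev u x w v.
Proof.
move=> Ux; have E1 := Ck2_schwarz v w oU Ux Cu.
have E2 := Ck2_schwarz (Jmul v) (Jmul w) oU Ux Cu.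
have aux (a b c d : R) : b = a -> d = c -> a + c = b + d by move=> -> ->.
exact: aux E1 E2.
Qed.

Lemma levJ x v w : U x -> lev u x (Jmul v) (Jmul w) = lev u x v w.
Proof.
move=> Ux; have := derive2Zr (- v) (-1) w oU Ux Cu.
have dH e : differentiable ('D_e u) x := Ck_diff (Ck_derive e Cu) Ux.
rewrite (deriveNv v (dH w)) scaleN1r => E1.
rewrite /lev !JmulK.
have aux (a b c : R) : c = -1 * - a -> b + c = a + b by move=> ->; ring.
exact: aux E1.
Qed.

Lemma levPr x a v w w' : U x ->
  lev u x v (a *: w + w') = a * lev u x v w + lev u x v w'.
Proof.
move=> Ux; have E1 := derive2Dr v a w w' oU Ux Cu.
have E2 := derive2Dr (Jmul v) a (Jmul w) (Jmul w') oU Ux Cu.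
rewrite /lev linearP.
have aux (p q p1 p2 q1 q2 : R) : p = a * p1 + p2 -> q = a * q1 + q2 ->
  p + q = a * (p1 + q1) + (p2 + q2) by move=> -> ->; ring.
exact: aux E1 E2.
Qed.

Lemma lev_comb x v w x1 x2 x3 x4 : U x ->
  lev u x (comb v w x1 x2 x3 x4) (comb v w x1 x2 x3 x4) =
  lev u x v v * (x1 ^+ 2 + x2 ^+ 2) + lev u x w w * (x3 ^+ 2 + x4 ^+ 2)
  + 2 * (lev u x v w * (x1 * x3 + x2 * x4)
       + lev u x v (Jmul w) * (x1 * x4 - x2 * x3)).
Proof.
move=> Ux; apply: (Jform_comb (B := lev u x)).
- by move=> v' w'; exact: lev_sym.
- by move=> v' w'; exact: levJ.
- by move=> a v' w' w''; exact: levPr.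
Qed.

Lemma lev_combr x v w x1 x2 x3 x4 : U x ->
  lev u x v (comb v w x1 x2 x3 x4) =
  lev u x v v * x1 + lev u x v w * x3 + lev u x v (Jmul w) * x4.
Proof.
move=> Ux; apply: (Jform_combr (B := lev u x)).
- by move=> v' w'; exact: lev_sym.
- by move=> v' w'; exact: levJ.
- by move=> a v' w' w''; exact: levPr.
Qed.

Lemma derive_comb x v w x1 x2 x3 x4 : U x ->
  'D_(comb v w x1 x2 x3 x4) u x = x1 * 'D_v u x + (x2 * 'D_(Jmul v) u x +
    (x3 * 'D_w u x + x4 * 'D_(Jmul w) u x)).
Proof.
move=> Ux; have du := Ck_diff Cu Ux.
have E1 := deriveP_lin x1 v (x2 *: Jmul v + (x3 *: w + x4 *: Jmul w)) du.
have E2 := deriveP_lin x2 (Jmul v) (x3 *: w + x4 *: Jmul w) du.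
have E3 := deriveP_lin x3 w (x4 *: Jmul w) du.
have E4 := deriveZv x4 (Jmul w) du.
have aux (p q r s p1 p2 p3 p4 : R) : p = x1 * p1 + q -> q = x2 * p2 + r ->
  r = x3 * p3 + s -> s = x4 * p4 ->
  p = x1 * p1 + (x2 * p2 + (x3 * p3 + x4 * p4)) by move=> -> -> -> ->.
exact: aux E1 E2 E3 E4.
Qed.

End LeviForm.

(** * The determinant that decides strict plurisubharmonicity *)

Section PshDet.
Variable R : realType.
Variable n : nat.
Local Notation E := (cspace R n).
Implicit Types (u : E -> R^o) (y : E).

(** Determinant of 4 times the Levi matrix in the frame e1, e2; the off-diagonal
    entry has real and imaginary parts lev e1 e2 and lev e1 (J e2). *)
Definition levdet u (e1 e2 : E) y : R :=
  lev u y e1 e1 * lev u y e2 e2 - lev u y e1 e2 ^+ 2 - lev u y e1 (Jmul e2) ^+ 2.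

(** Up to a negative constant, the determinant of the Levi matrix bordered by the
    complex differential of u. Up to a positive factor it is the Levi form on the
    complex tangent line of the level set of u. *)
Definition levbord u (e1 e2 : E) y : R :=
  lev u y e1 e1 * ('D_e2 u y ^+ 2 + 'D_(Jmul e2) u y ^+ 2)
  + lev u y e2 e2 * ('D_e1 u y ^+ 2 + 'D_(Jmul e1) u y ^+ 2)
  - 2 * (lev u y e1 e2 * ('D_e1 u y * 'D_e2 u y + 'D_(Jmul e1) u y * 'D_(Jmul e2) u y)
    + lev u y e1 (Jmul e2) *
      ('D_e1 u y * 'D_(Jmul e2) u y - 'D_(Jmul e1) u y * 'D_e2 u y)).

(** Determinant in the frame e1, e2 of the hermitian form
    (1 - eta) |du|^2 - u lev, divided by u. At a Levi-flat boundary that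
    determinant vanishes to second order; dividing by u leaves a function that is
    still of class C^1 up to the boundary, and whose normal derivative decides its
    sign. *)
Definition pshdet u (eta : R) (e1 e2 : E) y : R :=
  u y * levdet u e1 e2 y - (1 - eta) * levbord u e1 e2 y.

(** Diagonal entry at e2 of the form whose determinant is u * pshdet. *)
Definition pshdiag u (eta : R) (e2 : E) y : R :=
  (1 - eta) * ('D_e2 u y ^+ 2 + 'D_(Jmul e2) u y ^+ 2) - u y * lev u y e2 e2.

Lemma Ck_lev u (U : set E) v w : open U -> Ck_on 3 U u ->
  Ck_on 1 U (fun y => lev u y v w : R^o).
Proof.
move=> oU Cu; exact: (CkD oU (Ck_derive v (Ck_derive w Cu))
  (Ck_derive (Jmul v) (Ck_derive (Jmul w) Cu))).
Qed.

Lemma lev_pow u (U : set E) (eta : R) y w : open U -> U y ->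
  (forall z, U z -> 0 < u z) -> Ck_on 2 U u ->
  lev (fun z => - (u z `^ eta) : R^o) y w w =
  eta * u y `^ (eta - 2) *
    ((1 - eta) * ('D_w u y ^+ 2 + 'D_(Jmul w) u y ^+ 2) - u y * lev u y w w).
Proof.
move=> oU Uy u0 Cu.
have key v : 'D_v ('D_v (fun z => - (u z `^ eta) : R^o)) y =
    eta * u y `^ (eta - 2) * ((1 - eta) * 'D_v u y ^+ 2 - u y * 'D_v ('D_v u) y).
  have D1 z : U z -> (- eta) *: (u z `^ (eta - 1) * 'D_v u z : R^o) =
      'D_v (fun z => - (u z `^ eta) : R^o) z.
    move=> Uz; have [dp Dp] := derive_comp1 v (Ck_diff Cu Uz) (is_derive1_powR eta (u0 _ Uz)).
    rewrite deriveN; last exact: diff_derivable.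
    rewrite Dp /GRing.scale /=; ring.
  rewrite -(open_eq_derive v oU Uy D1).
  have [dp Dp] := derive_comp1 v (Ck_diff Cu Uy) (is_derive1_powR (eta - 1) (u0 _ Uy)).
  have dv := Ck_diff (Ck_derive v Cu) Uy.
  rewrite deriveZ; last first.
    by apply: derivableM; apply: diff_derivable.
  rewrite (@deriveM _ _ (fun z => u z `^ (eta - 1)) ('D_v u)); [|exact: diff_derivable..].
  rewrite Dp.
  have -> : eta - 1 - 1 = eta - 2 by ring.
  have -> : u y `^ (eta - 1) = u y `^ (eta - 2) * u y.
    rewrite -[X in _ * X]powRr1 ?ltW ?u0 // -powRD; last by rewrite (gt_eqF (u0 _ Uy)) implybT.
    by congr (_ `^ _); ring.
  have aux (a b c d e : R) : - a *: ((b * c *: d : R^o) + e *: ((a - 1) * b * e : R^o) : R^o) =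
      a * b * ((1 - a) * e ^+ 2 - c * d) by rewrite /GRing.scale /=; ring.
  exact: aux.
have aux (p q a b c c' d d' e : R) :
  p = a * ((1 - b) * c ^+ 2 - e * d) -> q = a * ((1 - b) * c' ^+ 2 - e * d') ->
  p + q = a * ((1 - b) * (c ^+ 2 + c' ^+ 2) - e * (d + d')) by move=> -> ->; ring.
exact: aux (key w) (key (Jmul w)).
Qed.

Fact qform_aux (h u p1 p2 r1 r2 l11 l22 lb lc x1 x2 x3 x4 dw djw lw : R) :
  dw = x1 * p1 + (x2 * p2 + (x3 * r1 + x4 * r2)) ->
  djw = - x2 * p1 + (x1 * p2 + (- x4 * r1 + x3 * r2)) ->
  lw = l11 * (x1 ^+ 2 + x2 ^+ 2) + l22 * (x3 ^+ 2 + x4 ^+ 2)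
       + 2 * (lb * (x1 * x3 + x2 * x4) + lc * (x1 * x4 - x2 * x3)) ->
  h * (dw ^+ 2 + djw ^+ 2) - u * lw =
  (h * (p1 ^+ 2 + p2 ^+ 2) - u * l11) * (x1 ^+ 2 + x2 ^+ 2) +
  (h * (r1 ^+ 2 + r2 ^+ 2) - u * l22) * (x3 ^+ 2 + x4 ^+ 2) +
  2 * ((h * (p1 * r1 + p2 * r2) - u * lb) * (x1 * x3 + x2 * x4) +
       (h * (p1 * r2 - p2 * r1) - u * lc) * (x1 * x4 - x2 * x3)).
Proof. by move=> -> -> ->; ring. Qed.

Fact qdet_aux (h u p1 p2 r1 r2 l11 l22 lb lc : R) :
  (h * (p1 ^+ 2 + p2 ^+ 2) - u * l11) * (h * (r1 ^+ 2 + r2 ^+ 2) - u * l22)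
  - (h * (p1 * r1 + p2 * r2) - u * lb) ^+ 2
  - (h * (p1 * r2 - p2 * r1) - u * lc) ^+ 2 =
  u * (u * (l11 * l22 - lb ^+ 2 - lc ^+ 2) - h *
   (l11 * (r1 ^+ 2 + r2 ^+ 2) + l22 * (p1 ^+ 2 + p2 ^+ 2)
    - 2 * (lb * (p1 * r1 + p2 * r2) + lc * (p1 * r2 - p2 * r1)))).
Proof. by ring. Qed.

(** The hermitian form (1 - eta) |du|^2 - u lev, which lev_pow relates to - u^eta,
    in the frame e1, e2. The first summand has rank one, so the terms of its
    determinant without a factor u cancel. *)
Lemma lev_pow_comb u (U : set E) (eta : R) y e1 e2 : open U -> U y ->
  Ck_on 2 U u ->
  exists a b c : R,
  (forall (x1 x2 x3 x4 : R), let w := comb e1 e2 x1 x2 x3 x4 in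
  (1 - eta) * ('D_w u y ^+ 2 + 'D_(Jmul w) u y ^+ 2) - u y * lev u y w w =
  a * (x1 ^+ 2 + x2 ^+ 2) + pshdiag u eta e2 y * (x3 ^+ 2 + x4 ^+ 2)
      + 2 * (b * (x1 * x3 + x2 * x4) + c * (x1 * x4 - x2 * x3))) /\
  a * pshdiag u eta e2 y - b ^+ 2 - c ^+ 2 = u y * pshdet u eta e1 e2 y.
Proof.
move=> oU Uy Cu.
exists ((1 - eta) * ('D_e1 u y ^+ 2 + 'D_(Jmul e1) u y ^+ 2) - u y * lev u y e1 e1),
  ((1 - eta) * ('D_e1 u y * 'D_e2 u y + 'D_(Jmul e1) u y * 'D_(Jmul e2) u y)
  - u y * lev u y e1 e2),
  ((1 - eta) * ('D_e1 u y * 'D_(Jmul e2) u y - 'D_(Jmul e1) u y * 'D_e2 u y)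
  - u y * lev u y e1 (Jmul e2)); split; last exact: qdet_aux.
move=> x1 x2 x3 x4 w; rewrite /w Jmul_comb.
exact: (qform_aux _ _ (derive_comb Cu e1 e2 x1 x2 x3 x4 Uy)
  (derive_comb Cu e1 e2 (- x2) x1 (- x4) x3 Uy)
  (lev_comb oU Cu e1 e2 x1 x2 x3 x4 Uy)).
Qed.

Definition free2 (e1 e2 : E) := forall x1 x2 x3 x4 : R,
  comb e1 e2 x1 x2 x3 x4 = 0 -> [/\ x1 = 0, x2 = 0, x3 = 0 & x4 = 0].

Lemma comb_neq0 e1 e2 (x1 x2 x3 x4 : R) : free2 e1 e2 ->
  [|| x1 != 0, x2 != 0, x3 != 0 | x4 != 0] -> comb e1 e2 x1 x2 x3 x4 != 0.
Proof.
move=> fr x0; apply: contraTneq x0 => /fr[-> -> -> ->].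
by rewrite !eqxx.
Qed.

Lemma pshdet_necessary u (U : set E) (eta : R) y e1 e2 : open U -> U y ->
  Ck_on 2 U u -> (forall z, U z -> 0 < u z) -> 0 < eta -> free2 e1 e2 ->
  (forall w, w != 0 -> 0 < lev (fun z => - (u z `^ eta) : R^o) y w w) ->
  0 < pshdet u eta e1 e2 y.
Proof.
move=> oU Uy Cu u0 eta0 fr H.
have [a [b [c [E1 E2]]]] := lev_pow_comb eta e1 e2 oU Uy Cu.
have f0 : 0 < eta * u y `^ (eta - 2) by rewrite mulr_gt0 // powR_gt0 // u0.
have aux (A B C : R) : A = B * C -> 0 < B -> 0 < A -> 0 < C.
  by move=> -> B0; rewrite pmulr_rgt0.
have aux2 (X k Y Z : R) : X = k * Y -> Y = Z -> 0 < k -> 0 < X -> 0 < Z.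
  by move=> -> -> k0; rewrite pmulr_rgt0.
apply: (aux _ _ _ E2 (u0 _ Uy)); apply: herm22_det_gt0 => x1 x2 x3 x4 x0.
exact: (aux2 _ _ _ _ (lev_pow eta _ oU Uy u0 Cu) (E1 x1 x2 x3 x4) f0
  (H _ (comb_neq0 fr x0))).
Qed.

Lemma pshdet_sufficient u (U : set E) (eta : R) y e1 e2 : open U -> U y ->
  Ck_on 2 U u -> (forall z, U z -> 0 < u z) -> 0 < eta ->
  (forall w, exists x1 x2 x3 x4, w = comb e1 e2 x1 x2 x3 x4) ->
  0 < pshdiag u eta e2 y -> 0 < pshdet u eta e1 e2 y ->
  forall w, w != 0 -> 0 < lev (fun z => - (u z `^ eta) : R^o) y w w.
Proof.
move=> oU Uy Cu u0 eta0 sp p22 p w w0.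
have [a [b [c [E1 E2]]]] := lev_pow_comb eta e1 e2 oU Uy Cu.
have f0 : 0 < eta * u y `^ (eta - 2) by rewrite mulr_gt0 // powR_gt0 // u0.
have [x1 [x2 [x3 [x4 wE]]]] := sp w.
have aux (X k Y Z : R) : X = k * Y -> Y = Z -> 0 < k -> 0 < Z -> 0 < X.
  by move=> -> -> k0; rewrite pmulr_rgt0.
have aux2 (A B C : R) : A = B * C -> 0 < B -> 0 < C -> 0 < A.
  by move=> -> B0; rewrite pmulr_rgt0.
have x0 : [|| x1 != 0, x2 != 0, x3 != 0 | x4 != 0].
  apply: contraNT w0; rewrite !negb_or !negbK wE => /and4P[/eqP-> /eqP-> /eqP-> /eqP->].
  by rewrite /comb !scale0r !addr0.
rewrite wE; exact: (aux _ _ _ _ (lev_pow eta _ oU Uy u0 Cu) (E1 x1 x2 x3 x4) f0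
  (herm22_pos p22 (aux2 _ _ _ E2 (u0 _ Uy) p) x0)).
Qed.

Lemma Ck_pshdet_aux (U : set E) (h : R) (v l11 l22 lb lc p1 p2 r1 r2 : E -> R^o) :
  open U -> Ck_on 1 U v -> Ck_on 1 U l11 -> Ck_on 1 U l22 -> Ck_on 1 U lb ->
  Ck_on 1 U lc -> Ck_on 1 U p1 -> Ck_on 1 U p2 -> Ck_on 1 U r1 -> Ck_on 1 U r2 ->
  Ck_on 1 U (fun y => v y * (l11 y * l22 y - lb y ^+ 2 - lc y ^+ 2) - h *
   (l11 y * (r1 y ^+ 2 + r2 y ^+ 2) + l22 y * (p1 y ^+ 2 + p2 y ^+ 2)
    - 2 * (lb y * (p1 y * r1 y + p2 y * r2 y) + lc y * (p1 y * r2 y - p2 y * r1 y))) : R^o).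
Proof.
move=> oU Cv C11 C22 Cb Cc Cp1 Cp2 Cr1 Cr2.
have CX (f : E -> R^o) : Ck_on 1 U f -> Ck_on 1 U (fun x => f x ^+ 2 : R^o).
  by move=> Cf; apply: (Ck_ext oU _ (CkM oU Cf Cf)) => y _; rewrite expr2.
have CK (c : R) : Ck_on 1 U (fun _ : E => c : R^o) := @Ck_cst R E R^o 1 U c.
have D1 := CkD oU (CkD oU (CkM oU C11 C22) (CkN oU (CX _ Cb))) (CkN oU (CX _ Cc)).
have D2 := CkD oU (CkM oU C11 (CkD oU (CX _ Cr1) (CX _ Cr2)))
  (CkM oU C22 (CkD oU (CX _ Cp1) (CX _ Cp2))).
have D3 := CkM oU Cb (CkD oU (CkM oU Cp1 Cr1) (CkM oU Cp2 Cr2)).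
have D4 := CkM oU Cc (CkD oU (CkM oU Cp1 Cr2) (CkN oU (CkM oU Cp2 Cr1))).
have D5 := CkM oU (CK 2) (CkD oU D3 D4).
exact: (CkD oU (CkM oU Cv D1) (CkN oU (CkM oU (CK h) (CkD oU D2 (CkN oU D5))))).
Qed.

Lemma Ck_pshdet u (U : set E) (eta : R) e1 e2 : open U -> Ck_on 3 U u ->
  Ck_on 1 U (pshdet u eta e1 e2 : E -> R^o).
Proof.
move=> oU Cu; have Cl v w := Ck_lev v w oU Cu.
have Cd v : Ck_on 1 U ('D_v u) := CkW (Ck_derive v Cu).
exact: (Ck_pshdet_aux (1 - eta) oU (CkW (CkW Cu)) (Cl e1 e1) (Cl e2 e2) (Cl e1 e2)
  (Cl e1 (Jmul e2)) (Cd e1) (Cd (Jmul e1)) (Cd e2) (Cd (Jmul e2))).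
Qed.

Fact pshdet_ring_aux (h a1 a2 a3 a4 a5 a6 a7 a8 a9 a10 a11 a12 a13 : R) :
  0 * (0 * a3 + a13 * a2 - (a10 * a4 + a10 * a4) - (a11 * a5 + a11 * a5))
  + (0 * a13 - a10 ^+ 2 - a11 ^+ 2) * a1
  - (h * (0 * (a12 * a8 + a12 * a8 + (0 * a9 + 0 * a9)) + (a12 ^+ 2 + 0 ^+ 2) * a2
     + (a13 * (0 * a6 + 0 * a6 + (0 * a7 + 0 * a7)) + (0 ^+ 2 + 0 ^+ 2) * a3)
     - (2 * (a10 * (0 * a8 + a12 * a6 + (0 * a9 + 0 * a7)) + (0 * a12 + 0 * 0) * a4
           + (a11 * (0 * a9 + 0 * a6 - (0 * a8 + a12 * a7)) + (0 * 0 - 0 * a12) * a5))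
        + (a10 * (0 * a12 + 0 * 0) + a11 * (0 * 0 - 0 * a12)) * 0))
   + (0 * (a12 ^+ 2 + 0 ^+ 2) + a13 * (0 ^+ 2 + 0 ^+ 2)
     - 2 * (a10 * (0 * a12 + 0 * 0) + a11 * (0 * 0 - 0 * a12))) * 0) =
  a1 * (- a10 ^+ 2 - a11 ^+ 2)
  - h * (a2 * a12 ^+ 2 - 2 * (a10 * (a6 * a12) - a11 * (a7 * a12))).
Proof. by ring. Qed.

Lemma derive_pshdet_aux (h : R) (v l11 l22 lb lc p1 p2 r1 r2 : E -> R^o) y nu :
  differentiable v y -> differentiable l11 y -> differentiable l22 y ->
  differentiable lb y -> differentiable lc y -> differentiable p1 y ->
  differentiable p2 y -> differentiable r1 y -> differentiable r2 y ->
  v y = 0 -> l11 y = 0 -> p1 y = 0 -> p2 y = 0 -> r2 y = 0 ->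
  'D_nu (fun y => v y * (l11 y * l22 y - lb y ^+ 2 - lc y ^+ 2) - h *
   (l11 y * (r1 y ^+ 2 + r2 y ^+ 2) + l22 y * (p1 y ^+ 2 + p2 y ^+ 2)
    - 2 * (lb y * (p1 y * r1 y + p2 y * r2 y) + lc y * (p1 y * r2 y - p2 y * r1 y))) : R^o) y
  = 'D_nu v y * (- lb y ^+ 2 - lc y ^+ 2) - h * ('D_nu l11 y * r1 y ^+ 2
    - 2 * (lb y * ('D_nu p1 y * r1 y) - lc y * ('D_nu p2 y * r1 y))).
Proof.
move=> dv d11 d22 db dc dp1 dp2 dr1 dr2 v0 l0 p10 p20 r20.
have iv := derivableP (@diff_derivable _ _ _ _ _ nu dv).
have i11 := derivableP (@diff_derivable _ _ _ _ _ nu d11).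
have i22 := derivableP (@diff_derivable _ _ _ _ _ nu d22).
have ib := derivableP (@diff_derivable _ _ _ _ _ nu db).
have ic := derivableP (@diff_derivable _ _ _ _ _ nu dc).
have ip1 := derivableP (@diff_derivable _ _ _ _ _ nu dp1).
have ip2 := derivableP (@diff_derivable _ _ _ _ _ nu dp2).
have ir1 := derivableP (@diff_derivable _ _ _ _ _ nu dr1).
have ir2 := derivableP (@diff_derivable _ _ _ _ _ nu dr2).
have iM (f g : E -> R^o) a b : is_derive y nu f a -> is_derive y nu g b ->
    is_derive y nu (fun x => f x * g x : R^o) (f y * b + g y * a).
  by move=> i1 i2; exact: is_deriveM.
have iD (f g : E -> R^o) a b : is_derive y nu f a -> is_derive y nu g b ->
    is_derive y nu (fun x => f x + g x : R^o) (a + b).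
  by move=> i1 i2; exact: is_deriveD.
have iN (f : E -> R^o) a : is_derive y nu f a ->
    is_derive y nu (fun x => - f x : R^o) (- a).
  by move=> i1; exact: is_deriveN.
have iX (f : E -> R^o) a : is_derive y nu f a ->
    is_derive y nu (fun x => f x ^+ 2 : R^o) (f y * a + f y * a).
  by move=> i1; have -> : (fun x => f x ^+ 2 : R^o) = (fun x => f x * f x);
    [apply/funext => x; rewrite expr2|exact: iM].
have iC (c : R) : is_derive y nu (fun _ : E => c : R^o) 0 by exact: is_derive_cst.
have D1 := iD _ _ _ _ (iD _ _ _ _ (iM _ _ _ _ i11 i22) (iN _ _ (iX _ _ ib))) (iN _ _ (iX _ _ ic)).
have D2 := iD _ _ _ _ (iM _ _ _ _ i11 (iD _ _ _ _ (iX _ _ ir1) (iX _ _ ir2)))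
  (iM _ _ _ _ i22 (iD _ _ _ _ (iX _ _ ip1) (iX _ _ ip2))).
have D3 := iM _ _ _ _ ib (iD _ _ _ _ (iM _ _ _ _ ip1 ir1) (iM _ _ _ _ ip2 ir2)).
have D4 := iM _ _ _ _ ic (iD _ _ _ _ (iM _ _ _ _ ip1 ir2) (iN _ _ (iM _ _ _ _ ip2 ir1))).
have D5 := iM _ _ _ _ (iC 2) (iD _ _ _ _ D3 D4).
have D6 := iD _ _ _ _ (iM _ _ _ _ iv D1)
  (iN _ _ (iM _ _ _ _ (iC h) (iD _ _ _ _ D2 (iN _ _ D5)))).
apply: (etrans (@derive_val _ _ _ _ _ _ _ D6)).
rewrite v0 l0 p10 p20 r20.
move: ('D_nu v y) ('D_nu l11 y) ('D_nu l22 y) ('D_nu lb y) ('D_nu lc y)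
  ('D_nu p1 y) ('D_nu p2 y) ('D_nu r1 y) ('D_nu r2 y) (lb y) (lc y) (r1 y) (l22 y).
move=> a1 a2 a3 a4 a5 a6 a7 a8 a9 a10 a11 a12 a13.
exact: pshdet_ring_aux.
Qed.

(** At a boundary point, with e1 tangent to the leaf and e2 pointing across the
    boundary, most factors of pshdet vanish, and only the products with a single
    vanishing factor contribute. *)
Lemma derive_pshdet0 u (U : set E) (eta : R) (e1 e2 : E) y nu : open U -> U y ->
  Ck_on 3 U u -> u y = 0 -> 'D_e1 u y = 0 -> 'D_(Jmul e1) u y = 0 ->
  'D_(Jmul e2) u y = 0 -> lev u y e1 e1 = 0 ->
  'D_nu (pshdet u eta e1 e2 : E -> R^o) y =
  'D_nu u y * (- lev u y e1 e2 ^+ 2 - lev u y e1 (Jmul e2) ^+ 2) -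
  (1 - eta) * ('D_nu (fun y => lev u y e1 e1 : R^o) y * 'D_e2 u y ^+ 2
    - 2 * (lev u y e1 e2 * ('D_nu ('D_e1 u) y * 'D_e2 u y)
         - lev u y e1 (Jmul e2) * ('D_nu ('D_(Jmul e1) u) y * 'D_e2 u y))).
Proof.
move=> oU Uy Cu u0 p10 p20 r20 l0.
have dl v w := Ck_diff (Ck_lev v w oU Cu) Uy.
have dd v := Ck_diff (Ck_derive v Cu) Uy.
exact: (derive_pshdet_aux (1 - eta) nu (Ck_diff Cu Uy) (dl e1 e1) (dl e2 e2) (dl e1 e2)
  (dl e1 (Jmul e2)) (dd e1) (dd (Jmul e1)) (dd e2) (dd (Jmul e2)) u0 l0 p10 p20 r20).
Qed.

End PshDet.

(** * Computation along the leaves *)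

Fact leaf_ring_aux (R : realType) (dpsi h H Ha Hb Lb Lc d11 dp1 dp2 lap ltau Dt1 Dt2
    x1 x2 x3 x4 q1 q2 p1 p2 r2 l0 : R) :
  dpsi = H * (- Lb ^+ 2 - Lc ^+ 2) - h * (d11 * H ^+ 2
    - 2 * (Lb * (dp1 * H) - Lc * (dp2 * H))) ->
  Ha = Lb -> Hb = - Lc -> lap = d11 + 2 * ltau ->
  Ha = Dt1 + q1 -> Hb = Dt2 + q2 -> q1 = dp1 -> q2 = dp2 ->
  Dt1 = x1 * p1 + (x2 * p2 + (x3 * H + x4 * r2)) ->
  Dt2 = - x2 * p1 + (x1 * p2 + (- x4 * H + x3 * r2)) ->
  ltau = l0 * x1 + Lb * x3 + Lc * x4 -> p1 = 0 -> p2 = 0 -> r2 = 0 -> l0 = 0 ->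
  dpsi = H * (h * (2 * (Ha ^+ 2 + Hb ^+ 2) - H * lap) - (Ha ^+ 2 + Hb ^+ 2)).
Proof.
move=> -> HaE HbE -> Ha' Hb' <- <- D1 D2 -> p10 p20 r20 ->.
rewrite p10 p20 r20 in D1 D2.
have -> : q1 = Ha - x3 * H by rewrite Ha' D1; ring.
have -> : q2 = Hb + x4 * H by rewrite Hb' D2; ring.
have -> : Lb = Ha by [].
have -> : Lc = - Hb by rewrite HbE opprK.
by ring.
Qed.

Fact leaf_aux1 (R : realType) (x y z k : R) :
  x + y = 0 -> k + z = 0 -> k = - x -> y + z = 0.
Proof. by move=> h1 h2 h3; lra. Qed.

Fact leaf_aux2 (R : realType) (x p r s z : R) :
  x = p + r -> p + s = 0 -> z = -1 * s -> x = r + z.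
Proof. by move=> -> h1 ->; lra. Qed.

Fact leaf_aux3 (R : realType) (x k r p s z z' : R) : x = k + r -> p + s = 0 ->
  k = - p -> z = -1 * s -> z' = -1 * r -> x = - (z + z').
Proof. by move=> -> h1 -> -> ->; lra. Qed.

Section Leaf.
Variable R : realType.
Variable n : nat.
Local Notation E := (cspace R n).
Variable Q : normedModType R.

Lemma derive_Jmul (G : Q -> E) v q : differentiable G q ->
  differentiable (fun y => Jmul (G y)) q /\
  'D_v (fun y => Jmul (G y)) q = Jmul ('D_v G q).
Proof. exact: (@derive_linear R (n + n) Q E (@Jmul R n) G q v). Qed.

Lemma Ck_coord m (G : Q -> 'rV[R]_m) k (U : set Q) i : open U -> Ck_on k U G ->
  Ck_on k U (fun x => G x 0 i : R^o).
Proof.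
move=> oU; elim: k G => [|k IH] G CG.
  move=> x Ux; apply: (@continuous_comp Q 'rV[R]_m R^o G (fun M => M 0 i)).
    exact: (Ck_cont CG Ux).
  exact/differentiable_continuous/differentiable_coord.
split=> [x Ux|v]; first exact: differentiable_coordE (Ck_diff CG Ux).
apply: (Ck_ext oU _ (IH _ (Ck_derive v CG))) => y Uy.
by rewrite derive_coord //; exact: (Ck_diff CG Uy).
Qed.

Lemma schwarz_rV m (G : Q -> 'rV[R]_m) (U : set Q) v w q : open U -> U q ->
  Ck_on 2 U G -> 'D_w ('D_v G) q = 'D_v ('D_w G) q.
Proof.
move=> oU Uq CG; apply/rowP => i.
have dG e : differentiable ('D_e G) q := Ck_diff (Ck_derive e CG) Uq.
have key e e' : ('D_e ('D_e' G) q) 0 i = 'D_e ('D_e' (fun x => G x 0 i : R^o)) q.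
  rewrite -(derive_coord e i (dG e')).
  apply: (open_eq_derive e oU Uq) => y Uy.
  by rewrite derive_coord //; exact: (Ck_diff CG Uy).
exact: (etrans (key w v) (etrans (Ck2_schwarz v w oU Uq (Ck_coord i oU CG))
  (esym (key v w)))).
Qed.

Variables (a b : Q) (V : set Q).
Hypothesis oV : open V.

Lemma holo_laplacian (G : Q -> E) q : V q -> Ck_on 2 V G ->
  (forall q, V q -> 'D_b G q = Jmul ('D_a G q)) ->
  'D_b ('D_b G) q = - 'D_a ('D_a G) q.
Proof.
move=> Vq CG JG.
have dG e : differentiable ('D_e G) q := Ck_diff (Ck_derive e CG) Vq.
rewrite (open_eq_derive b oV Vq JG) (derive_Jmul b (dG a)).2.
rewrite (schwarz_rV a b oV Vq CG) (open_eq_derive a oV Vq JG).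
by rewrite (derive_Jmul a (dG a)).2 JmulK.
Qed.

Lemma holo_transverse (G : Q -> E) t q : V q -> Ck_on 2 V G ->
  (forall q, V q -> 'D_b G q = Jmul ('D_a G q)) ->
  'D_b ('D_t G) q = Jmul ('D_a ('D_t G) q).
Proof.
move=> Vq CG JG.
have dG e : differentiable ('D_e G) q := Ck_diff (Ck_derive e CG) Vq.
rewrite (schwarz_rV t b oV Vq CG) (open_eq_derive t oV Vq JG).
by rewrite (derive_Jmul t (dG a)).2 (schwarz_rV a t oV Vq CG).
Qed.

Variables (t : Q) (F : Q -> E) (B : set E) (u : E -> R^o).
Hypotheses (oB : open B) (CF : Ck_on 3 V F) (Cu : Ck_on 3 B u).
Hypotheses (FB : forall q, V q -> B (F q)) (uF : forall q, V q -> u (F q) = 0).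
Hypothesis JF : forall q, V q -> 'D_b F q = Jmul ('D_a F q).

Let T := 'D_t F.
Let CT : Ck_on 2 V T := Ck_derive t CF.
Let C2F : Ck_on 2 V F := CkW CF.
Let C2u : Ck_on 2 B u := CkW Cu.
Let dF q : V q -> differentiable F q. Proof. exact: (Ck_diff CF). Qed.
Let dDF v q : V q -> differentiable ('D_v F) q.
Proof. exact: (Ck_diff (Ck_derive v CF)). Qed.
Let dT q : V q -> differentiable T q. Proof. exact: (Ck_diff CT). Qed.
Let dDT v q : V q -> differentiable ('D_v T) q.
Proof. exact: (Ck_diff (Ck_derive v CT)). Qed.

(** The function H with |H| = h_delta, in a fixed chart. *)
Definition normal_der (q : Q) : R^o := 'D_(Jmul ('D_t F q)) u (F q).
Local Notation H := normal_der.

Lemma leaf_du v q : V q -> 'D_('D_v F q) u (F q) = 0.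
Proof.
move=> Vq; rewrite -(derive_comp v (dF Vq) (Ck_diff Cu (FB Vq))).
have E0 q' : V q' -> u (F q') = (cst 0 : Q -> R^o) q' by move=> V'; rewrite uF.
by rewrite (open_eq_derive v oV Vq E0) derive_cst.
Qed.

Lemma leaf_ddu v w q : V q ->
  'D_('D_w ('D_v F) q) u (F q) + 'D_('D_w F q) ('D_('D_v F q) u) (F q) = 0.
Proof.
move=> Vq.
rewrite -(derive_along w oB C2u (FB Vq) (dF Vq) (dDF v Vq)).2.
have E0 q' : V q' -> 'D_('D_v F q') u (F q') = (cst 0 : Q -> R^o) q'.
  by move=> V'; rewrite leaf_du.
by rewrite (open_eq_derive w oV Vq E0) derive_cst.
Qed.

(** The leaves are complex curves on which u vanishes, so the Laplacian of u o F
    in z' is zero; it equals the Levi form of u on the tangent of the leaf, because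
    the components of F are harmonic in z'. *)
Lemma leaf_lev q : V q -> lev u (F q) ('D_a F q) ('D_a F q) = 0.
Proof.
move=> Vq; have E1 := leaf_ddu a a Vq; have E2 := leaf_ddu b b Vq.
rewrite (holo_laplacian Vq C2F JF) (JF Vq) in E2.
have E3 := deriveNv ('D_a ('D_a F) q) (Ck_diff Cu (FB Vq)).
exact: leaf_aux1 E1 E2 E3.
Qed.

Let dJT v q : V q -> differentiable (fun q => Jmul (T q)) q /\
  'D_v (fun q => Jmul (T q)) q = Jmul ('D_v T q).
Proof. by move=> Vq; exact: (derive_Jmul v (dT Vq)). Qed.

Lemma derive_H v q : V q -> differentiable H q /\ 'D_v H q =
  'D_(Jmul ('D_v T q)) u (F q) + 'D_('D_v F q) ('D_(Jmul (T q)) u) (F q).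
Proof.
move=> Vq.
have [d1 D1] := derive_along v oB C2u (FB Vq) (dF Vq) (dJT v Vq).1.
by rewrite (dJT v Vq).2 in D1.
Qed.

Lemma derive2_H v w q : V q -> differentiable ('D_v H) q /\ 'D_w ('D_v H) q =
  ('D_(Jmul ('D_w ('D_v T) q)) u (F q)
   + 'D_('D_w F q) ('D_(Jmul ('D_v T q)) u) (F q))
  + ('D_('D_w ('D_v F) q) ('D_(Jmul (T q)) u) (F q)
   + 'D_('D_v F q) ('D_(Jmul ('D_w T q)) u) (F q)
   + 'D_('D_w F q) ('D_('D_v F q) ('D_(Jmul (T q)) u)) (F q)).
Proof.
move=> Vq.
have dJDT := derive_Jmul w (dDT v Vq).
have [d1 D1] := derive_along w oB C2u (FB Vq) (dF Vq) dJDT.1.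
have [d2 D2] := derive_along2 w oB Cu (FB Vq) (dF Vq) (dDF v Vq) (dJT w Vq).1.
rewrite dJDT.2 in D1; rewrite (dJT w Vq).2 in D2.
have E0 q' : V q' -> 'D_(Jmul ('D_v T q')) u (F q') + 'D_('D_v F q') ('D_(Jmul (T q')) u) (F q')
    = 'D_v H q' by move=> V'; exact: (esym (derive_H v V').2).
split; first exact: (open_eq_diff oV Vq E0 (differentiableD d1 d2)).
apply: (etrans (esym (open_eq_derive w oV Vq E0))).
apply: (etrans (deriveD (diff_derivable d1) (diff_derivable d2))).
exact: (f_equal2 +%R D1 D2).
Qed.

Lemma derive2_H_sym v w q : V q -> 'D_w ('D_v H) q = 'D_v ('D_w H) q.
Proof.
move=> Vq; have [_ E1] := derive2_H v w Vq; have [_ E2] := derive2_H w v Vq.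
rewrite -(schwarz_rV v w oV Vq CT) -(schwarz_rV v w oV Vq C2F) in E2.
have S := Ck2_schwarz ('D_v F q) ('D_w F q) oB (FB Vq) (Ck_derive (Jmul (T q)) Cu).
have aux (x y p q1 q2 q3 r1 r2 : R) : x = (p + q1) + (q2 + q3 + r1) ->
  y = (p + q3) + (q2 + q1 + r2) -> r1 = r2 -> x = y by move=> -> -> ->; ring.
exact: aux E1 E2 S.
Qed.

Section AtPoint.
Variable q : Q.
Hypothesis Vq : V q.
Let l := 'D_a F q.
Let m := Jmul (T q).
Let tau := 'D_a T q.

Let DbT : 'D_b T q = Jmul tau.
Proof. exact: (holo_transverse t Vq C2F JF). Qed.

(** The derivative of H contains the term du (J d_a d_t F), which is second order
    in F. The identity u o F = 0, differentiated in t and in z', rewrites it as a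
    second derivative of u; this and leaf_Hb identify the off-diagonal Levi entry
    of the frame (l, m) with the z'-derivative of H. *)
Lemma leaf_Ha : 'D_a H q = lev u (F q) l m.
Proof.
have [_ E1] := derive_H a Vq.
have E2 := leaf_ddu t b Vq; rewrite -/T DbT (JF Vq) in E2.
have E3 := derive2Zr (Jmul l) (-1) (T q) oB (FB Vq) C2u.
rewrite scaleN1r -(JmulK (T q)) in E3.
exact: leaf_aux2 E1 E2 E3.
Qed.

Lemma leaf_Hb : 'D_b H q = - lev u (F q) l (Jmul m).
Proof.
have [_ E1] := derive_H b Vq; rewrite DbT JmulK (JF Vq) in E1.
have E2 := leaf_ddu t a Vq; rewrite -/T -/tau in E2.
have E3 := deriveNv tau (Ck_diff Cu (FB Vq)).
have E4 := derive2Zr l (-1) (T q) oB (FB Vq) C2u.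
rewrite scaleN1r -(JmulK (T q)) in E4.
have E5 := derive2Zr (Jmul l) (-1) m oB (FB Vq) C2u.
rewrite scaleN1r -(JmulK m) in E5.
exact: leaf_aux3 E1 E2 E3 E4 E5.
Qed.

(** The second derivatives of F and of d_t F cancel because both are harmonic in
    z'. What remains is the derivative of the Levi form of the leaf direction in
    the normal direction, and a term with the first derivative of d_t F. *)
Lemma leaf_lapH : 'D_a ('D_a H) q + 'D_b ('D_b H) q =
  'D_m (fun y => lev u y l l : R^o) (F q) + 2 * lev u (F q) l (Jmul tau).
Proof.
have [_ E1] := derive2_H a a Vq; have [_ E2] := derive2_H b b Vq.
rewrite (holo_laplacian Vq C2F JF) in E2.
have JT q' : V q' -> 'D_b T q' = Jmul ('D_a T q') by move=> V'; exact: (holo_transverse t V' C2F JF).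
rewrite (holo_laplacian Vq CT JT) DbT (JF Vq) -/l -/tau -/m in E2.
rewrite -/l -/tau -/m in E1.
have E3 := deriveNv (Jmul ('D_a ('D_a T) q)) (Ck_diff Cu (FB Vq)).
rewrite -linearN in E3.
have dm := Ck_diff (Ck_derive m Cu) (FB Vq).
have E4 := deriveNv ('D_a ('D_a F) q) dm.
have sw w : 'D_w ('D_w ('D_m u)) (F q) = 'D_m ('D_w ('D_w u)) (F q).
  apply: (etrans (open_eq_derive w oB (FB Vq) (fun y By => Ck2_schwarz m w oB By C2u))).
  exact: (Ck2_schwarz m w oB (FB Vq) (Ck_derive w Cu)).
have dl v := Ck_diff (Ck_derive v (Ck_derive v Cu)) (FB Vq).
have E5 : 'D_m (fun y => lev u y l l : R^o) (F q) =
    'D_m ('D_l ('D_l u)) (F q) + 'D_m ('D_(Jmul l) ('D_(Jmul l) u)) (F q).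
  exact: (deriveD (diff_derivable (dl l)) (diff_derivable (dl (Jmul l)))).
have aux (x y p p' q1 q2 r r' s1 s2 d : R) :
  x = (p + q1) + (r + q1 + s1) -> y = (p' + q2) + (r' + q2 + s2) ->
  p' = - p -> r' = - r -> d = s1 + s2 -> x + y = d + 2 * (q1 + q2).
  by move=> -> -> -> -> ->; ring.
apply: (aux _ _ _ _ _ _ _ _ _ _ _ E1 E2 E3 E4).
exact: (etrans E5 (f_equal2 +%R (esym (sw l)) (esym (sw (Jmul l))))).
Qed.

(** The first derivatives of H and the sum of its second derivatives express all
    the terms of the normal derivative of pshdet, up to the coordinates of
    J (d_a d_t F) on the frame; these cancel. *)
Lemma leaf_pshdet (eta : R) :
  (exists x1 x2 x3 x4 : R, Jmul tau = comb l m x1 x2 x3 x4) ->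
  'D_m (pshdet u eta l m : E -> R^o) (F q) =
  H q * ((1 - eta) * (2 * ('D_a H q ^+ 2 + 'D_b H q ^+ 2)
     - H q * ('D_a ('D_a H) q + 'D_b ('D_b H) q))
   - ('D_a H q ^+ 2 + 'D_b H q ^+ 2)).
Proof.
move=> [x1 [x2 [x3 [x4 xE]]]].
have Bq := FB Vq.
have p10 : 'D_l u (F q) = 0 by exact: leaf_du.
have p20 : 'D_(Jmul l) u (F q) = 0 by rewrite -(JF Vq); exact: leaf_du.
have r20 : 'D_(Jmul m) u (F q) = 0.
  by rewrite /m JmulK (deriveNv _ (Ck_diff Cu Bq)) (leaf_du t Vq) oppr0.
have l0 : lev u (F q) l l = 0 by exact: leaf_lev.
have E0 := derive_pshdet0 eta m oB Bq Cu (uF Vq) p10 p20 r20 l0.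
have Ha := leaf_Ha; have Hb := leaf_Hb; have HL := leaf_lapH.
have [_ Ha'] := derive_H a Vq; have [_ Hb'] := derive_H b Vq.
rewrite DbT (JF Vq) in Hb'.
have S1 := Ck2_schwarz m l oB Bq C2u.
have S2 := Ck2_schwarz m (Jmul l) oB Bq C2u.
have xJ : Jmul (Jmul tau) = comb l m (- x2) x1 (- x4) x3.
  exact: (etrans (f_equal (@Jmul R n) xE) (Jmul_comb l m x1 x2 x3 x4)).
have D1 := etrans (f_equal (fun v => 'D_v u (F q)) xE) (derive_comb C2u l m x1 x2 x3 x4 Bq).
have D2 := etrans (f_equal (fun v => 'D_v u (F q)) xJ)
  (derive_comb C2u l m (- x2) x1 (- x4) x3 Bq).
have L1 := etrans (f_equal (lev u (F q) l) xE) (lev_combr oB C2u l m x1 x2 x3 x4 Bq).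
exact: (leaf_ring_aux E0 Ha Hb HL Ha' Hb' S1 S2 D1 D2 L1 p10 p20 r20 l0).
Qed.

End AtPoint.
End Leaf.

(** * Charts of a complex manifold *)

Local Notation coord := Defs.coord.

Fact wirtbar0_aux (R : realType) (a b e f : R) :
  (a - b) / 2 = 0 -> (e + f) / 2 = 0 -> f = - e /\ b = a.
Proof. by move=> h1 h2; split; lra. Qed.

Section Charts.
Variables (R : realType) (n : nat) (X : complex_manifold R n).
Local Notation E := (cspace R n).
Implicit Types (c d : chart R n X) (A : set X).

Lemma chart_image_open c A : open A -> open (coord c @` (dom c `&` A)).
Proof.
move=> oA; rewrite openE => _ [x [cx Ax] <-]; rewrite /interior.
have Ry : (coord c @` dom c) (coord c x) by exists x.
have n1 : nbhs (coord c x) (coord c @` dom c) by apply: open_nbhs_nbhs; split => //; exact: ran_open.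
have n2 : nbhs (coord c x) (coordV c @^-1` A).
  apply: (coordV_continuous Ry); rewrite coordK //; exact: open_nbhs_nbhs.
apply: filterS2 n1 n2 => y [z cz <-]; rewrite /preimage /= coordK // => Az.
by exists z.
Qed.

Lemma chart_preimage_open c (O : set E) : open O ->
  open (dom c `&` coord c @^-1` O).
Proof.
move=> oO; rewrite openE => x [cx Ox]; rewrite /interior.
have n1 : nbhs x (dom c) by apply: open_nbhs_nbhs; split => //; exact: dom_open.
have n2 : nbhs x (coord c @^-1` O).
  by apply: (Defs.coord_continuous cx); exact: open_nbhs_nbhs.
exact: filterI n1 n2.
Qed.

Lemma wirtbar0 (V : normedModType R) (P Q : V -> R^o) (v w : V) x :
  wirtbar v w (fun y => P y +i* Q y) x = 0 ->
  'D_w P x = - 'D_v Q x /\ 'D_w Q x = 'D_v P x.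
Proof.
rewrite wirtbar_re => -[]; move: ('D_v P x) ('D_w Q x) ('D_v Q x) ('D_w P x).
move=> a b e f; exact: wirtbar0_aux.
Qed.

(** The Cauchy-Riemann equations for the components say that the derivative
    commutes with J on the coordinate directions, hence on all directions. *)
Lemma transition_holo c d : atlas c -> atlas d ->
  forall z, (coord c @` (dom c `&` dom d)) z ->
  differentiable (fun y => coord d (coordV c y)) z /\
  forall k, 'D_(Jmul k) (fun y => coord d (coordV c y)) z =
            Jmul ('D_k (fun y => coord d (coordV c y)) z).
Proof.
move=> ac ad z Uz; set f := fun y => _.
have H k := atlas_holomorphic ac ad k Uz.
have df : differentiable f z.
  apply: differentiable_rV => i; case: (split_ordP i) => k ->.
    by have [] := H k.
  by have [] := H k.
split=> // k.
have Jb j : 'D_(ydir R j) f z = Jmul ('D_(xdir R j) f z).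
  apply/rowP => i; case: (split_ordP i) => k' ->.
    have [_ _ /(_ j) /wirtbar0[h1 h2]] := H k'.
    by rewrite Jmul_l -!derive_coord //; exact: h1.
  have [_ _ /(_ j) /wirtbar0[h1 h2]] := H k'.
  by rewrite Jmul_r -!derive_coord //; exact: h2.
have Jd i : 'D_(Jmul (delta_mx 0 i : E)) f z = Jmul ('D_(delta_mx 0 i) f z).
  case: (split_ordP i) => j ->.
    by rewrite -[delta_mx 0 (lshift n j)]/(xdir R j) Jmul_xdir Jb.
  rewrite -[delta_mx 0 (rshift n j)]/(ydir R j) Jmul_ydir (deriveNv _ df).
  by rewrite Jb JmulK.
rewrite (derive_rV k df) {1}(rV_sum k) !linear_sum.
rewrite (eq_bigr (fun i => k 0 i *: Jmul (delta_mx 0 i : E))); last first.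
  by move=> i _; rewrite linearZ.
rewrite (derive_sumv _ _ df); apply: eq_bigr => i _.
by rewrite Jd linearZ.
Qed.

(** The derivative of a transition map is injective, the opposite transition map
    being differentiable too. *)
Lemma transition_deriv c d x w : atlas c -> atlas d -> dom c x -> dom d x ->
  'D_w (fun y => coord d (coordV c y)) (coord c x) = 0 -> w = 0.
Proof.
move=> ac ad cx dx; set f := fun y => _.
pose g y := coord c (coordV d y).
have Uc : (coord c @` (dom c `&` dom d)) (coord c x) by exists x.
have Ud : (coord d @` (dom d `&` dom c)) (coord d x) by exists x.
have [df _] := transition_holo ac ad Uc.
have [dg _] := transition_holo ad ac Ud.
have fx : f (coord c x) = coord d x by rewrite /f coordK.
rewrite -/g -fx in dg.
have E1 := derive_comp w df dg.
have gf y : (coord c @` (dom c `&` dom d)) y -> g (f y) = id y.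
  by move=> [x' [cx' dx'] <-]; rewrite /g /f !coordK.
rewrite (open_eq_derive w (chart_image_open (dom_open d)) Uc gf) derive_id in E1.
by move=> f0; rewrite E1 f0 derive0.
Qed.

Lemma chart_at_atlas (x : X) : atlas (chart_at x).
Proof. exact: (projT2 (cid (atlas_cover x))).1. Qed.

Lemma chart_at_dom (x : X) : dom (chart_at x) x.
Proof. exact: (projT2 (cid (atlas_cover x))).2. Qed.

(** Strict plurisubharmonicity may be tested in one chart around each point. *)
Lemma levi_chart_change c d (v : X -> R) A x : atlas c -> atlas d -> open A ->
  A x -> dom c x -> dom d x -> Ck_fun 2 A v ->
  (forall w, w != 0 -> 0 < lev (fun y => v (coordV d y) : R^o) (coord d x) w w) ->
  levi_pos (fun y => v (coordV c y)) (coord c x).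
Proof.
move=> ac ad oA Ax cx dx Cv H; set f := fun y => coord d (coordV c y).
pose U := coord c @` (dom c `&` (dom d `&` A)).
have oU : open U by apply: chart_image_open; apply: openI => //; exact: dom_open.
have Ux : U (coord c x) by exists x.
have Uc : coord c @` (dom c `&` (dom d `&` A)) `<=` coord c @` (dom c `&` A).
  by move=> _ [z [cz [dz Az]] <-]; exists z.
have Cvc : Ck_on 2 U (fun y => v (coordV c y) : R^o) := Ck_sub Uc (Cv c ac).
have oV := chart_image_open (c := d) oA.
apply/(levi_posP oU Ux Cvc) => w w0.
have fE : f (coord c x) = coord d x by rewrite /f coordK.
have Hf z : U z -> [/\ differentiable f z,
     forall k, 'D_(Jmul k) f z = Jmul ('D_k f z), (coord d @` (dom d `&` A)) (f z) &
     v (coordV c z) = v (coordV d (f z))].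
  move=> [z' [cz' [dz' Az']] zE].
  have Uz : (coord c @` (dom c `&` dom d)) z by exists z'.
  have [dfz Jfz] := transition_holo ac ad Uz.
  split=> //; first by exists z' => //; rewrite -zE /f coordK.
  by rewrite -zE /f !coordK.
rewrite (lev_transfer w oU Ux oV Cvc (Cv d ad) Hf) fE.
apply: H; apply: contraNneq w0 => fw0.
by rewrite (transition_deriv ac ad cx dx fw0).
Qed.

Lemma tderive_chart c k (delta : X -> R) A x w : atlas c -> open A -> A x ->
  dom c x -> Ck_fun k.+1 A delta ->
  tderive delta x ('D_w (fun y => coord (chart_at x) (coordV c y)) (coord c x)) =
  'D_w (fun y => delta (coordV c y) : R^o) (coord c x).
Proof.
move=> ac oA Ax cx Cd; have ad := chart_at_atlas x; have dx := chart_at_dom x.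
rewrite /tderive; move: (chart_at x) ad dx => d ad dx.
set f := fun y => coord d (coordV c y).
pose U := coord c @` (dom c `&` dom d).
have oU : open U by apply: chart_image_open; exact: dom_open.
have Ux : U (coord c x) by exists x.
have [df _] := transition_holo ac ad Ux.
have fE : f (coord c x) = coord d x by rewrite /f coordK.
have dd : differentiable (fun y => delta (coordV d y) : R^o) (f (coord c x)).
  by rewrite fE; apply: (Ck_diff (Cd d ad)); exists x.
rewrite -fE -(derive_comp w df dd).
by apply: (open_eq_derive w oU Ux) => _ [z [cz dz] <-]; rewrite /f !coordK.
Qed.

(** In the definition of h_delta the chart depends on the point. Differentiating
    h_delta needs one chart for a whole neighbourhood; the chain rule and the
    holomorphy of the transition map allow the exchange. *)
Lemma induced_metric_chart c k (delta : X -> R) A (V : set (fdom R))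
    (phi : fdom R -> X) q : atlas c -> open A -> Ck_fun k.+1 A delta ->
  (forall q, V q -> {for q, continuous phi}) ->
  V q -> A (phi q) -> dom c (phi q) ->
  differentiable (fun q => coord c (phi q)) q ->
  induced_metric delta phi q =
  `|'D_(Jmul ('D_(dir_t R) (fun q => coord c (phi q)) q))
      (fun y => delta (coordV c y) : R^o) (coord c (phi q))|.
Proof.
move=> ac oA Cd cphi Vq Aq cq dF.
rewrite /induced_metric -(tderive_chart _ ac oA Aq cq Cd).
have ad := chart_at_atlas (phi q); have dq := chart_at_dom (phi q).
set d := chart_at (phi q) in ad dq *.
set F := fun q => coord c (phi q) in dF *; set f := fun y => coord d (coordV c y).
have Uq : (coord c @` (dom c `&` dom d)) (F q) by exists (phi q).
have [df Jf] := transition_holo ac ad Uq.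
rewrite Jf -(derive_comp _ dF df); congr (`| tderive _ _ (Jmul _)|).
apply: near_eq_derive.
have n1 : \forall q' \near q, dom c (phi q').
  by apply: (cphi q Vq); apply: open_nbhs_nbhs; split => //; exact: dom_open.
by apply: filterS n1 => q' cq'; rewrite /f /F coordK.
Qed.

End Charts.

(** * Curvature coefficients of a metric |H| *)

Fact sign_of (R : realType) (x : R) : x != 0 ->
  exists2 s : R, s != 0 & forall y, 0 < x * y -> 0 < s * y /\ `|y| = s * y.
Proof.
move=> x0; have [xp|xn|xE] := ltgtP x 0; last by rewrite xE eqxx in x0.
  exists (-1); first by rewrite oppr_eq0 oner_eq0.
  move=> y; rewrite nmulr_rgt0 // mulN1r oppr_gt0 => y0.
  by rewrite ltr0_norm.
exists 1; first by rewrite oner_eq0.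
by move=> y; rewrite pmulr_rgt0 // mul1r => y0; rewrite gtr0_norm.
Qed.

Fact ln_abs_aux (R : realType) (s x d : R) : s != 0 ->
  (s *: (x : R^o))^-1 * (s *: (d : R^o)) = d * x^-1.
Proof.
by move=> s0; rewrite /GRing.scale /= invfM mulrACA mulVf // mul1r mulrC.
Qed.

Fact ln_abs_aux2 (R : realType) (a d e x z : R) : z = - x ^- 2 * d ->
  a * z + x^-1 * e = e / x - a * d / x ^+ 2.
Proof. by move=> ->; ring. Qed.

Fact half_aux (R : realType) (x y z z' : R) : z = 0 -> z' = 0 ->
  ((x - z) / 2) +i* ((z' + y) / 2) = (2^-1 * x) +i* (2^-1 * y).
Proof. by move=> -> ->; rewrite subr0 add0r ![2^-1 * _]mulrC. Qed.

Fact A_aux (R : realType) (a b x ka kb z z' : R) : x != 0 ->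
  ka = a / x -> kb = b / x -> z = 0 -> z' = 0 ->
  ((ka + z) / 2 +i* ((z' - kb) / 2)) * ((2^-1 * ka) +i* (2^-1 * kb)) =
  ((a ^+ 2 + b ^+ 2) / (4 * x ^+ 2))%:C :> R[i].
Proof.
move=> x0 -> -> -> ->; apply/eqP; rewrite eq_complex /=.
by apply/andP; split; apply/eqP; field.
Qed.

Fact Theta_aux (R : realType) (a b aa bb ab ba x t1 t2 t3 t4 : R) : x != 0 ->
  ab = ba -> t1 = 2^-1 * (aa / x - a * a / x ^+ 2) ->
  t2 = 2^-1 * (bb / x - b * b / x ^+ 2) ->
  t3 = 2^-1 * (ba / x - b * a / x ^+ 2) ->
  t4 = 2^-1 * (ab / x - a * b / x ^+ 2) ->
  - (((t1 + t2) / 2) +i* ((t3 - t4) / 2)) =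
  ((a ^+ 2 + b ^+ 2 - x * (aa + bb)) / (4 * x ^+ 2))%:C :> R[i].
Proof.
move=> x0 <- -> -> -> ->; apply/eqP; rewrite eq_complex /=.
by apply/andP; split; apply/eqP; field.
Qed.

Section LogMetric.
Variable R : realType.
Variable Q : normedModType R.
Variables (V : set Q) (H : Q -> R^o) (h : Q -> R) (q : Q).
Hypotheses (oV : open V) (Vq : V q) (Hq : H q != 0).
Hypotheses (hH : forall q', V q' -> h q' = `|H q'|).
Hypothesis dH : forall q', V q' -> differentiable H q'.

Let near_nz : \forall q' \near q, V q' /\ 0 < H q * H q'.
Proof.
have cH : {for q, continuous (fun q' => H q * H q')}.
  exact: (differentiable_continuous (differentiableZ (H q) (dH Vq))).
have n1 : \forall q' \near q, 0 < H q * H q'.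
  apply: (cvgr_gt _ cH); by rewrite -expr2 exprn_even_gt0.
have n2 := open_near oV Vq.
by near=> q'; split; [exact: (near n2 q')|exact: (near n1 q')].
Unshelve. all: by end_near. Qed.

(** Near q the sign s of H is constant, and log h = log (s H). *)
Lemma derive_ln_abs : exists2 r : R, 0 < r & forall q', `|q' - q| < r ->
  [/\ V q', H q' != 0 &
   forall v, 'D_v (fun q' => ln (h q') : R^o) q' = 'D_v H q' * (H q')^-1].
Proof.
have [r r0 Hr] := near_normball near_nz.
exists r => // q' q'r; have [Vq' pos] := Hr q' q'r.
have Hq' : H q' != 0 by apply: contraTneq pos => ->; rewrite mulr0 ltxx.
split=> // v.
have [s s0 sE] := sign_of Hq.
have sH q1 : `|q1 - q| < r -> 0 < s * H q1 /\ h q1 = s * H q1.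
  move=> /Hr[V1 p1]; have [h1 h2] := sE _ p1.
  by split=> //; exact: (etrans (hH V1) h2).
have oB : open (ball q r) by exact: ball_open.
have Bq' : ball q r q' by rewrite -ball_normE /= distrC.
have lnE q1 : ball q r q1 -> ln (h q1) = ln (s * H q1).
  by rewrite -ball_normE /= distrC => /sH[_ ->].
rewrite (open_eq_derive v oB Bq' lnE).
have ds : differentiable (fun q1 => s *: H q1 : R^o) q'.
  by apply: differentiableZ; exact: dH.
have [p' _] := sH q' q'r.
have [_ ->] := derive_comp1 v ds (is_derive1_ln p').
rewrite deriveZ; last exact/diff_derivable/dH.
exact: ln_abs_aux.
Qed.

Hypothesis d2H : forall v, differentiable ('D_v H) q.

Lemma derive2_ln_abs v w :
  derivable (fun q' => 'D_v (fun q' => ln (h q') : R^o) q' : R^o) q w /\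
  'D_w ('D_v (fun q' => ln (h q') : R^o)) q =
  'D_w ('D_v H) q / H q - 'D_v H q * 'D_w H q / H q ^+ 2.
Proof.
have [r r0 Hr] := derive_ln_abs.
have oB : open (ball q r) by exact: ball_open.
have Bq : ball q r q by exact: ballxx.
have E q' : ball q r q' -> 'D_v H q' * (H q')^-1 = 'D_v (fun q' => ln (h q') : R^o) q'.
  by rewrite -ball_normE /= distrC => /Hr[_ _ ->].
have d1 := @diff_derivable _ _ _ _ _ w (d2H v).
have d2 := @diff_derivable _ _ _ _ _ w (dH Vq).
have d3 := derivableV Hq d2.
have dM := derivableM d1 d3.
split.
  apply: (near_eq_derivable _ dM); near=> q'; apply: E; near: q'.
  exact: (open_near oB Bq).
rewrite -(open_eq_derive w oB Bq E).
exact: (etrans (deriveM d1 d3) (ln_abs_aux2 _ _ (deriveV Hq d2))).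
Unshelve. all: by end_near. Qed.

End LogMetric.

Section MetricForms.
Variable R : realType.
Local Notation Q := (fdom R).
Variables (V : set Q) (H : Q -> R^o) (h : Q -> R) (q : Q).
Hypotheses (oV : open V) (Vq : V q) (Hq : H q != 0).
Hypotheses (hH : forall q', V q' -> h q' = `|H q'|).
Hypothesis dH : forall q', V q' -> differentiable H q'.
Hypothesis d2H : forall v, differentiable ('D_v H) q.
Hypothesis symH : 'D_(dir_b R) ('D_(dir_a R) H) q = 'D_(dir_a R) ('D_(dir_b R) H) q.

Let k : Q -> R^o := fun q' => ln (h q').

Let wirtbar_k q' : wirtbar (dir_a R) (dir_b R) (fun q' => (ln (h q'))%:C) q' =
  (2^-1 *: 'D_(dir_a R) k q' : R^o) +i* (2^-1 *: 'D_(dir_b R) k q' : R^o).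
Proof.
apply: (etrans (@wirtbar_re _ _ k (cst 0) (dir_a R) (dir_b R) q')).
exact: (half_aux _ _ (derive_cst _ _ _) (derive_cst _ _ _)).
Qed.

Let derive_k v : 'D_v k q = 'D_v H q / H q.
Proof.
have [r r0 Hr] := derive_ln_abs oV Vq Hq hH dH.
by have [|_ _ ->] := Hr q; rewrite ?subrr ?normr0.
Qed.

Lemma A_coefE : A_coef h q =
  ((('D_(dir_a R) H q ^+ 2 + 'D_(dir_b R) H q ^+ 2) / (4 * H q ^+ 2)) : R)%:C.
Proof.
rewrite /A_coef wirtbar_k.
have E1 := @wirt_re _ _ k (cst 0) (dir_a R) (dir_b R) q.
apply: (etrans (f_equal ( *%R^~ _) E1)).
exact: (A_aux Hq (derive_k _) (derive_k _) (derive_cst _ _ _) (derive_cst _ _ _)).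
Qed.

Lemma Theta_coefE : Theta_coef h q =
  ((('D_(dir_a R) H q ^+ 2 + 'D_(dir_b R) H q ^+ 2 - H q *
    ('D_(dir_a R) ('D_(dir_a R) H) q + 'D_(dir_b R) ('D_(dir_b R) H) q))
    / (4 * H q ^+ 2)) : R)%:C.
Proof.
rewrite /Theta_coef.
have -> : wirtbar (dir_a R) (dir_b R) (fun q' => (ln (h q'))%:C) =
    (fun q' => (2^-1 *: 'D_(dir_a R) k q' : R^o) +i* (2^-1 *: 'D_(dir_b R) k q' : R^o)).
  by apply/funext => q'; exact: wirtbar_k.
rewrite wirt_re.
have dZ v w : 'D_w (fun q' => 2^-1 *: 'D_v k q' : R^o) q =
    2^-1 * ('D_w ('D_v H) q / H q - 'D_v H q * 'D_w H q / H q ^+ 2).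
  have [d1 D1] := derive2_ln_abs oV Vq Hq hH dH d2H v w.
  exact: (etrans (deriveZ 2^-1 d1) (f_equal ( *%R 2^-1) D1)).
exact: (Theta_aux Hq symH (dZ _ _) (dZ _ _) (dZ _ _) (dZ _ _)).
Qed.

End MetricForms.

(** * Frames of C^2 *)

Section Frames.
Variable R : realType.
Local Notation E := (cspace R 2).

Lemma comb_span (e1 e2 : E) : free2 e1 e2 ->
  forall w, exists x1 x2 x3 x4, w = comb e1 e2 x1 x2 x3 x4.
Proof.
move=> fr w.
pose M : 'M[R]_(4, 2 + 2) := \matrix_i tnth [tuple e1; Jmul e1; e2; Jmul e2] i.
have vM (v : 'rV[R]_4) : v *m M = comb e1 e2 (v 0 0) (v 0 1) (v 0 2) (v 0 3).
  rewrite mulmx_sum_row !big_ord_recl big_ord0 addr0 !rowK.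
  rewrite !(tnth_nth 0) /comb /=.
  by congr (_ *: _ + (_ *: _ + (_ *: _ + _ *: _))); congr (v _ _); apply: val_inj.
have fM : row_free M.
  apply: inj_row_free => v; rewrite vM => /fr[v0 v1 v2 v3].
  by apply/rowP; case=> -[|[|[|[|//]]]] i; rewrite mxE; [rewrite -v0|rewrite -v1|
    rewrite -v2|rewrite -v3]; congr (v _ _); apply: val_inj.
have uM : (M : 'M[R]_4) \in unitmx by rewrite -row_free_unit.
pose v : 'rV[R]_4 := w *m invmx (M : 'M[R]_4).
exists (v 0 0); exists (v 0 1); exists (v 0 2); exists (v 0 3).
by rewrite -vM /v (mulmxKV uM).
Qed.

(** A complex relation between l and J T, multiplied by the conjugate of the
    coefficient of J T, becomes a real relation between l, J l and T. *)
Lemma free2_normal (l T : E) :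
  (forall c1 c2 c3, c1 *: l + c2 *: Jmul l + c3 *: T = 0 ->
     [/\ c1 = 0, c2 = 0 & c3 = 0]) ->
  free2 l (Jmul T).
Proof.
move=> fr x1 x2 x3 x4 w0.
have Jw0 : comb l (Jmul T) (- x2) x1 (- x4) x3 = 0.
  by rewrite -Jmul_comb w0 linear0.
have E0 : (x4 * x1 - x3 * x2) *: l + (x4 * x2 + x3 * x1) *: Jmul l +
    (- (x3 ^+ 2 + x4 ^+ 2)) *: T =
    x4 *: comb l (Jmul T) x1 x2 x3 x4 + x3 *: comb l (Jmul T) (- x2) x1 (- x4) x3.
  apply/rowP => i; rewrite /comb JmulK !mxE; ring.
have [_ _ r0] : [/\ x4 * x1 - x3 * x2 = 0, x4 * x2 + x3 * x1 = 0 &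
    - (x3 ^+ 2 + x4 ^+ 2) = 0].
  by apply: fr; rewrite E0 w0 Jw0 !scaler0 addr0.
have /andP[/eqP x30 /eqP x40] : (x3 == 0) && (x4 == 0).
  by move/eqP: r0; rewrite oppr_eq0 paddr_eq0 ?sqr_ge0 // !sqrf_eq0.
have [] := fr x1 x2 0; last by [].
by rewrite -[RHS]w0 /comb x30 x40 !scale0r !addr0.
Qed.

Fact bord_aux (p1 p2 r1 r2 l11 l22 lb lc x1 x2 x3 x4 : R) :
  r1 ^+ 2 + r2 ^+ 2 != 0 -> (x1 != 0) || (x2 != 0) ->
  x1 * p1 + (x2 * p2 + (x3 * r1 + x4 * r2)) = 0 ->
  - x2 * p1 + (x1 * p2 + (- x4 * r1 + x3 * r2)) = 0 ->
  l11 * (x1 ^+ 2 + x2 ^+ 2) + l22 * (x3 ^+ 2 + x4 ^+ 2)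
       + 2 * (lb * (x1 * x3 + x2 * x4) + lc * (x1 * x4 - x2 * x3)) = 0 ->
  l11 * (r1 ^+ 2 + r2 ^+ 2) + l22 * (p1 ^+ 2 + p2 ^+ 2)
  - 2 * (lb * (p1 * r1 + p2 * r2) + lc * (p1 * r2 - p2 * r1)) = 0.
Proof.
move=> rn x0 e1 e2.
have E3 : x3 = - (r1 * (x1 * p1 + x2 * p2) + r2 * (x1 * p2 - x2 * p1)) / (r1 ^+ 2 + r2 ^+ 2).
  apply/eqP; rewrite eq_sym -subr_eq0; apply/eqP.
  transitivity (- (r1 * (x1 * p1 + (x2 * p2 + (x3 * r1 + x4 * r2))) +
     r2 * (- x2 * p1 + (x1 * p2 + (- x4 * r1 + x3 * r2)))) / (r1 ^+ 2 + r2 ^+ 2)).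
    by field.
  by rewrite e1 e2 !mulr0 addr0 oppr0 mul0r.
have E4 : x4 = - (r2 * (x1 * p1 + x2 * p2) - r1 * (x1 * p2 - x2 * p1)) / (r1 ^+ 2 + r2 ^+ 2).
  apply/eqP; rewrite eq_sym -subr_eq0; apply/eqP.
  transitivity (- (r2 * (x1 * p1 + (x2 * p2 + (x3 * r1 + x4 * r2))) -
     r1 * (- x2 * p1 + (x1 * p2 + (- x4 * r1 + x3 * r2)))) / (r1 ^+ 2 + r2 ^+ 2)).
    by field.
  by rewrite e1 e2 !mulr0 subr0 oppr0 mul0r.
have xn : x1 ^+ 2 + x2 ^+ 2 != 0.
  by rewrite paddr_eq0 ?sqr_ge0 // !sqrf_eq0 negb_and.
rewrite {}E3 {}E4 => e; apply: (mulfI xn); rewrite mulr0.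
rewrite -[RHS](mulr0 (r1 ^+ 2 + r2 ^+ 2)) -{}[in RHS]e.
by field.
Qed.

(** The vector l spans the complex line on which the complex differential of u
    vanishes, and levbord is a positive multiple of the Levi form on that line. *)
Lemma levbord0 (u : E -> R^o) (U : set E) (e1 e2 l : E) y : open U -> U y ->
  Ck_on 2 U u -> (forall w, exists x1 x2 x3 x4, w = comb e1 e2 x1 x2 x3 x4) ->
  'D_e2 u y != 0 -> l != 0 -> 'D_l u y = 0 -> 'D_(Jmul l) u y = 0 ->
  lev u y l l = 0 -> levbord u e1 e2 y = 0.
Proof.
move=> oU Uy Cu sp r0 l0 d1 d2 d3.
have [x1 [x2 [x3 [x4 lE]]]] := sp l.
rewrite lE in d1 d3; rewrite lE Jmul_comb in d2.
have D1 := etrans (esym (derive_comb Cu e1 e2 x1 x2 x3 x4 Uy)) d1.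
have D2 := etrans (esym (derive_comb Cu e1 e2 (- x2) x1 (- x4) x3 Uy)) d2.
have D3 := etrans (esym (lev_comb oU Cu e1 e2 x1 x2 x3 x4 Uy)) d3.
have rn : ('D_e2 u y : R) ^+ 2 + ('D_(Jmul e2) u y : R) ^+ 2 != 0.
  by rewrite paddr_eq0 ?sqr_ge0 // !sqrf_eq0 negb_and r0.
apply: (bord_aux rn _ D1 D2 D3).
apply: contraNT l0; rewrite negb_or !negbK => /andP[/eqP x10 /eqP x20].
have aux (r1 r2 p1 p2 : R) : r1 ^+ 2 + r2 ^+ 2 != 0 ->
    x1 * p1 + (x2 * p2 + (x3 * r1 + x4 * r2)) = 0 ->
    - x2 * p1 + (x1 * p2 + (- x4 * r1 + x3 * r2)) = 0 -> x3 = 0 /\ x4 = 0.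
  rewrite x10 x20 oppr0 !mul0r !add0r => rn' e e'.
  split; apply: (mulfI rn'); rewrite mulr0.
    transitivity (r1 * (x3 * r1 + x4 * r2) + r2 * (- x4 * r1 + x3 * r2)); first by ring.
    by rewrite e e' !mulr0 addr0.
  transitivity (r2 * (x3 * r1 + x4 * r2) - r1 * (- x4 * r1 + x3 * r2)); first by ring.
  by rewrite e e' !mulr0 subr0.
have [x30 x40] := aux _ _ _ _ rn D1 D2.
by rewrite lE x10 x20 x30 x40 /comb !scale0r !addr0.
Qed.

End Frames.

(** * The local problem at a boundary point *)

Section LocalModel.
Variable R : realType.
Local Notation E := (cspace R 2).

Lemma Ck_pshdiag (U : set E) (u : E -> R^o) (eta : R) (e : E) : open U ->
  Ck_on 3 U u -> Ck_on 1 U (pshdiag u eta e : E -> R^o).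
Proof.
move=> oU Cu.
have Cl : Ck_on 1 U (fun y => lev u y e e : R^o) := Ck_lev e e oU Cu.
have C1 : Ck_on 1 U ('D_e u) := CkW (Ck_derive e Cu).
have C2 : Ck_on 1 U ('D_(Jmul e) u) := CkW (Ck_derive (Jmul e) Cu).
exact: (CkD oU (CkZ (1 - eta) oU (CkD oU (CkM oU C1 C1) (CkM oU C2 C2)))
  (CkN oU (CkM oU (CkW (CkW Cu)) Cl))).
Qed.

Variable Q : normedModType R.
(* Om is the domain and u the boundary distance function in a chart; F is a
   parametrization of the boundary near F q by the foliated chart, and O is a
   neighbourhood of F q in which the boundary of Om is the image of F *)
Variables (a b t : Q) (V : set Q) (F : Q -> E) (B Om O : set E) (u : E -> R^o).
Variable q : Q.
Hypotheses (oV : open V) (Vq : V q) (oB : open B).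
Hypotheses (CF : Ck_on 3 V F) (Cu : Ck_on 3 B u).
Hypotheses (FB : forall q, V q -> B (F q)) (uF : forall q, V q -> u (F q) = 0).
Hypothesis JF : forall q, V q -> 'D_b F q = Jmul ('D_a F q).
Hypothesis frF : forall q, V q -> forall c1 c2 c3 : R,
  c1 *: 'D_a F q + c2 *: 'D_b F q + c3 *: 'D_t F q = 0 ->
  [/\ c1 = 0, c2 = 0 & c3 = 0].
Hypotheses (oO : open O) (Oy : O (F q)) (OB : O `<=` B) (oOm : open (Om `&` O)).
Hypothesis upos : forall y, O y -> Om y -> 0 < u y.
Hypothesis bdO : forall y, O y -> closure Om y -> ~ Om y ->
  exists2 q', V q' & F q' = y.
Hypothesis clOm : closure Om (F q).
Hypothesis du0 : exists w, 'D_w u (F q) <> 0.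

Let l := 'D_a F q.
Let m := Jmul ('D_t F q).
Let H := normal_der t F u.
Let Ha := 'D_a H q.
Let Hb := 'D_b H q.
Let L := 'D_a ('D_a H) q + 'D_b ('D_b H) q.

Lemma leaf_frame : free2 l m.
Proof. by apply: free2_normal; rewrite /l -(JF Vq); exact: frF. Qed.

Let du_l : 'D_l u (F q) = 0.
Proof. exact: (leaf_du oV CF Cu FB uF a Vq). Qed.
Let du_Jl : 'D_(Jmul l) u (F q) = 0.
Proof. rewrite /l -(JF Vq); exact: (leaf_du oV CF Cu FB uF b Vq). Qed.
Let du_Jm : 'D_(Jmul m) u (F q) = 0.
Proof.
rewrite /m JmulK (deriveNv _ (Ck_diff Cu (FB Vq))).
by rewrite (leaf_du oV CF Cu FB uF t Vq) oppr0.
Qed.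

Lemma normal_der_neq0 : H q != 0.
Proof.
apply/eqP => H0; have [w []] := du0.
have [x1 [x2 [x3 [x4 ->]]]] := comb_span leaf_frame w.
have aux (x p1 p2 r1 r2 : R) : x = x1 * p1 + (x2 * p2 + (x3 * r1 + x4 * r2)) ->
  p1 = 0 -> p2 = 0 -> r1 = 0 -> r2 = 0 -> x = 0.
  by move=> -> -> -> -> ->; rewrite !mulr0 !addr0.
exact: (aux _ _ _ _ _ (derive_comb (CkW Cu) l m x1 x2 x3 x4 (FB Vq)) du_l du_Jl H0 du_Jm).
Qed.

Let H0 : H q != 0 := normal_der_neq0.
Let By : B (F q) := FB Vq.

(** At each boundary point near F q the Levi form vanishes on the tangent of the
    leaf through that point, so the bordered determinant vanishes, even though the
    frame l, m is that of the point F q. *)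
Lemma pshdet_boundary (eta : R) : exists2 D, open D & D (F q) /\ D `<=` O /\
  forall y, D y -> closure Om y -> ~ Om y -> pshdet u eta l m y = 0.
Proof.
have cm : {for F q, continuous ('D_m u)} := Ck_cont (CkW (CkW (Ck_derive m Cu))) By.
have nz : \forall y \near F q, 'D_m u y != 0 by exact: (cvgr_neq0 _ cm H0).
have nn : \forall y \near F q, O y /\ 'D_m u y != 0.
  by apply: filterS2 (open_near oO Oy) nz.
have [r r0 Hr] := near_normball nn.
exists (ball (F q) r); first exact: ball_open.
split; first exact: ballxx.
split=> [y|y]; rewrite -ball_normE /= distrC => /Hr[Dx my] // cy ny.
have [q' Vq' qE] := bdO Dx cy ny.
rewrite /pshdet -qE (uF Vq') mul0r.
have -> : levbord u l m (F q') = 0; last by rewrite mulr0 subrr.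
have l0 : 'D_a F q' != 0.
  apply/eqP => Fa; have [] := @frF q' Vq' 1 0 0; last by move=> /eqP; rewrite oner_eq0.
  by rewrite Fa !scale0r scaler0 !addr0.
apply: (levbord0 oB (FB Vq') (CkW Cu) (comb_span leaf_frame) _ l0).
- by rewrite qE.
- exact: (leaf_du oV CF Cu FB uF a Vq').
- rewrite -(JF Vq'); exact: (leaf_du oV CF Cu FB uF b Vq').
- exact: (leaf_lev oV oB CF Cu FB uF JF Vq').
Qed.

(** The vector H m points into the domain whatever the sign of H is, since
    du (H m) = H^2. *)
Lemma pshdet_normal (eta : R) : 'D_(H q *: m) (pshdet u eta l m : E -> R^o) (F q) =
  H q ^+ 2 * ((1 - eta) * (2 * (Ha ^+ 2 + Hb ^+ 2) - H q * L) - (Ha ^+ 2 + Hb ^+ 2)).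
Proof.
have dp := Ck_diff (Ck_pshdet eta l m oB Cu) By.
apply: (etrans (deriveZv (H q) m dp)).
have sp := comb_span leaf_frame (Jmul ('D_a ('D_t F) q)).
have E1 := leaf_pshdet oV oB CF Cu FB uF JF Vq eta sp.
apply: (etrans (f_equal ( *%R (H q)) E1)).
exact: (etrans (mulrA _ _ _) (f_equal ( *%R^~ _) (esym (expr2 (H q))))).
Qed.

Let du_nu : 0 < 'D_(H q *: m) u (F q).
Proof.
rewrite (deriveZv _ _ (Ck_diff Cu By)).
have aux (x : R) : x != 0 -> 0 < x * x by move=> x0; rewrite -expr2 exprn_even_gt0.
exact: (aux _ H0).
Qed.

Let sqH : 0 < H q ^+ 2.
Proof. by rewrite exprn_even_gt0. Qed.

(** The inequality says that pshdet has positive inward derivative at F q. *)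
Lemma local_sufficient (eta : R) : 0 < eta -> eta < 1 ->
  Ha ^+ 2 + Hb ^+ 2 < (1 - eta) * (2 * (Ha ^+ 2 + Hb ^+ 2) - H q * L) ->
  \forall y \near F q, Om y ->
    forall w, w != 0 -> 0 < lev (fun z => - (u z `^ eta) : R^o) y w w.
Proof.
move=> e0 e1 HL.
have [D oD [Dx [DO p0]]] := pshdet_boundary eta.
have DB : D `<=` B by move=> y /DO /OB.
have dp : 0 < 'D_(H q *: m) (pshdet u eta l m : E -> R^o) (F q).
  by rewrite pshdet_normal mulr_gt0 // subr_gt0.
have oOmD : open (Om `&` D).
  have -> : Om `&` D = (Om `&` O) `&` D.
    by apply/seteqP; split=> y; [move=> [? ?]; split=> //; split=> //; exact: DO|move=> [[? ?] ?]].
  exact: openI.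
have n1 := barrier oD Dx oOmD (fun y Dy Oy => upos (DO y Dy) Oy) p0
  (Ck_sub DB (CkW (CkW Cu))) (Ck_sub DB (Ck_pshdet eta l m oB Cu)) (uF Vq)
  du_nu dp.
have p22 : 0 < pshdiag u eta m (F q).
  have E0 : pshdiag u eta m (F q) = (1 - eta) * H q ^+ 2.
    rewrite /pshdiag (uF Vq) mul0r subr0.
    have aux (x y : R) : y = 0 -> (1 - eta) * (x ^+ 2 + y ^+ 2) = (1 - eta) * x ^+ 2.
      by move=> ->; rewrite expr0n addr0.
    exact: (aux _ _ du_Jm).
  by rewrite E0 mulr_gt0 // subr_gt0.
have c22 : {for F q, continuous (pshdiag u eta m : E -> R^o)}.
  exact: (Ck_cont (CkW (Ck_pshdiag eta m oB Cu)) By).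
have n2 : \forall y \near F q, 0 < pshdiag u eta m y by exact: (cvgr_gt _ c22 _ p22).
have n3 := open_near oO Oy.
near=> y; move=> Omy w w0.
have Oy1 : O y by near: y.
have [p1 p2] : 0 < pshdet u eta l m y /\ 0 < pshdiag u eta m y.
  by split; [move: Omy; near: y|near: y].
have C2 : Ck_on 2 (Om `&` O) u by apply: Ck_sub (CkW Cu) => z [_ /OB].
have u1 z : (Om `&` O) z -> 0 < u z by move=> [Oz1 Oz2]; exact: upos.
exact: (pshdet_sufficient oOm (conj Omy Oy1) C2 u1 e0 (comb_span leaf_frame) p2 p1 w0).
Unshelve. all: by end_near. Qed.

(** If the inequality failed, - pshdet would have positive inward derivative, and
    pshdet would be negative in the domain near F q. *)
Lemma local_necessary (eta : R) : 0 < eta ->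
  (\forall y \near F q, Om y ->
    forall w, w != 0 -> 0 < lev (fun z => - (u z `^ eta) : R^o) y w w) ->
  Ha ^+ 2 + Hb ^+ 2 <= (1 - eta) * (2 * (Ha ^+ 2 + Hb ^+ 2) - H q * L).
Proof.
move=> e0 HP; rewrite leNgt; apply/negP => HL.
have [D oD [Dx [DO p0]]] := pshdet_boundary eta.
have DB : D `<=` B by move=> y /DO /OB.
have Cpsi := Ck_pshdet eta l m oB Cu.
have dp : 0 < 'D_(H q *: m) (fun y => - pshdet u eta l m y : R^o) (F q).
  have dN := deriveN (@diff_derivable _ _ _ _ _ (H q *: m) (Ck_diff Cpsi By)).
  have aux (x y z : R) : x = - y -> y = H q ^+ 2 * z -> z < 0 -> 0 < x.
    by move=> -> -> z0; rewrite oppr_gt0 pmulr_rlt0.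
  by apply: (aux _ _ _ dN (pshdet_normal eta)); rewrite subr_lt0.
have oOmD : open (Om `&` D).
  have -> : Om `&` D = (Om `&` O) `&` D.
    by apply/seteqP; split=> y; [move=> [? ?]; split=> //; split=> //; exact: DO|move=> [[? ?] ?]].
  exact: openI.
have p0N y : D y -> closure Om y -> ~ Om y -> - pshdet u eta l m y = 0.
  by move=> h1 h2 h3; rewrite p0 // oppr0.
have n1 := barrier oD Dx oOmD (fun y Dy Oy => upos (DO y Dy) Oy) p0N
  (Ck_sub DB (CkW (CkW Cu))) (Ck_sub DB (CkN oB Cpsi)) (uF Vq) du_nu dp.
have [|y [Omy [h1 [h2 h3]]]] := clOm (_ : nbhs (F q) [set y | (Om y -> 0 < - pshdet u eta l m y) /\
   ((Om y -> forall w, w != 0 -> 0 < lev (fun z => - (u z `^ eta) : R^o) y w w) /\ O y)]).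
  exact: (filterI n1 (filterI HP (open_near oO Oy))).
have C2 : Ck_on 2 (Om `&` O) u by apply: Ck_sub (CkW Cu) => z [_ /OB].
have u1 z : (Om `&` O) z -> 0 < u z by move=> [Oz1 Oz2]; exact: upos.
have p1 := pshdet_necessary oOm (conj Omy h3) C2 u1 e0 leaf_frame (h2 Omy).
by have := h1 Omy; rewrite oppr_gt0 ltNge (ltW p1).
Qed.

End LocalModel.

(** * The local exponent as a supremum; domains in charts *)

Section Supremum.
Variable R : realType.

(** S lies between the solutions e in (0, 1) of the strict and of the weak
    inequality N < (1 - e) Z, N <= (1 - e) Z, and these sets have the same supremum
    1 - N / Z. One solution of the weak inequality forces Z > N. *)
Lemma sup_threshold (S : set R) (N Z : R) : 0 <= N -> ~ (Z - N = 0 /\ N = 0) ->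
  (forall e, S e -> [/\ 0 < e, e < 1 & N <= (1 - e) * Z]) ->
  (forall e, 0 < e -> e < 1 -> N < (1 - e) * Z -> S e) ->
  (exists e, [/\ 0 < e, e < 1 & N <= (1 - e) * Z]) ->
  0 < Z - N /\ sup S = (Z - N) / Z.
Proof.
move=> N0 nz SN NS [e0 [e00 e01 e0N]].
have Z0 : 0 < Z.
  have Z1 : 0 <= (1 - e0) * Z by exact: le_trans e0N.
  have : 0 <= Z by rewrite -(pmulr_rge0 _ (_ : 0 < 1 - e0)) // subr_gt0.
  rewrite le_eqVlt => /orP[/eqP Z00|//]; exfalso; apply: nz.
  have N00 : N = 0 by apply/eqP; rewrite eq_le N0 andbT; move: e0N; rewrite -Z00 mulr0.
  by rewrite N00 -Z00 subr0.
have T0 : 0 < Z - N by nra.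
split=> //.
set s := _ / Z; have s0 : 0 < s by rewrite divr_gt0.
have s1 : s <= 1 by rewrite ler_pdivrMr // mul1r; lra.
have lts e : e < s -> N < (1 - e) * Z.
  by rewrite /s ltr_pdivlMr // => ?; lra.
have S0 : S !=set0 by exists (s / 2); apply: NS; [lra|lra|apply: lts; lra].
have ub e : S e -> e <= s.
  by move=> /SN[_ _ ?]; rewrite /s ler_pdivlMr //; lra.
have hS : has_sup S by split=> //; exists s.
apply/eqP; rewrite eq_le; apply/andP; split; first by apply: ge_sup.
rewrite leNgt; apply/negP => lt.
pose e := (Num.max (sup S) 0 + s) / 2.
have M1 : Num.max (sup S) 0 < s by rewrite gt_max lt.
have M2 : 0 <= Num.max (sup S) 0 by rewrite le_max lexx orbT.
have M3 : sup S <= Num.max (sup S) 0 by rewrite le_max lexx.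
have Se : S e by apply: NS; rewrite /e; [lra|lra|apply: lts; lra].
have := sup_upper_bound hS Se; rewrite /e; lra.
Qed.

End Supremum.

Section Domains.
Variables (R : realType) (n : nat) (X : complex_manifold R n).
Implicit Types (c d : chart R n X) (A D : set X).

Lemma chart_image_mem c A x : dom c x -> (coord c @` (dom c `&` A)) (coord c x) <-> A x.
Proof.
move=> cx; split=> [[z [cz Az] E]|Ax]; last by exists x.
by rewrite -(coordK cx) -E coordK.
Qed.

Lemma closure_chart c D x : dom c x ->
  closure (coord c @` (dom c `&` D)) (coord c x) <-> closure D x.
Proof.
move=> cx; split=> cl N nN.
  have Ry : (coord c @` dom c) (coord c x) by exists x.
  have : nbhs (coord c x) (coordV c @^-1` N).
    by apply: (coordV_continuous Ry); rewrite coordK.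
  by move=> /cl[_ [[z [cz Dz] <-]]]; rewrite /preimage /= coordK // => Nz; exists z.
have n1 : nbhs x (coord c @^-1` N) by exact: (Defs.coord_continuous cx).
have n2 : nbhs x (dom c) by exact: open_nbhs_nbhs (conj (dom_open c) cx).
have [z [Dz [Nz cz]]] := cl _ (filterI n1 n2).
by exists (coord c z); split=> //; exists z.
Qed.

Lemma bdry_open D : open D -> bdry D = closure D `\` D.
Proof. by move=> /interior_id; rewrite /bdry => ->. Qed.

(** A positive value of delta at p would put p in D, and a negative one would,
    by continuity, make delta negative at points of D. *)
Lemma boundary_distance_eq0 k D (delta : X -> R) p : open D ->
  boundary_distance k.+1 D delta -> bdry D p -> delta p = 0.
Proof.
move=> oD [[W [oW clW Cd]] DE _]; rewrite (bdry_open oD) => -[clp nDp].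
apply/eqP; rewrite eq_le; apply/andP; split.
  by rewrite leNgt; apply/negP => dp; apply: nDp; rewrite DE.
pose c := chart_at p; have cp := chart_at_dom p.
have Wp := clW _ clp.
have Bp : (coord c @` (dom c `&` W)) (coord c p) by apply/chart_image_mem.
have cu := differentiable_continuous (Ck_diff (Cd c (chart_at_atlas p)) Bp).
rewrite leNgt; apply/negP => dp.
have dp' : delta (coordV c (coord c p)) < 0 by rewrite coordK.
have n1 : \forall y \near coord c p, delta (coordV c y) < 0 by exact: (cvgr_lt _ cu _ dp').
have [y [[z [cz Dz] <-]]] := (closure_chart D cp).2 clp _ n1.
rewrite /= coordK // => dz.
by move: Dz; rewrite DE => -[_]; rewrite ltNge (ltW dz).
Qed.

Lemma spsh_near c D (v : X -> R) (U : set X) p : atlas c -> dom c p ->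
  open D -> open U -> U p -> spsh_on (U `&` D) v ->
  \forall y \near coord c p, (coord c @` (dom c `&` D)) y ->
    forall w, w != 0 -> 0 < lev (fun z => v (coordV c z) : R^o) y w w.
Proof.
move=> ac cp oD oU Up [Cv Lv].
have n1 : nbhs (coord c p) (coord c @` (dom c `&` U)).
  by apply: (open_near (chart_image_open oU)); apply/chart_image_mem.
apply: filterS n1 => _ [x [cx Ux] <-] /(chart_image_mem _ cx) Dx.
have UD : (U `&` D) x by [].
have mem : (coord c @` (dom c `&` (U `&` D))) (coord c x) by apply/chart_image_mem.
exact: (levi_posP (chart_image_open (openI oU oD)) mem (Cv c ac)).1 (Lv c x ac cx UD).
Qed.

Lemma near_spsh c D (delta : X -> R) (W : set X) eta p : atlas c -> dom c p ->
  open D -> D `<=` W -> Ck_fun 3 W delta -> (forall x, D x -> 0 < delta x) ->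
  (\forall y \near coord c p, (coord c @` (dom c `&` D)) y ->
    forall w, w != 0 -> 0 < lev (fun z => - (delta (coordV c z) `^ eta) : R^o) y w w) ->
  exists U : set X, [/\ open U, U p & spsh_on (U `&` D) (fun x => - (delta x `^ eta))].
Proof.
move=> ac cp oD DW Cd dpos /near_normball[r r0 Hr].
exists (dom c `&` coord c @^-1` ball (coord c p) r); split.
- by apply: chart_preimage_open; exact: ball_open.
- by split=> //; exact: ballxx.
set U := _ `&` _ `&` D.
have oU : open U.
  by apply: openI => //; apply: chart_preimage_open; exact: ball_open.
have CU : Ck_fun 2 U (fun x => - (delta x `^ eta)).
  move=> d ad; have oI := chart_image_open (c := d) oU.
  apply: (CkN oI); apply: (Ck_powR _ oI).
    by move=> _ [z [dz [_ Dz]] <-]; rewrite coordK //; exact: dpos.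
  apply: (Ck_sub _ (CkW (Cd d ad))) => _ [z [dz [_ Dz]] <-].
  by exists z => //; split=> //; exact: DW.
split=> // d x ad dx Ux.
have [[cx bx] Dx] := Ux.
apply: (levi_chart_change ad ac oU Ux dx cx CU) => w w0.
apply: Hr => //; last by apply/chart_image_mem.
by move: bx; rewrite /preimage /= -ball_normE /= distrC.
Qed.

End Domains.

(** * Foliated charts in a fixed holomorphic chart *)

Section FoliatedFrame.
Variables (R : realType) (X : complex_manifold R 2).
Variables (M : set X) (V : set (fdom R)) (phi : fdom R -> X).
Hypothesis fol : foliated_chart M V phi.
Local Notation da := (dir_a R).
Local Notation db := (dir_b R).
Local Notation dt := (dir_t R).

Lemma foliated_open A : open A -> open (V `&` phi @^-1` A).
Proof.
have [oV [cphi _ _] _ _] := fol.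
move=> oA; rewrite openE => q [Vq Aq]; rewrite /interior.
have n1 : nbhs q V by exact: open_nbhs_nbhs.
have n2 : nbhs q (phi @^-1` A) by apply: (cphi q Vq); exact: open_nbhs_nbhs.
exact: filterI n1 n2.
Qed.

Lemma foliated_mem q : V q -> M (phi q).
Proof.
have [oV [_ _ im] _ _] := fol.
move=> Vq; have [G _ E] := im V oV (fun _ h => h).
have : (phi @` V) (phi q) by exists q.
by rewrite E => -[].
Qed.

Variable c : chart R 2 X.
Hypothesis ac : atlas c.
Let F q := coord c (phi q).
Let V' := V `&` phi @^-1` dom c.

Lemma foliated_Ck : Ck_on 3 V' F.
Proof. by have [_ _ CF _] := fol; exact: CF. Qed.

Lemma foliated_holo q : V' q -> 'D_db F q = Jmul ('D_da F q).
Proof.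
move=> V'q; have [_ _ _ H] := fol; have [_ W0] := H c q ac V'q.1 V'q.2.
have dF := Ck_diff foliated_Ck V'q.
apply/rowP => i; case: (split_ordP i) => k ->.
  have [h1 h2] := wirtbar0 (W0 k).
  rewrite Jmul_l; exact: (etrans (esym (derive_coord db _ dF))
    (etrans h1 (f_equal -%R (derive_coord da _ dF)))).
have [h1 h2] := wirtbar0 (W0 k).
rewrite Jmul_r; exact: (etrans (esym (derive_coord db _ dF))
  (etrans h2 (derive_coord da _ dF))).
Qed.

(** The three vectors are the images of the coordinate directions under the
    injective derivative of the parametrization. *)
Lemma foliated_free q : V' q -> forall c1 c2 c3 : R,
  c1 *: 'D_da F q + c2 *: 'D_db F q + c3 *: 'D_dt F q = 0 ->
  [/\ c1 = 0, c2 = 0 & c3 = 0].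
Proof.
move=> V'q c1 c2 c3; have [_ _ _ H] := fol; have [imm _] := H c q ac V'q.1 V'q.2.
have dF := Ck_diff foliated_Ck V'q.
rewrite -!(deriveZv _ _ dF) -!(deriveDv _ _ dF) => /imm E.
have E1 : c1 *: xdir R (0 : 'I_1) + c2 *: ydir R (0 : 'I_1) = 0.
  by have := f_equal fst E; rewrite /= scaler0 addr0.
have E3 := f_equal snd E.
split.
- have := f_equal (fun w : cspace R 1 => w 0 (lshift 1 0)) E1.
  by rewrite !mxE /= mulr1 mulr0 addr0.
- have := f_equal (fun w : cspace R 1 => w 0 (rshift 1 0)) E1.
  by rewrite !mxE /= mulr1 mulr0 add0r.
- by move: E3; rewrite /= !scaler0 !add0r /GRing.scale /= mulr1.
Qed.

End FoliatedFrame.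

(** * The value of the local exponent *)


Fact ratio_aux (R : realType) (N Z x : R) : x != 0 -> 0 < Z - N ->
  ((Z - N) / (4 * x ^+ 2))%:C != 0 :> R[i] /\
  ((Z - N) / Z)%:C = (1 + (N / (4 * x ^+ 2))%:C / ((Z - N) / (4 * x ^+ 2))%:C)^-1 :> R[i].
Proof.
move=> x0 ZN.
have d0 : 4 * x ^+ 2 != 0 by rewrite mulf_neq0 ?expf_neq0 // pnatr_eq0.
have n0 : Z - N != 0 by rewrite gt_eqF.
split.
  by rewrite (inj_eq (@complexI _)) mulf_neq0 // invr_eq0.
rewrite -[1]/((1 : R)%:C) -fmorphV -rmorphM -rmorphD -fmorphV; congr (_%:C).
have -> : 1 + N / (4 * x ^+ 2) * ((Z - N) / (4 * x ^+ 2))^-1 = Z / (Z - N).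
  by field; rewrite x0 n0.
by rewrite invf_div.
Qed.

Theorem corollary1p2 (R : realType) (X : complex_manifold R 2)
    (Omega : set X) (delta : X -> R) :
  domain Omega ->
  compact (closure Omega) ->
  Ck_boundary 3 Omega ->
  levi_flat (bdry Omega) ->
  boundary_distance 3 Omega delta ->
  0 < DF_exponent Omega delta ->
  forall p : X, bdry Omega p ->
  forall (V : set (fdom R)) (phi : fdom R -> X) (q : fdom R),
    foliated_chart (bdry Omega) V phi -> V q -> phi q = p ->
  let Theta := Theta_coef (induced_metric delta phi) q in
  let A := A_coef (induced_metric delta phi) q in
  ~ (Theta = 0 /\ A = 0) ->
  Theta != 0 /\
  (local_DF_exponent Omega delta p)%:C = (1 + A / Theta)^-1.
Proof.
move=> [_ oOm _] _ _ _ bd DF p bp V phi q fol Vq pE Theta A nz.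
have bdE := bdry_open oOm.
have [[W [oW clW Cd]] OmE gradE] := bd.
have dpos x : Omega x -> 0 < delta x by rewrite OmE => -[].
have [clp nOmp] : closure Omega p /\ ~ Omega p by move: bp; rewrite bdE.
have OmW : Omega `<=` W by move=> x /subset_closure /clW.
pose c := chart_at p.
have ac : atlas c by exact: chart_at_atlas.
have cp : dom c p by exact: chart_at_dom.
have oV : open (V `&` phi @^-1` dom c) := foliated_open fol (dom_open c).
pose V' := V `&` phi @^-1` dom c.
have V'q : V' q by split=> //; rewrite /preimage /= pE.
pose F q' := coord c (phi q').
have Fq : F q = coord c p by rewrite /F pE.
pose B := coord c @` (dom c `&` W).
pose u y := delta (coordV c y) : R^o.
pose Om := coord c @` (dom c `&` Omega).
have oB : open B by exact: chart_image_open.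
have Cu : Ck_on 3 B u := Cd c ac.
have CF : Ck_on 3 V' F := foliated_Ck fol ac.
have Mphi q' : V q' -> bdry Omega (phi q') := foliated_mem fol (q := q').
have Wphi q' : V q' -> W (phi q').
  by move=> /Mphi; rewrite bdE => -[/clW].
have FB q' : V' q' -> B (F q').
  by move=> [Vq' cq']; apply/chart_image_mem => //; exact: Wphi.
have uF q' : V' q' -> u (F q') = 0.
  move=> [Vq' cq']; rewrite /u /F coordK //.
  exact: (boundary_distance_eq0 oOm bd (Mphi q' Vq')).
have JF := foliated_holo fol ac.
have frF := foliated_free fol ac.
have [_ [_ _ im] _ _] := fol.
have [G oG GE] := im V' oV (@subIsetl _ V _).
have Gp : G p.
  have : (phi @` V') p by exists q.
  by rewrite GE => -[].
pose D := coord c @` (dom c `&` (W `&` G)).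
have oD : open D by apply: chart_image_open; exact: openI.
have Dq : D (F q) by rewrite Fq; apply/chart_image_mem => //; split=> //; exact: clW.
have DB : D `<=` B by move=> _ [x [cx [Wx _]] <-]; exists x.
have oOmD : open (Om `&` D) by apply: openI => //; exact: chart_image_open.
have upos y : D y -> Om y -> 0 < u y.
  by move=> _ [x [cx Ox] <-]; rewrite /u coordK //; exact: dpos.
have bdD y : D y -> closure Om y -> ~ Om y -> exists2 q', V' q' & F q' = y.
  move=> [x [cx [Wx Gx]] <-] /(closure_chart Omega cx) clx nOm.
  have : (bdry Omega `&` G) x.
    by rewrite bdE; split=> //; split=> // Ox; apply: nOm; exists x.
  by rewrite -GE => -[q' V'q' qE]; exists q' => //; rewrite /F qE.
have clOm : closure Om (F q) by rewrite Fq; apply/closure_chart.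
have du0 : exists w, 'D_w u (F q) <> 0.
  by have [w wE] := gradE p bp; exists w; rewrite Fq.
pose H := normal_der (dir_t R) F u.
have H0 : H q != 0.
  exact: (normal_der_neq0 oV V'q CF Cu FB uF JF frF du0).
have hH q' : V' q' -> induced_metric delta phi q' = `|H q'|.
  move=> V'q'; apply: (induced_metric_chart ac oW Cd _ V'q'.1 (Wphi _ V'q'.1) V'q'.2).
  - by have [_ []] := fol.
  - exact: (Ck_diff CF V'q').
have dH q' : V' q' -> differentiable H q'.
  by move=> V'q'; have [] := derive_H (dir_t R) oB CF Cu FB 0 V'q'.
have d2H v : differentiable ('D_v H) q.
  by have [] := derive2_H oV (dir_t R) oB CF Cu FB v 0 V'q.
have symH := derive2_H_sym oV (dir_t R) oB CF Cu FB (dir_a R) (dir_b R) V'q.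
have AE : A = _ := A_coefE oV V'q H0 hH dH.
have TE : Theta = _ := Theta_coefE oV V'q H0 hH dH d2H symH.
clearbody Theta A.
have nec := @local_necessary R _ _ _ _ V' F B Om D u q oV V'q oB CF Cu FB uF JF frF
  oD Dq DB oOmD upos bdD clOm du0.
have suf := @local_sufficient R _ _ _ _ V' F B Om D u q oV V'q oB CF Cu FB uF JF frF
  oD Dq DB oOmD upos bdD du0.
rewrite Fq in nec suf.
move: AE TE nec suf; rewrite -/H.
move: ('D_(dir_a R) H q) ('D_(dir_b R) H q) => Ha Hb.
move: ('D_(dir_a R) ('D_(dir_a R) H) q + 'D_(dir_b R) ('D_(dir_b R) H) q) => L.
pose N : R := Ha ^+ 2 + Hb ^+ 2; pose Z : R := 2 * N - H q * L.
rewrite -/N -/Z => AE TE nec suf.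
have ZE : N - H q * L = Z - N by rewrite /Z; ring.
rewrite ZE in TE.
have N0 : 0 <= N by rewrite addr_ge0 ?sqr_ge0.
have [||||T0 supE] := @sup_threshold R [set eta : R | [/\ 0 < eta, eta < 1 &
    exists U : set X, [/\ open U, U p &
      spsh_on (U `&` Omega) (fun x => - (delta x `^ eta))]]] N Z N0.
- by move=> [z1 z2]; apply: nz; split; [rewrite TE z1 mul0r|rewrite AE z2 mul0r].
- move=> e [e0 e1 [U [oU Up sU]]]; split; [exact: e0|exact: e1|].
  exact: (nec e e0 (spsh_near ac cp oOm oU Up sU)).
- move=> e e0 e1 eZ; split; [exact: e0|exact: e1|].
  exact: (near_spsh ac cp oOm OmW Cd dpos (suf e e0 e1 eZ)).
- (* a positive global exponent is witnessed by some eta, and the compact set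
     excluded there stays away from p *)
  have [e [e0 e1 [K [cK KO sK]]]] : [set eta : R | [/\ 0 < eta, eta < 1 &
      exists K : set X, [/\ compact K, K `<=` Omega &
        spsh_on (Omega `\` K) (fun x => - (delta x `^ eta))]]] !=set0.
    apply/set0P; apply: contraTneq DF => S0.
    by rewrite /DF_exponent S0 sup0 ltxx.
  have nK : open (~` K) by exact/closed_openC/(compact_closed (@space_hausdorff _ _ X)).
  have pK : (~` K) p by move=> /KO.
  have sK' : spsh_on (~` K `&` Omega) (fun x => - (delta x `^ e)) by rewrite setIC -setDE.
  exists e; split; [exact: e0|exact: e1|].
  exact: (nec e e0 (spsh_near ac cp oOm nK pK sK')).
have [R1 R2] := ratio_aux H0 T0.
rewrite TE AE; split; first exact: R1.
exact: (etrans (f_equal (fun x : R => x%:C) supE) R2).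
Qed.
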